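(* For $t\in\mathbb{C}$ let $\mathcal{L}_t:\mathcal{A}_\infty(U)^{\oplus k}\to\mathcal{A}_\infty(U)^{\oplus k}$ be defined by $(\mathcal{L}_t\mathbf{w})_i(z)=\sum_{j=1}^k p_{ij}e^{t\,\ell_{j}(z)}w_j(\widehat{M}_jz)$, $1\le i\le k$, where $\ell_j(z)=\frac12\log\bigl[\sum_{r=1}^d ((M_jz)_r)^2\bigr]$. Then when $|t|$ is sufficiently small, we can write $$\mathcal{L}_t=\beta(t)\mathcal{N}(t)+\mathcal{Q}(t),$$ where $\beta(t)$ is the unique eigenvalue of maximal modulus of $\mathcal{L}_t$, $\mathcal{N}(t)$ is a rank-one projection, $\mathcal{Q}(t)$ has spectral radius strictly smaller than $|\beta(t)|$, and $\mathcal{N}(t)\mathcal{Q}(t)=\mathcal{Q}(t)\mathcal{N}(t)=0$. Moreover $\beta(t)$, $\mathcal{N}(t)$ and $\mathcal{Q}(t)$ are analytic with respect to $t$. When $t=0$, we have $\beta(0)=1$, and for every $\mathbf{f}=(f_1,\dots,f_k)\in\mathcal{C}(\overline{V},\mathbb{R})^{\oplus k}$, $$\mathcal{N}(0)\mathbf{f}=\int\mathbf{f}\,\mathrm{d}\nu^*$$ (the scalar on the right being read as the constant vector $(\int\mathbf{f}\,\mathrm{d}\nu^* )\mathbf{1}^{\oplus k}$), and $\|\mathcal{Q}'(0)\|$ is bounded.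
   Context: Let $d\ge 2$, $k\ge1$, let $M_1,\dots,M_k\in GL(d,\mathbb{R})$ be matrices with all entries strictly positive, let $P=(p_{ij})_{1\le i,j\le k}$ be a stochastic matrix with all entries strictly positive, and let $\mathbf{q}=(q_1,\dots,q_k)$ be the stationary distribution of $P$. Put $C_+^{d-1}=\{(1,z_2,\dots,z_d): z_i\in\mathbb{C},\ \operatorname{Re} z_i>0\}$, identified with an open subset of $\mathbb{C}^{d-1}$ by dropping the first coordinate. For a positive matrix $M$, $\widehat{M}(z)=Mz/(Mz)_1$, where $(Mz)_r$ is the $r$-th entry of $Mz$. Throughout, $U\subset C_+^{d-1}$ is a fixed bounded, nonempty, connected open set such that $V:=\operatorname{Re} U=\{\operatorname{Re} z:z\in U\}$ is a connected open subset of $\{(1,x_2,\dots,x_d):x_i\in\mathbb{R},\ x_i>0\}$ contained in $U$, and such that for each $i$: $\overline{\widehat{M}_i(U)}\subseteq U$, $\widehat{M}_i|_U$ is complex analytic, $\overline{\widehat{M}_i(V)}\subseteq V$, and $\widehat{M}_i|_V$ is real analytic; moreover $U$ is such that $\sum_{r}((M_jz)_r)^2$ takes no value in $(-\infty,0]$ for $z\in U$ and each $\ell_j$ belongs to $\mathcal{A}_\infty(U)$ (such $U$ exist). For real $z$, $\ell_j(z)=\log\|M_jz\|$ with $\|\cdot\|$ the Euclidean norm. $\mathcal{A}_\infty(U)$ is the Banach space of complex analytic functions on $U$ with continuous extension to $\partial U$, with the supremum norm; $\mathcal{A}_\infty(U)^{\oplus k}$ is the direct sum of $k$ copies, with norm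 $\|\mathbf{w}\|=\sum_{i=1}^k q_i\|w_i\|$. $\mathcal{C}(\overline{V},\mathbb{R})$ is the space of continuous real functions on $\overline{V}$ with the supremum norm, and $\mathcal{C}(\overline{V},\mathbb{R})^{\oplus k}$ is the direct sum of $k$ copies. By convention, operators defined on the analytic function spaces are also regarded, with the same notation, as operators on the corresponding spaces of continuous real functions on $\overline{V}$; this is how $\mathcal{N}(0)$ acts on $\mathcal{C}(\overline{V},\mathbb{R})^{\oplus k}$. $\mathbf{1}^{\oplus k}$ is the vector with all components the constant function $1$. $\nu^*=\oplus_{i=1}^k q_i\nu_i^*$, with $\int\mathbf{f}\,\mathrm{d}\nu^*=\sum_i q_i\int f_i\,\mathrm{d}\nu_i^*$, where $\nu_1^*,\dots,\nu_k^*$ are the unique probability measures on $\overline{V}$ such that $\int\mathcal{L}_0\mathbf{f}\,\mathrm{d}\nu^*=\int\mathbf{f}\,\mathrm{d}\nu^*$ for all $\mathbf{f}\in\mathcal{C}(\overline{V},\mathbb{R})^{\oplus k}$ ($\mathcal{L}_0$ acting by the same formula). *)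

(* Defs.v *)
From HB Require Import structures.
From mathcomp Require Import all_boot all_order all_algebra.
From mathcomp Require Import complex.
From mathcomp Require Import all_classical all_reals all_analysis.
Set Implicit Arguments.
Unset Strict Implicit.
Unset Printing Implicit Defensive.
Import Order.TTheory GRing.Theory Num.Theory numFieldNormedType.Exports.
Local Open Scope classical_set_scope.
Local Open Scope ring_scope.

(* R[i] has no topology of its own in the library: the topology and the norm
   come from its being (the sort of) a numFieldType. *)
Definition Cx (R : realType) : numClosedFieldType := R[i]%C.

Definition toC (R : realType) (x : R) : Cx R := x%:C%C.

Definition reC (R : realType) (z : Cx R) : R := complex.Re z.

(* The norm `|z| of Cx R is an element of Cx R; cmod z is the same number
   as a real. *)
Definition cmod (R : realType) (z : Cx R) : R := reC `|z|.

Definition cexp (R : realType) (z : Cx R) : Cx R :=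
  let: (a +i* b)%C := z in
  ((expR a * cos b) +i* (expR a * sin b))%C.

Definition carg (R : realType) (z : Cx R) : R :=
  if 0 <= complex.Im z then acos (reC z / cmod z)
  else - acos (reC z / cmod z).

Definition clog (R : realType) (z : Cx R) : Cx R := (ln (cmod z) +i* carg z)%C.

Section Analytic.
Variables (K : numFieldType) (n : nat).

(* Sum of the terms of a power series in n variables whose multi-index has all
   its entries smaller than N. *)
Definition cube_sum (a : ('I_n -> nat) -> K) (h : 'I_n -> K) (N : nat) : K :=
  \sum_(al : {ffun 'I_n -> 'I_N})
    a (fun i => al i) * \prod_(i < n) h i ^+ al i.

(* f is the sum of a power series on a polydisc around z. The series is asked
   to converge absolutely at polyradius r, which is no restriction since r may
   be decreased; this makes the order of summation irrelevant. *)
Definition analytic_at (f : 'cV[K]_n -> K) (z : 'cV[K]_n) : Prop :=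
  exists (a : ('I_n -> nat) -> K) (r B : K),
    [/\ 0 < r,
        forall N, cube_sum (fun al => `|a al|) (fun=> r) N <= B &
        forall h : 'cV[K]_n, (forall i, `|h i 0| < r) ->
          cube_sum a (fun i => h i 0) N @[N --> \oo] --> f (z + h)].

Definition analytic_on (U : set 'cV[K]_n) (f : 'cV[K]_n -> K) : Prop :=
  forall z, U z -> analytic_at f z.

Lemma analytic_at_lin (a : K) (f g : 'cV[K]_n -> K) (z : 'cV[K]_n) :
  analytic_at f z -> analytic_at g z -> analytic_at (a *: f + g) z.
Proof.
move=> [u [r [B [r0 uB uf]]]] [v [s [D [s0 vD vg]]]].
have rr : r \is Num.real by rewrite realE ltW.
have sr : s \is Num.real by rewrite realE ltW.
have [m [m0 mr ms]] : exists m : K, [/\ 0 < m, m <= r & m <= s].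
  by have /orP[rs|sr'] := real_leVge rr sr; [exists r|exists s].
have mono (w : ('I_n -> nat) -> K) (t : K) N : m <= t ->
    cube_sum (fun al => `|w al|) (fun=> m) N <=
    cube_sum (fun al => `|w al|) (fun=> t) N.
  move=> mt; apply: ler_sum => al _; apply: ler_wpM2l => //.
  apply: ler_prod => i _; rewrite exprn_ge0 ?(ltW m0)//=.
  by apply: lerXn2r => //; rewrite nnegrE ltW// (lt_le_trans m0).
have lin (h : 'I_n -> K) N : cube_sum (fun al => a * u al + v al) h N =
    a * cube_sum u h N + cube_sum v h N.
  rewrite /cube_sum mulr_sumr -big_split/=; apply: eq_bigr => al _.
  by rewrite mulrDl mulrA.
exists (fun al => a * u al + v al), m, (`|a| * B + D); split=> //.
  move=> N; apply: (@le_trans _ _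
    (`|a| * cube_sum (fun al => `|u al|) (fun=> m) N +
     cube_sum (fun al => `|v al|) (fun=> m) N)).
    rewrite /cube_sum mulr_sumr -big_split/=; apply: ler_sum => al _.
    rewrite mulrA -mulrDl; apply: ler_wpM2r.
      by apply: prodr_ge0 => i _; rewrite exprn_ge0// ltW.
    by rewrite -normrM; exact: ler_normD.
  apply: lerD; last exact: le_trans (mono _ _ _ ms) (vD N).
  by apply: ler_wpM2l => //; exact: le_trans (mono _ _ _ mr) (uB N).
move=> h hm; rewrite (_ : (fun N => _) = (fun N =>
   a * cube_sum u (fun i => h i 0) N + cube_sum v (fun i => h i 0) N));
  last by apply/funext => N; exact: lin.
apply: cvgD; last by apply: vg => i; exact: lt_le_trans (hm i) ms.
by apply: cvgMr; apply: uf => i; exact: lt_le_trans (hm i) mr.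
Qed.

Lemma analytic_at0 (z : 'cV[K]_n) : analytic_at 0 z.
Proof.
exists (fun=> 0), 1, 0; split=> //.
  by move=> N; rewrite /cube_sum big1// => al _; rewrite normr0 mul0r.
move=> h _; rewrite (_ : (fun N => _) = fun=> 0); first exact: cvg_cst.
by apply/funext => N; rewrite /cube_sum big1// => al _; rewrite mul0r.
Qed.

End Analytic.

Section Ainf.
Variables (R : realType) (n : nat) (U : set 'cV[Cx R]_n).
Local Notation C := (Cx R).

Definition in_Ainf (f : 'cV[C]_n -> C) : Prop :=
  analytic_on U f /\
  exists g : 'cV[C]_n -> C,
    {within closure U, continuous g} /\ forall z, U z -> g z = f z.

(* Functions on U are represented by their extension by 0 outside U, so that
   equality is equality on U. *)
Definition Ainf_pred : {pred 'cV[C]_n -> C} :=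
  fun f => `[< in_Ainf f /\ forall z, ~ U z -> f z = 0 >].

Lemma Ainf_submod : submod_closed Ainf_pred.
Proof.
split.
  apply/asboolP; split=> //; split; first by move=> z _; exact: analytic_at0.
  by exists (fun=> 0); split=> // z; exact: cvg_cst.
move=> a f g /asboolP[[af [f' [cf ff]]] f0] /asboolP[[ag [g' [cg gg]]] g0].
apply/asboolP; split; last first.
  move=> z Uz; rewrite (_ : (a *: f + g) z = a * f z + g z)//.
  by rewrite f0// g0// mulr0 addr0.
split; first by move=> z Uz; apply: analytic_at_lin; [exact: af|exact: ag].
exists (fun z => a * f' z + g' z); split; last by move=> z Uz; rewrite ff// gg.
move=> z; apply: cvgD; last exact: cg.
by apply: cvgMr; exact: cf.
Qed.

HB.instance Definition _ :=
  GRing.isSubmodClosed.Build C ('cV[C]_n -> C) Ainf_pred Ainf_submod.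

Record Ainf := MkAinf {
  Ainf_val :> 'cV[C]_n -> C;
  _ : Ainf_val \in Ainf_pred }.

HB.instance Definition _ := [isSub for Ainf_val].
HB.instance Definition _ := [Choice of Ainf by <:].
HB.instance Definition _ := [SubChoice_isSubLmodule of Ainf by <:].

Definition Ainf_norm (f : Ainf) : R := sup [set cmod (f z) | z in U].

End Ainf.

Section Cbar.
Variables (R : realType) (n : nat) (V : set 'cV[R]_n).

(* Extension by 0 outside the closure of V, as above. *)
Definition Cbar_pred : {pred 'cV[R]_n -> R} :=
  fun f => `[< {within closure V, continuous f} /\
               forall x, ~ closure V x -> f x = 0 >].

Lemma Cbar_submod : submod_closed Cbar_pred.
Proof.
split; first by apply/asboolP; split=> // z; exact: cvg_cst.
move=> a f g /asboolP[cf f0] /asboolP[cg g0]; apply/asboolP; split.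
  by move=> z; apply: cvgD; [apply: cvgMr; exact: cf|exact: cg].
move=> z Vz; rewrite (_ : (a *: f + g) z = a * f z + g z)//.
by rewrite f0// g0// mulr0 addr0.
Qed.

HB.instance Definition _ :=
  GRing.isSubmodClosed.Build R ('cV[R]_n -> R) Cbar_pred Cbar_submod.

Record Cbar := MkCbar {
  Cbar_val :> 'cV[R]_n -> R;
  _ : Cbar_val \in Cbar_pred }.

HB.instance Definition _ := [isSub for Cbar_val].
HB.instance Definition _ := [Choice of Cbar by <:].
HB.instance Definition _ := [SubChoice_isSubLmodule of Cbar by <:].

Definition Cbar_norm (f : Cbar) : R := sup [set `|f x| | x in closure V].

End Cbar.

Definition sum_norm (R : realType) (k : nat) (q : 'I_k -> R)
    (K : numFieldType) (E : lmodType K) (nm : E -> R)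
    (w : {ffun 'I_k -> E}) : R :=
  \sum_(i < k) q i * nm (w i).

Definition bounded_op (R : realType) (K : numFieldType) (E : lmodType K)
    (nm : E -> R) (T : E -> E) : Prop :=
  linear T /\ exists c : R, forall w, nm (T w) <= c * nm w.

Section Operators.
Variables (R : realType) (E : lmodType (Cx R)) (nm : E -> R).
Local Notation C := (Cx R).

Definition opnorm (T : E -> E) : \bar R :=
  ereal_sup [set (nm (T w))%:E | w in [set w | nm w <= 1]].

Definition eigenvalue (T : E -> E) (la : C) : Prop :=
  exists w, w != 0 /\ T w = la *: w.

Definition max_modulus_eigenvalue (T : E -> E) (la : C) : Prop :=
  eigenvalue T la /\
  forall mu, eigenvalue T mu -> mu != la -> cmod mu < cmod la.

Definition spectrum (T : E -> E) : set C :=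
  [set la | ~ exists S : E -> E,
     [/\ bounded_op nm S, forall w, S (la *: w - T w) = w
       & forall w, la *: S w - T (S w) = w]].

Definition spectral_radius (T : E -> E) : \bar R :=
  ereal_sup [set (cmod la)%:E | la in spectrum T].

Definition rank_one_projection (N : E -> E) : Prop :=
  [/\ bounded_op nm N, forall w, N (N w) = N w
    & exists v, v != 0 /\ range N = [set c *: v | c in [set: C]]].

Definition op_analytic_at (F : C -> E -> E) (t0 : C) : Prop :=
  exists (a : nat -> E -> E) (r : R),
    [/\ forall m, bounded_op nm (a m), 0 < r &
        forall h : C, cmod h < r ->
          opnorm (fun w => F (t0 + h) w - \sum_(m < N) h ^+ m *: a m w)
            @[N --> \oo] --> 0%E].

Definition op_derivative (F : C -> E -> E) (t0 : C) (D : E -> E) : Prop :=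
  linear D /\
  opnorm (fun w => h^-1 *: (F (t0 + h) w - F t0 w) - D w)
    @[h --> (0 : C)^'] --> 0%E.

End Operators.

Definition scalar_analytic_at (R : realType) (f : Cx R -> Cx R) (t0 : Cx R) :
    Prop :=
  exists (a : nat -> Cx R) (r : R),
    0 < r /\
    forall h : Cx R, cmod h < r ->
      \sum_(m < N) a m * h ^+ m @[N --> \oo] --> f (t0 + h).

(* The point (1, z_2, ..., z_d) is represented by the column (z_2, ..., z_d),
   with d = 1 + n; lin_act M z is M (1, z_2, ..., z_d)^T, and proj_act M z is
   lin_act M z divided by its first entry, that entry being dropped. *)
Section Action.
Variables (K : fieldType) (n : nat).

Definition lin_act (M : 'M[K]_(1 + n)) (z : 'cV[K]_n) : 'cV[K]_(1 + n) :=
  M *m col_mx 1%:M z.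

Definition proj_act (M : 'M[K]_(1 + n)) (z : 'cV[K]_n) : 'cV[K]_n :=
  (lin_act M z 0 0)^-1 *: dsubmx (lin_act M z).

End Action.

Definition mxC (R : realType) (m n : nat) (A : 'M[R]_(m, n)) : 'M[Cx R]_(m, n) :=
  map_mx (@toC R) A.

Definition mxRe (R : realType) (m n : nat) (A : 'M[Cx R]_(m, n)) : 'M[R]_(m, n) :=
  map_mx (@reC R) A.

Definition sum_squares (R : realType) (n : nat) (M : 'M[R]_(1 + n))
    (z : 'cV[Cx R]_n) : Cx R :=
  \sum_(r < 1 + n) (lin_act (mxC M) z r 0) ^+ 2.

Definition ell (R : realType) (n : nat) (M : 'M[R]_(1 + n))
    (z : 'cV[Cx R]_n) : Cx R :=
  2^-1 * clog (sum_squares M z).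

(* T is the operator L_t. Points of the boundary of U are left out because
   there ell need not be the continuous extension of its values on U. The formula determines T, as elements of Ainf U
   vanish outside U. *)
Definition is_transfer_op (R : realType) (n k : nat) (U : set 'cV[Cx R]_n)
    (M : 'I_k -> 'M[R]_(1 + n)) (p : 'I_k -> 'I_k -> R) (t : Cx R)
    (T : {ffun 'I_k -> Ainf U} -> {ffun 'I_k -> Ainf U}) : Prop :=
  forall w i z, U z ->
    T w i z = \sum_(j < k)
      toC (p i j) * cexp (t * ell (M j) z) * w j (proj_act (mxC (M j)) z).

(* L_0 acting on continuous real functions; the factor exp (0 * l_j) is 1. *)
Definition real_transfer0 (R : realType) (n k : nat) (V : set 'cV[R]_n)
    (M : 'I_k -> 'M[R]_(1 + n)) (p : 'I_k -> 'I_k -> R)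
    (f : {ffun 'I_k -> Cbar V}) (i : 'I_k) (x : 'cV[R]_n) : R :=
  \sum_(j < k) p i j * f j (proj_act (M j) x).

Definition borel_cV (R : realType) (n : nat) :=
  g_sigma_algebraType (@open 'cV[R]_n).

Definition sum_integral (R : realType) (n k : nat) (V : set 'cV[R]_n)
    (q : 'I_k -> R) (nu : 'I_k -> probability (borel_cV R n) R)
    (f : 'I_k -> 'cV[R]_n -> R) : R :=
  \sum_(i < k) q i * \int[nu i]_(x in closure V) f i x.

(* NC is the bounded operator on continuous real functions which an operator N
   on analytic functions induces: whenever w restricts to the real function f
   on V, N w restricts to NC f on V. (Continuity makes it equivalent to ask
   this on V or on its closure, which need not be contained in U.) *)
Definition induced_op (R : realType) (n k : nat) (U : set 'cV[Cx R]_n)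
    (V : set 'cV[R]_n) (q : 'I_k -> R)
    (N : {ffun 'I_k -> Ainf U} -> {ffun 'I_k -> Ainf U})
    (NC : {ffun 'I_k -> Cbar V} -> {ffun 'I_k -> Cbar V}) : Prop :=
  bounded_op (sum_norm q (@Cbar_norm R n V)) NC /\
  forall (w : {ffun 'I_k -> Ainf U}) (f : {ffun 'I_k -> Cbar V}),
    (forall i x, V x -> w i (mxC x) = toC (f i x)) ->
    forall i x, V x -> N w i (mxC x) = toC (NC f i x).

(* Main.v *)
(**
Re g satisfies Harnack's inequality when it is nonnegative on U, and the images of U have closure in
U; hence L_0 maps a function of oscillation d to one of oscillation at most gam d with gam < 1, as in
Doeblin's argument for Markov chains. For small t this contraction survives on normalised functions:
iterating w |-> L_t w / (L_t w)(x0) gives an eigenvector v(t) with eigenvalue beta(t), and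
phi_t(w) = lim (L_t^m w)(x0) / beta(t)^m is the eigenfunctional, so that N(t) w = phi_t(w) v(t).
The iterates of Q(t) = L_t - beta(t) N(t) are O(g^m) for some g < |beta(t)|, and the
Neumann series bounds the spectral radius. All these objects are uniform limits of functions that are
holomorphic in t when evaluated at a point, and Cauchy's estimates, uniform in the point, turn
pointwise holomorphy into operator power series.

At t = 0 the functions L_0^m w converge uniformly to a constant, which invariance of nu* identifies
with the integral of w. The induced operator is unique because polynomials, which belong to the
analytic space, are dense in the continuous functions on the closure of V.
*)

Require Import Defs.
From HB Require Import structures.
From mathcomp Require Import all_boot all_order all_algebra.
From mathcomp Require Import complex.
From mathcomp Require Import all_classical all_reals all_analysis.
From mathcomp Require Import ring lra.
Import Order.TTheory GRing.Theory Num.Theory numFieldNormedType.Exports.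
Local Open Scope classical_set_scope.
Local Open Scope ring_scope.
Set Implicit Arguments.
Unset Strict Implicit.
Unset Printing Implicit Defensive.

(** * The modulus and strict complex differentiability *)

(** The obstacle is function theory in several complex variables. Power series are awkward to
    compose, to invert or to pass to limits with, so analyticity is traded for strict
    differentiability, which every operation in the transfer operator preserves. The way back to
    power series is discrete: polynomials interpolating on grids of roots of unity, with bounds
    uniform in the number of roots. Averages over the same grids yield Cauchy's estimates and, as
    Carathéodory's coefficient bound, Harnack's inequality.

    The perturbation argument only sees a vector space with separating evaluations [ev x], where [x]
    is later a component index together with a point of [U]. Estimates are thus about numbers, and
    the weighted norm enters through its equivalence with the supremum over all evaluations.

    All constants hang on [s = 1 - gam]. Perturbations of size [s ^ 2 / 512] preserve the functions
    with value 1 at [x0] and oscillation at most [s / 64], up to normalisation, and contract their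
    differences by [1 - s / 2]. The eigenvalue stays within [s / 32] of 1, hence above the
    contraction rate. *)

Section ComplexModulus.
Variable R : realType.
Local Notation C := (Cx R).
Implicit Types (x y z : C) (r : R).

Lemma cmodE z : toC (cmod z) = `|z|.
Proof. by rewrite /toC /cmod /reC normc_def. Qed.

Lemma toC_inj : injective (@toC R).
Proof. by move=> x y []. Qed.

Lemma toCD r s : toC (r + s) = toC r + toC s.
Proof. exact: (raddfD (real_complex R)). Qed.

Lemma toCB r s : toC (r - s) = toC r - toC s.
Proof. exact: (raddfB (real_complex R)). Qed.

Lemma toCM r s : toC (r * s) = toC r * toC s.
Proof. exact: (rmorphM (real_complex R)). Qed.

Lemma toC0 : toC (0 : R) = 0. Proof. by []. Qed.
Lemma toC1 : toC (1 : R) = 1. Proof. by []. Qed.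

Lemma toCX r n : toC (r ^+ n) = toC r ^+ n.
Proof. exact: (rmorphXn (real_complex R)). Qed.

Lemma toC_sum (I : Type) (s : seq I) (P : pred I) (F : I -> R) :
  toC (\sum_(i <- s | P i) F i) = \sum_(i <- s | P i) toC (F i).
Proof. exact: (raddf_sum (real_complex R)). Qed.

Lemma lerC r s : (toC r <= toC s :> C) = (r <= s).
Proof. exact: lecR. Qed.

Lemma ltrC r s : (toC r < toC s :> C) = (r < s).
Proof. exact: ltcR. Qed.

Lemma cmod_ge0 z : 0 <= cmod z.
Proof. by rewrite -lerC cmodE; exact: normr_ge0. Qed.

Lemma cmodM x y : cmod (x * y) = cmod x * cmod y.
Proof. by apply: toC_inj; rewrite toCM !cmodE normrM. Qed.

Lemma cmodN z : cmod (- z) = cmod z.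
Proof. by rewrite /cmod normrN. Qed.

Lemma cmodD x y : cmod (x + y) <= cmod x + cmod y.
Proof. by rewrite -lerC toCD !cmodE ler_normD. Qed.

Lemma cmodB x y : cmod (x - y) = cmod (y - x).
Proof. by rewrite /cmod distrC. Qed.

Lemma cmodBle x y : cmod (x - y) <= cmod x + cmod y.
Proof. by rewrite -(cmodN y) cmodD. Qed.

Lemma cmod0 : cmod (0 : C) = 0.
Proof. by rewrite /cmod normr0. Qed.

Lemma cmod1 : cmod (1 : C) = 1.
Proof. by rewrite /cmod normr1. Qed.

Lemma cmod_eq0 z : (cmod z == 0) = (z == 0).
Proof. by rewrite -(inj_eq toC_inj) cmodE normr_eq0. Qed.

Lemma cmod_gt0 z : (0 < cmod z) = (z != 0).
Proof. by rewrite lt_def cmod_ge0 andbT cmod_eq0. Qed.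

Lemma cmodX z n : cmod (z ^+ n) = cmod z ^+ n.
Proof. by apply: toC_inj; rewrite toCX !cmodE normrX. Qed.

Lemma cmodV z : cmod z^-1 = (cmod z)^-1.
Proof.
have [->|z0] := eqVneq z 0; first by rewrite invr0 cmod0 invr0.
have zn : cmod z != 0 by rewrite cmod_eq0.
by apply: (mulfI zn); rewrite -cmodM !mulfV ?cmod1.
Qed.

Lemma cmod_toC r : cmod (toC r) = `|r|.
Proof.
by rewrite /cmod /reC normc_def /= expr0n /= addr0 sqrtr_sqr.
Qed.

Lemma cmod_sum (I : Type) (s : seq I) (P : pred I) (F : I -> C) :
  cmod (\sum_(i <- s | P i) F i) <= \sum_(i <- s | P i) cmod (F i).
Proof.
elim/big_ind2: _ => [|u a v b ua vb|//]; first by rewrite cmod0.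
by apply: le_trans (cmodD _ _) _; exact: lerD.
Qed.

Lemma cmod_prod (I : Type) (s : seq I) (P : pred I) (F : I -> C) :
  cmod (\prod_(i <- s | P i) F i) = \prod_(i <- s | P i) cmod (F i).
Proof.
elim/big_ind2: _ => [|u a v b ua vb|//]; first by rewrite cmod1.
by rewrite cmodM ua vb.
Qed.

Lemma cmodBD x y z : cmod (x - z) <= cmod (x - y) + cmod (y - z).
Proof. by rewrite -[x - z](subrKA y) cmodD. Qed.

Lemma reCD x y : reC (x + y) = reC x + reC y.
Proof. exact: (raddfD (@complex.Re R : Rcomplex R -> R)). Qed.

Lemma reCN x : reC (- x) = - reC x.
Proof. exact: (raddfN (@complex.Re R : Rcomplex R -> R)). Qed.

Lemma reCB x y : reC (x - y) = reC x - reC y.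
Proof. by rewrite reCD reCN. Qed.

Lemma reC_sum (I : Type) (s : seq I) (P : pred I) (F : I -> C) :
  reC (\sum_(i <- s | P i) F i) = \sum_(i <- s | P i) reC (F i).
Proof. exact: (raddf_sum (@complex.Re R : Rcomplex R -> R)). Qed.

Lemma reC_toC r : reC (toC r) = r. Proof. by []. Qed.

Lemma reC_toCM r z : reC (toC r * z) = r * reC z.
Proof. by case: z => a b; rewrite /reC /= mul0r subr0. Qed.

Lemma reC_le z : `|reC z| <= cmod z.
Proof. by rewrite -lerC cmodE; exact: normc_ge_Re. Qed.

Lemma reC_le_cmod z : reC z <= cmod z.
Proof. by apply: le_trans (reC_le z); rewrite ler_norm. Qed.

Lemma reC_ge_cmod z : - cmod z <= reC z.
Proof. by have := reC_le z; rewrite ler_norml => /andP[]. Qed.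

Lemma cmod_le_ReIm z : cmod z <= `|complex.Re z| + `|complex.Im z|.
Proof.
case: z => a b; rewrite /cmod /reC normc_def /=.
rewrite -(@ler_pXn2r _ 2) ?nnegrE ?sqrtr_ge0 ?addr_ge0 //.
rewrite sqr_sqrtr ?addr_ge0 ?sqr_ge0 // sqrrD !real_normK ?num_real //.
have := mulr_ge0 (normr_ge0 a) (normr_ge0 b); lra.
Qed.

Lemma Im_le_cmod z : `|complex.Im z| <= cmod z.
Proof.
case: z => a b; rewrite /cmod /reC normc_def /= -sqrtr_sqr.
by apply: ler_wsqrtr; rewrite lerDr sqr_ge0.
Qed.

(** A positive element of [Cx R] is real, because the order only compares numbers with the same
    imaginary part. So the epsilons of its topology can be exchanged for real ones. *)
Lemma gt0_toC (e : C) : 0 < e -> exists2 r : R, 0 < r & e = toC r.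
Proof.
move=> e0; exists (reC e); last by rewrite /toC RRe_real // gtr0_real.
by rewrite -ltrC /toC RRe_real // gtr0_real.
Qed.

Lemma cvg_cmodP (T : Type) (F : set_system T) {FF : Filter F} (u : T -> C) l :
  u @ F --> l <-> forall e : R, 0 < e -> \forall t \near F, cmod (u t - l) < e.
Proof.
split=> [/cvgrPdist_lt ul e e0|ul].
  have := ul (toC e); rewrite ltrC => /(_ e0); apply: filterS => t.
  by rewrite -cmodE ltrC cmodB.
apply/cvgrPdist_lt => e /gt0_toC[r r0 ->].
by have := ul r r0; apply: filterS => t; rewrite -cmodE ltrC cmodB.
Qed.

Lemma nbhs_cV n (a : 'cV[C]_n) (P : set 'cV[C]_n) :
  nbhs a P <-> exists2 d : R, 0 < d &
    forall x : 'cV[C]_n, (forall i, cmod (x i 0 - a i 0) < d) -> P x.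
Proof.
split=> [/nbhs_ballP[e /= /gt0_toC[d d0 ->] eP]|[d d0 dP]].
  exists d => // x xa; apply: eP; split; rewrite ?ltrC // => i j.
  by rewrite /ball /= ord1 -cmodE ltrC cmodB.
apply/nbhs_ballP; exists (toC d); first by rewrite /= ltrC.
move=> x [_ ax]; apply: dP => i; have := ax i 0.
by rewrite /ball /= -cmodE ltrC cmodB.
Qed.

Lemma nbhs_C (a : C) (P : set C) :
  nbhs a P <-> exists2 d : R, 0 < d & forall x : C, cmod (x - a) < d -> P x.
Proof.
split=> [/nbhs_ballP[e /= /gt0_toC[d d0 ->] eP]|[d d0 dP]].
  exists d => // x xa; apply: eP.
  by rewrite /ball /= -cmodE ltrC cmodB.
apply/nbhs_ballP; exists (toC d); first by rewrite /= ltrC.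
move=> x; rewrite /ball /= -cmodE ltrC cmodB; exact: dP.
Qed.

End ComplexModulus.

Section StrictDifferentiability.
Variable R : realType.
Local Notation C := (Cx R).

Lemma finite_lbound (I : finType) (d : I -> R) : (forall i, 0 < d i) ->
  exists2 m, 0 < m & forall i, m <= d i.
Proof.
move=> d0; exists (\big[Num.min/1]_i d i); last first.
  by move=> i; rewrite (bigD1 i) //= ge_min lexx.
by apply: (big_ind (fun x => 0 < x)) => // u v u0 v0; rewrite lt_min u0.
Qed.

Definition polydisc n (a : 'cV[C]_n) (d : R) : set 'cV[C]_n :=
  [set x | forall i, cmod (x i 0 - a i 0) < d].

(** An upper bound of the supremum distance rather than the distance itself: no maximum over
    coordinates has to be computed. The clause [0 <= r] matters in dimension 0, where the second
    clause is empty. *)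
Definition vdist_le n (x y : 'cV[C]_n) (r : R) : Prop :=
  0 <= r /\ forall i, cmod (y i 0 - x i 0) <= r.

(* Strict complex differentiability at a: the estimate in two points is what telescopes along
   segments, so that Cauchy's theorem below needs no integral. *)
Definition sdiff n (f : 'cV[C]_n -> C) (a : 'cV[C]_n) : Prop :=
  exists D : 'I_n -> C, forall e : R, 0 < e -> exists2 d : R, 0 < d &
    forall x y, polydisc a d x -> polydisc a d y ->
    forall r, vdist_le x y r ->
      cmod (f y - f x - \sum_i D i * (y i 0 - x i 0)) <= e * r.

Lemma polydisc_le n (a : 'cV[C]_n) (d d' : R) :
  d <= d' -> polydisc a d `<=` polydisc a d'.
Proof. by move=> dd x ax i; exact: lt_le_trans (ax i) dd. Qed.

Lemma polydisc_center n (a : 'cV[C]_n) (d : R) : 0 < d -> polydisc a d a.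
Proof. by move=> d0 i; rewrite subrr cmod0. Qed.

Lemma cmod_lin_le n (D : 'I_n -> C) (x y : 'cV[C]_n) (r : R) : vdist_le x y r ->
  cmod (\sum_i D i * (y i 0 - x i 0)) <= (\sum_i cmod (D i)) * r.
Proof.
move=> [r0 xy]; apply: le_trans (cmod_sum _ _ _) _; rewrite mulr_suml.
apply: ler_sum => i _; rewrite cmodM; apply: ler_wpM2l; first exact: cmod_ge0.
exact: xy.
Qed.

Lemma sum_cmod_ge0 n (D : 'I_n -> C) : 0 <= \sum_i cmod (D i).
Proof. by apply: sumr_ge0 => i _; exact: cmod_ge0. Qed.

Lemma sdiff_lip n (f : 'cV[C]_n -> C) a : sdiff f a ->
  exists2 K : R, 0 < K & exists2 d : R, 0 < d &
    forall x y, polydisc a d x -> polydisc a d y ->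
    forall r, vdist_le x y r -> cmod (f y - f x) <= K * r.
Proof.
move=> [D fD]; have [d d0 {}fD] := fD 1 ltr01.
exists (1 + \sum_i cmod (D i)).
  by apply: ltr_wpDr => //; exact: sum_cmod_ge0.
exists d => // x y ax ay r xy.
rewrite -[f y - f x](subrK (\sum_i D i * (y i 0 - x i 0))).
apply: le_trans (cmodD _ _) _; rewrite mulrDl; apply: lerD.
  exact: fD.
exact: cmod_lin_le.
Qed.

Lemma sdiff_near n (f g : 'cV[C]_n -> C) a (d : R) : 0 < d ->
  (forall x, polydisc a d x -> f x = g x) -> sdiff f a -> sdiff g a.
Proof.
move=> d0 fg [D fD]; exists D => e e0; have [d' d'0 {}fD] := fD e e0.
exists (Num.min d d'); first by rewrite lt_min d0.
move=> x y ax ay r xy.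
have le1 : Num.min d d' <= d by rewrite ge_min lexx.
have le2 : Num.min d d' <= d' by rewrite ge_min lexx orbT.
rewrite -!fg; [|exact: polydisc_le ax|exact: polydisc_le ay].
by apply: fD => //; [exact: polydisc_le ax|exact: polydisc_le ay].
Qed.

Lemma sdiff_cst n (c : C) (a : 'cV[C]_n) : sdiff (fun=> c) a.
Proof.
exists (fun=> 0) => e e0; exists 1 => // x y _ _ r [r0 _].
by rewrite subrr sub0r cmodN big1 ?cmod0 ?mulr_ge0 ?(ltW e0)// => i _; rewrite mul0r.
Qed.

Lemma sdiff_coord n (j : 'I_n) (a : 'cV[C]_n) : sdiff (fun x => x j 0) a.
Proof.
exists (fun i => (i == j)%:R) => e e0; exists 1 => // x y _ _ r [r0 _].
rewrite (bigD1 j) //= eqxx mul1r big1 ?addr0 ?subrr ?cmod0 ?mulr_ge0 ?(ltW e0)//.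
by move=> i /negPf->; rewrite mul0r.
Qed.

Lemma sdiffD n (f g : 'cV[C]_n -> C) a :
  sdiff f a -> sdiff g a -> sdiff (fun x => f x + g x) a.
Proof.
move=> [D fD] [E gE]; exists (fun i => D i + E i) => e e0.
have e20 : 0 < e / 2 by rewrite divr_gt0.
have [d d0 {}fD] := fD _ e20; have [d' d'0 {}gE] := gE _ e20.
exists (Num.min d d'); first by rewrite lt_min d0.
move=> x y ax ay r xy.
have le1 : Num.min d d' <= d by rewrite ge_min lexx.
have le2 : Num.min d d' <= d' by rewrite ge_min lexx orbT.
under eq_bigr do rewrite mulrDl.
rewrite big_split /=.
set S := \sum_i _; set T := \sum_i _.
have -> : f y + g y - (f x + g x) - (S + T) = (f y - f x - S) + (g y - g x - T) by ring.
apply: le_trans (cmodD _ _) _; have -> : e * r = e / 2 * r + e / 2 * r by field.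
apply: lerD; [apply: fD|apply: gE] => //.
- exact: polydisc_le ax.
- exact: polydisc_le ay.
- exact: polydisc_le ax.
- exact: polydisc_le ay.
Qed.

(** The error splits into that of [f] between [G x] and [G y], whose distance is at most [K * r],
    and the linear form [D] applied to the errors of the coordinates of [G]. Each part gets half of
    [e]. *)
Lemma sdiff_comp m n (f : 'cV[C]_m -> C) (G : 'cV[C]_n -> 'cV[C]_m) a :
  sdiff f (G a) -> (forall i, sdiff (fun x => G x i 0) a) ->
  sdiff (fun x => f (G x)) a.
Proof.
move=> [D fD] Gd.
have [K K0 [d d0 GK]] : exists2 K : R, 0 < K & exists2 d : R, 0 < d &
    forall x y, polydisc a d x -> polydisc a d y ->
    forall r, vdist_le x y r -> vdist_le (G x) (G y) (K * r).
  have /choice[K KP] : forall i, exists K : R, 0 < K /\ exists2 d : R, 0 < d &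
    forall x y, polydisc a d x -> polydisc a d y ->
    forall r, vdist_le x y r -> cmod (G y i 0 - G x i 0) <= K * r.
    by move=> i; have [K K0 ?] := sdiff_lip (Gd i); exists K.
  have /choice[d dP] : forall i, exists d : R, 0 < d /\
    forall x y, polydisc a d x -> polydisc a d y ->
    forall r, vdist_le x y r -> cmod (G y i 0 - G x i 0) <= K i * r.
    by move=> i; have [_ [d d0 ?]] := KP i; exists d.
  exists (1 + \sum_i K i).
    by apply: ltr_wpDr => //; apply: sumr_ge0 => i _; rewrite ltW // (KP i).1.
  have [mu mu0 md] := finite_lbound (fun i => (dP i).1).
  exists mu => //.
  move=> x y ax ay r xy; have r0 := xy.1; split.
    rewrite mulr_ge0 // addr_ge0 //.
    by apply: sumr_ge0 => i _; rewrite ltW // (KP i).1.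
  move=> i; have [_ dPi] := dP i.
  have le1 := md i.
  apply: le_trans (dPi x y _ _ r xy) _; [exact: polydisc_le ax|exact: polydisc_le ay|].
  apply: ler_wpM2r => //; rewrite (bigD1 i) //= addrCA lerDl addr_ge0 //.
  by apply: sumr_ge0 => j _; rewrite ltW // (KP j).1.
have /choice[E GE] := Gd.
exists (fun j => \sum_i D i * E i j) => e e0.
set S := 1 + \sum_i cmod (D i).
have S0 : 0 < S by apply: ltr_wpDr => //; exact: sum_cmod_ge0.
have eK0 : 0 < e / 2 / K by rewrite !divr_gt0.
have [d1 d10 {}fD] := fD _ eK0.
have eS0 : 0 < e / 2 / S by rewrite !divr_gt0.
have /choice[h hP] : forall i, exists h : R, 0 < h /\
    forall x y, polydisc a h x -> polydisc a h y ->
    forall r, vdist_le x y r ->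
      cmod (G y i 0 - G x i 0 - \sum_j E i j * (y j 0 - x j 0)) <= e / 2 / S * r.
  by move=> i; have [h h0 ?] := GE i _ eS0; exists h.
have [h' h'0 h'h] := finite_lbound (fun i => (hP i).1).
(* The last bound keeps [G x] within [d1 / 2] of [G a], by the Lipschitz constant [K], hence inside
   the polydisc where [f] is controlled. *)
set d2 := Num.min (Num.min d h') (d1 / (2 * K)).
have d20 : 0 < d2 by rewrite !lt_min d0 h'0 divr_gt0 // mulr_gt0.
have le_d : d2 <= d by rewrite /d2 !ge_min lexx.
have le_h i : d2 <= h i.
  by rewrite /d2 !ge_min h'h !orbT.
have le_d1 : d2 <= d1 / (2 * K) by rewrite /d2 !ge_min lexx !orbT.
have Gin x : polydisc a d2 x -> polydisc (G a) d1 (G x).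
  move=> ax i.
  have [_ /(_ i) GG] := GK a x (polydisc_center a d0) (polydisc_le le_d ax) d2
     (conj (ltW d20) (fun i => ltW (ax i))).
  apply: le_lt_trans GG _; apply: (@le_lt_trans _ _ (d1 / 2)); last first.
    by rewrite ltr_pdivrMr // mulr_natr mulr2n ltrDl.
  apply: (@le_trans _ _ (K * (d1 / (2 * K)))); first by rewrite ler_pM2l.
  by rewrite le_eqVlt; apply/orP; left; apply/eqP; field; rewrite gt_eqF.
exists d2 => // x y ax ay r xy.
have Gxy := GK x y (polydisc_le le_d ax) (polydisc_le le_d ay) r xy.
have := fD (G x) (G y) (Gin _ ax) (Gin _ ay) _ Gxy.
have -> : e / 2 / K * (K * r) = e / 2 * r by field; rewrite gt_eqF.
move=> H1.
have -> : e * r = e / 2 * r + e / 2 * r by field.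
rewrite -(subrKA (\sum_i D i * (G y i 0 - G x i 0))).
apply: le_trans (cmodD _ _) (lerD H1 _).
have -> : \sum_i D i * (G y i 0 - G x i 0) -
     \sum_j (\sum_i D i * E i j) * (y j 0 - x j 0) =
   \sum_i D i * (G y i 0 - G x i 0 - \sum_j E i j * (y j 0 - x j 0)).
  under [X in _ - X]eq_bigr do rewrite mulr_suml.
  rewrite exchange_big /= -sumrB; apply: eq_bigr => i _.
  rewrite [RHS]mulrBr mulr_sumr; congr (_ - _); apply: eq_bigr => j _.
  by rewrite mulrA.
apply: le_trans (cmod_sum _ _ _) _.
have r0 := xy.1.
apply: (@le_trans _ _ (\sum_i cmod (D i) * (e / 2 / S * r))).
  apply: ler_sum => i _; rewrite cmodM; apply: ler_wpM2l; first exact: cmod_ge0.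
  by apply: (hP i).2 => //; exact: polydisc_le (le_h i) _ _.
rewrite -mulr_suml.
apply: (@le_trans _ _ (S * (e / 2 / S * r))).
  apply: ler_wpM2r; first by rewrite mulr_ge0 // ltW.
  by rewrite /S lerDr.
by rewrite le_eqVlt; apply/orP; left; apply/eqP; field; rewrite gt_eqF.
Qed.

Definition sdiff1 (f : C -> C) (t : C) : Prop :=
  sdiff (fun z : 'cV[C]_1 => f (z 0 0)) (const_mx t).

Lemma sdiff_comp1 n (f : C -> C) (g : 'cV[C]_n -> C) a :
  sdiff1 f (g a) -> sdiff g a -> sdiff (fun x => f (g x)) a.
Proof.
move=> fd gd.
have : sdiff (fun x => (fun z : 'cV[C]_1 => f (z 0 0)) (const_mx (g x))) a.
  apply: (@sdiff_comp 1 n (fun z => f (z 0 0)) (fun x => const_mx (g x))) => // i.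
  by apply: sdiff_near gd; [exact: ltr01|move=> x _; rewrite mxE].
by apply: sdiff_near; [exact: ltr01|move=> x _; rewrite mxE].
Qed.

Lemma sdiff1P (f : C -> C) t (c : C) :
  (forall e : R, 0 < e -> exists2 d : R, 0 < d & forall x y : C,
     cmod (x - t) < d -> cmod (y - t) < d ->
     cmod (f y - f x - c * (y - x)) <= e * cmod (y - x)) -> sdiff1 f t.
Proof.
move=> H; exists (fun=> c) => e e0; have [d d0 {}H] := H e e0.
exists d => // x y ax ay r [r0 xy].
rewrite big_ord1; apply: le_trans (H _ _ _ _) _.
- by have := ax 0; rewrite mxE.
- by have := ay 0; rewrite mxE.
- by rewrite ler_pM2l // xy.
Qed.

Lemma sdiff1_comp (f g : C -> C) t :
  sdiff1 f (g t) -> sdiff1 g t -> sdiff1 (fun x => f (g x)) t.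
Proof.
move=> fd gd; apply: (@sdiff_comp1 1 f (fun z => g (z 0 0))) => //.
by rewrite mxE.
Qed.

Lemma sdiffZ n (c : C) (f : 'cV[C]_n -> C) a : sdiff f a -> sdiff (fun x => c * f x) a.
Proof.
apply: (@sdiff_comp1 n (fun x => c * x) f a); apply: (@sdiff1P _ _ c) => e e0.
by exists 1 => // x y _ _; rewrite mulrBr subrr cmod0 mulr_ge0 ?(ltW e0) ?cmod_ge0.
Qed.

Lemma sdiff_sqr n (f : 'cV[C]_n -> C) a : sdiff f a -> sdiff (fun x => f x * f x) a.
Proof.
apply: (@sdiff_comp1 n (fun x => x * x) f a).
set t := f a; apply: (@sdiff1P _ _ (t + t)) => e e0.
exists (e / 2) => [|x y xt yt]; first by rewrite divr_gt0.
have -> : y * y - x * x - (t + t) * (y - x) = ((y - t) + (x - t)) * (y - x) by ring.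
rewrite cmodM; apply: ler_wpM2r; first exact: cmod_ge0.
by apply: le_trans (cmodD _ _) _; rewrite [leRHS](splitr e) lerD // ltW.
Qed.

Lemma sdiffN n (f : 'cV[C]_n -> C) a : sdiff f a -> sdiff (fun x => - f x) a.
Proof.
move=> /(sdiffZ (-1)); apply: sdiff_near; first exact: ltr01.
by move=> x _; rewrite mulN1r.
Qed.

Lemma sdiffB n (f g : 'cV[C]_n -> C) a :
  sdiff f a -> sdiff g a -> sdiff (fun x => f x - g x) a.
Proof. by move=> fd gd; apply: sdiffD => //; exact: sdiffN. Qed.

(** Polarisation, [4 f g = (f + g) ^ 2 - (f - g) ^ 2], reduces products to squares, which are
    handled by the chain rule in one variable. *)
Lemma sdiffM n (f g : 'cV[C]_n -> C) a :
  sdiff f a -> sdiff g a -> sdiff (fun x => f x * g x) a.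
Proof.
move=> fd gd.
have := sdiffZ (4^-1) (sdiffB (sdiff_sqr (sdiffD fd gd)) (sdiff_sqr (sdiffB fd gd))).
apply: sdiff_near; first exact: ltr01.
by move=> x _; field.
Qed.

Lemma sdiff_sum n (I : Type) (s : seq I) (P : pred I) (F : I -> 'cV[C]_n -> C) a :
  (forall i, P i -> sdiff (F i) a) -> sdiff (fun x => \sum_(i <- s | P i) F i x) a.
Proof.
move=> Fd; elim: s => [|i s IH].
  by apply: sdiff_near (sdiff_cst 0 a); [exact: ltr01|move=> x _; rewrite big_nil].
case Pi: (P i).
  by apply: sdiff_near (sdiffD (Fd i Pi) IH); [exact: ltr01|move=> x _; rewrite big_cons Pi].
by apply: sdiff_near IH; [exact: ltr01|move=> x _; rewrite big_cons Pi].
Qed.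

Lemma sdiff_prod n (I : Type) (s : seq I) (P : pred I) (F : I -> 'cV[C]_n -> C) a :
  (forall i, P i -> sdiff (F i) a) -> sdiff (fun x => \prod_(i <- s | P i) F i x) a.
Proof.
move=> Fd; elim: s => [|i s IH].
  by apply: sdiff_near (sdiff_cst 1 a); [exact: ltr01|move=> x _; rewrite big_nil].
case Pi: (P i).
  by apply: sdiff_near (sdiffM (Fd i Pi) IH); [exact: ltr01|move=> x _; rewrite big_cons Pi].
by apply: sdiff_near IH; [exact: ltr01|move=> x _; rewrite big_cons Pi].
Qed.

Lemma sdiffX n (f : 'cV[C]_n -> C) a m : sdiff f a -> sdiff (fun x => f x ^+ m) a.
Proof.
move=> fd; apply: sdiff_near (@sdiff_prod n _ (index_enum 'I_m) xpredT (fun=> f) a (fun _ _ => fd)).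
  exact: ltr01.
by move=> x _; rewrite prodr_const card_ord.
Qed.

Lemma sdiffV n (f : 'cV[C]_n -> C) a : sdiff f a -> f a != 0 ->
  sdiff (fun x => (f x)^-1) a.
Proof.
move=> fd fa0; move: fd; apply: (@sdiff_comp1 n GRing.inv f a).
set t := f a in fa0 *; have t0 : 0 < cmod t by rewrite cmod_gt0.
apply: (@sdiff1P _ _ (- t^-1 ^+ 2)) => e e0.
set T := cmod t in t0.
(* The first radius keeps [x] and [y] at modulus above [T / 2], so that the denominator [x y t ^ 2]
   below exceeds [T ^ 4 / 4]; the second bounds the numerator by [5 / 32 * e * T ^ 4]. *)
exists (Num.min (T / 2) (e * T ^+ 3 / 16)).
  by rewrite lt_min !divr_gt0 ?mulr_gt0 ?exprn_gt0.
move=> x y; rewrite !lt_min => /andP[xt xt'] /andP[yt yt'].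
have low z : cmod (z - t) < T / 2 -> T / 2 < cmod z.
  move=> zt; have := cmodBD t z 0; rewrite !subr0 -/T cmodB; lra.
have X := low _ xt; have Y := low _ yt.
have T2 : 0 < T / 2 by rewrite divr_gt0.
have x0 : x != 0 by rewrite -cmod_gt0 (lt_trans T2).
have y0 : y != 0 by rewrite -cmod_gt0 (lt_trans T2).
have -> : y^-1 - x^-1 - - t^-1 ^+ 2 * (y - x) =
   ((x - t) * y + t * (y - t)) * (x * y * t ^+ 2)^-1 * (y - x).
  by field; rewrite fa0 x0 y0.
rewrite cmodM; apply: ler_wpM2r; first exact: cmod_ge0.
rewrite cmodM cmodV !cmodM -/T -expr2.
have X0 : 0 < cmod x by rewrite (lt_trans T2).
have Y0 : 0 < cmod y by rewrite (lt_trans T2).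
rewrite ler_pdivrMr; last by rewrite !mulr_gt0 ?exprn_gt0.
set eta := e * T ^+ 3 / 16 in xt' yt'.
have Y3 : cmod y <= 3 / 2 * T.
  have := cmodBD y t 0; rewrite !subr0 -/T; lra.
apply: (@le_trans _ _ (eta * (5 / 2 * T))).
  apply: le_trans (cmodD _ _) _; rewrite !cmodM -/T.
  have -> : eta * (5 / 2 * T) = eta * (3 / 2 * T) + T * eta by field.
  apply: lerD; last by rewrite ler_pM2l // ltW.
  by apply: ler_pM => //; rewrite ?cmod_ge0 // ltW.
apply: (@le_trans _ _ (e * (T / 2 * (T / 2) * T ^+ 2))); last first.
  rewrite ler_pM2l //; apply: ler_wpM2r; first by rewrite exprn_ge0 // ltW.
  by apply: ler_pM; rewrite ltW.
rewrite /eta.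
have -> : e * T ^+ 3 / 16 * (5 / 2 * T) = 5 / 32 * (e * T ^+ 4) by field.
have -> : e * (T / 2 * (T / 2) * T ^+ 2) = 8 / 32 * (e * T ^+ 4) by field.
have : 0 < e * T ^+ 4 by rewrite mulr_gt0 ?exprn_gt0.
lra.
Qed.

Lemma sdiff_continuous n (f : 'cV[C]_n -> C) a : sdiff f a -> {for a, continuous f}.
Proof.
move=> /sdiff_lip[K K0 [d d0 fK]].
apply: (iffRL (@cvg_cmodP R _ (nbhs a) (nbhs_filter a) f (f a))) => e e0.
apply/nbhs_cV; exists (Num.min d (e / (2 * K))).
  by rewrite lt_min d0 divr_gt0 // mulr_gt0.
move=> x ax; set d' := Num.min d (e / (2 * K)).
have d'0 : 0 < d' by rewrite lt_min d0 divr_gt0 // mulr_gt0.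
have xd' i : cmod (x i 0 - a i 0) <= d' by exact: ltW.
apply: le_lt_trans (fK a x (polydisc_center a d0) _ d' (conj (ltW d'0) xd')) _.
  by move=> i; apply: lt_le_trans (ax i) _; rewrite ge_min lexx.
apply: (@le_lt_trans _ _ (e / 2)); last by rewrite ltr_pdivrMr // mulr_natr mulr2n ltrDl.
apply: (@le_trans _ _ (K * (e / (2 * K)))).
  by rewrite ler_pM2l // ge_min lexx orbT.
by rewrite le_eqVlt; apply/orP; left; apply/eqP; field; rewrite gt_eqF.
Qed.

End StrictDifferentiability.

(** * Analytic functions are strictly differentiable *)

Section AnalyticStrict.
Variable R : realType.
Local Notation C := (Cx R).

Lemma cvg_cmod_le (T : Type) (F : set_system T) {FF : ProperFilter F}
    (u : T -> C) (l c : C) (b : R) :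
  u @ F --> l -> (\forall t \near F, cmod (u t - c) <= b) -> cmod (l - c) <= b.
Proof.
move=> /cvg_cmodP ul ub; rewrite leNgt; apply/negP => lb.
have e0 : 0 < cmod (l - c) - b by rewrite subr_gt0.
have [t []] := filter_ex (filterI (ul _ e0) ub).
by have := cmodBD l (u t) c; rewrite (cmodB l (u t)) => *; lra.
Qed.

(** Telescoping, one factor exchanged at a time. The factor [rho] on the left stands for a division
    by [rho] on the right, and [c i] is meant to be an exponent, so that the lemma applies to powers
    first and then to monomials. *)
Lemma prod_diff_le (I : Type) (s : seq I) (u v : I -> C) (U c : I -> R) (rho d : R) :
  0 <= rho -> 0 <= d -> (forall i, 0 <= c i) ->
  (forall i, cmod (u i) <= U i) -> (forall i, cmod (v i) <= U i) ->
  (forall i, cmod (u i - v i) * rho <= c i * U i * d) ->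
  cmod (\prod_(i <- s) u i - \prod_(i <- s) v i) * rho <=
    (\sum_(i <- s) c i) * (\prod_(i <- s) U i) * d.
Proof.
move=> rho0 d0 c0 uU vU uv.
have U0 i : 0 <= U i by exact: le_trans (cmod_ge0 _) (uU i).
elim: s => [|i s IH]; first by rewrite !big_nil subrr cmod0 !mul0r.
rewrite !big_cons.
set pu := \prod_(j <- s) u j in IH *; set pv := \prod_(j <- s) v j in IH *.
set pU := \prod_(j <- s) U j in IH *; set sc := \sum_(j <- s) c j in IH *.
have pUge0 : 0 <= pU by apply: prodr_ge0.
have -> : u i * pu - v i * pv = (u i - v i) * pu + v i * (pu - pv) by ring.
have puU : cmod pu <= pU.
  rewrite /pu cmod_prod; apply: ler_prod => j _.
  by rewrite cmod_ge0 uU.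
apply: (@le_trans _ _ ((cmod (u i - v i) * rho) * cmod pu + cmod (v i) * (cmod (pu - pv) * rho))).
  rewrite [X in _ <= X + _]mulrAC mulrA -mulrDl.
  by apply: ler_wpM2r => //; rewrite -!cmodM cmodD.
have -> : (c i + sc) * (U i * pU) * d = (c i * U i * d) * pU + U i * (sc * pU * d) by ring.
apply: lerD.
  apply: ler_pM => //; first by rewrite mulr_ge0 ?cmod_ge0.
  exact: cmod_ge0.
apply: ler_pM => //; first exact: cmod_ge0.
by rewrite mulr_ge0 ?cmod_ge0.
Qed.

Lemma monomial_diff_le n (al : 'I_n -> nat) (x y : 'I_n -> C) (rho d : R) :
  0 <= rho -> 0 <= d ->
  (forall i, cmod (x i) <= rho) -> (forall i, cmod (y i) <= rho) ->
  (forall i, cmod (y i - x i) <= d) ->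
  cmod (\prod_i y i ^+ al i - \prod_i x i ^+ al i) * rho <=
   (\sum_i al i)%:R * rho ^+ (\sum_i al i) * d.
Proof.
move=> rho0 d0 xr yr xy; rewrite natr_sum expr_sum.
apply: prod_diff_le => // i.
- by rewrite cmodX lerXn2r ?nnegrE ?cmod_ge0.
- by rewrite cmodX lerXn2r ?nnegrE ?cmod_ge0.
have := @prod_diff_le _ (index_enum 'I_(al i)) (fun=> y i) (fun=> x i)
   (fun=> rho) (fun=> 1) rho d rho0 d0 (fun=> ler01) (fun=> yr i) (fun=> xr i).
rewrite !prodr_const sumr_const card_ord; apply => _.
by rewrite mul1r mulrC ler_wpM2l.
Qed.

Lemma natr_le_exp2 m : m%:R <= 2 ^+ m :> R.
Proof. by rewrite -natrX ler_nat ltnW // ltn_expl. Qed.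

(** Two factors [rho] are split off; the others are at most [r / 2] and absorb [m <= 2 ^ m]. The
    right side is thus quadratic in [rho] against the weight [r ^ m] of a convergent series. *)
Lemma monomial_weight (m : nat) (rho r : R) : (1 < m)%N ->
  0 < rho -> rho <= r / 2 -> m%:R * rho ^+ m <= rho * (4 * rho / r ^+ 2 * r ^+ m).
Proof.
case: m => [|[|m]] // _ rho0 rr; have r0 : 0 < r by lra.
have -> : rho * (4 * rho / r ^+ 2 * r ^+ m.+2) = rho ^+ 2 * (4 * r ^+ m).
  by rewrite !exprS; field; rewrite gt_eqF.
have -> : m.+2%:R * rho ^+ m.+2 = rho ^+ 2 * (m.+2%:R * rho ^+ m).
  by rewrite !exprS; ring.
rewrite ler_pM2l ?exprn_gt0 //.
apply: (@le_trans _ _ (2 ^+ m.+2 * (r / 2) ^+ m)).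
  apply: ler_pM; [by []|by rewrite exprn_ge0 // ltW|exact: natr_le_exp2|].
  by rewrite lerXn2r // nnegrE; lra.
rewrite expr_div_n !exprS le_eqVlt; apply/orP; left; apply/eqP; field.
by rewrite expf_neq0.
Qed.

Lemma sum_nat_eq1 n (al : 'I_n -> nat) : (\sum_i al i = 1)%N ->
  exists i, forall j, al j = (j == i).
Proof.
move=> s1; have [i i0|al0] := pickP (fun i => 0 < al i)%N; last first.
  by move: s1; rewrite big1 // => i _; apply/eqP; rewrite -leqn0 leqNgt al0.
exists i => j; move: s1; rewrite (bigD1 i) //=.
have [->|ji] := eqVneq j i; first by case: (al i) i0 => // -[].
rewrite (bigD1 j) //=; by case: (al i) i0 => // m _; case: (al j) => //= k; rewrite addSn addnS.
Qed.

(** Spreads the linear form over all multi-indices, so that it can be subtracted from the power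
    series term by term. With [1 < N] the exponent 1 lies in the range. *)
Lemma cube_sum_lin n (a : ('I_n -> nat) -> C) (N : nat) (h : 'I_n -> C) : (1 < N)%N ->
  \sum_(al : {ffun 'I_n -> 'I_N}) \sum_i
     (if [forall j, (al j : nat) == (j == i)] then a (fun j => al j) * h i else 0) =
  \sum_i a (fun j => (j == i) : nat) * h i.
Proof.
move=> N1; rewrite exchange_big /=; apply: eq_bigr => i _.
have lt1 (j : 'I_n) : (((j == i) : nat) < N)%N by case: (j == i); rewrite //= ltnW.
rewrite (bigD1 [ffun j => Ordinal (lt1 j)]) //= big1 ?addr0; last first.
  move=> al al_neq; case: forallP => // al_eq; case/eqP: al_neq.
  by apply/ffunP => j; apply/val_inj; rewrite ffunE /=; apply/eqP.
rewrite (_ : [forall _, _]); last by apply/forallP => j; rewrite ffunE.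
by congr (a _ * _); apply/funext => j; rewrite ffunE.
Qed.

Lemma analytic_sdiff n (f : 'cV[C]_n -> C) z : analytic_at f z -> sdiff f z.
Proof.
move=> [a [_ [B [/gt0_toC[r r0 ->] aB af]]]].
pose A := fun N => \sum_(al : {ffun 'I_n -> 'I_N})
   cmod (a (fun i => al i)) * r ^+ (\sum_i al i).
have AE N : cube_sum (fun al => `|a al|) (fun=> toC r) N = toC (A N).
  rewrite toC_sum; apply: eq_bigr => al _; rewrite toCM cmodE; congr (_ * _).
  by rewrite toCX expr_sum.
have A0 N : 0 <= A N.
  by apply: sumr_ge0 => al _; rewrite mulr_ge0 ?cmod_ge0 ?exprn_ge0 // ltW.
have [b b0 Ab] : exists2 b : R, 0 < b & forall N, A N <= b.
  exists (1 + cmod B); first by rewrite ltr_wpDr ?cmod_ge0.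
  move=> N; have := aB N; rewrite AE => AB.
  have B0 : 0 <= B by apply: le_trans (aB 0%N); rewrite AE -toC0 lerC.
  have : toC (A N) <= toC (cmod B) by rewrite cmodE ger0_norm.
  by rewrite lerC => AB'; apply: le_trans AB' _; rewrite lerDr.
exists (fun i => a (fun j => (j == i) : nat)) => e e0.
pose rho := Num.min (r / 2) (e * r ^+ 2 / (4 * b)).
(* [rho <= r / 2] is what [monomial_weight] asks for, and the second bound makes the total weight
   [b * (4 * rho / r ^ 2)] of the terms of degree at least 2 at most [e]. *)
have rho0 : 0 < rho by rewrite lt_min !divr_gt0 ?mulr_gt0 ?exprn_gt0.
have rho_r : rho <= r / 2 by rewrite ge_min lexx.
have rho_e : rho <= e * r ^+ 2 / (4 * b) by rewrite ge_min lexx orbT.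
exists rho => // x y zx zy d [d0 xy].
have small (u : 'cV[C]_n) : polydisc z rho u -> forall i, `|(u - z) i 0| < toC r.
  move=> zu i; rewrite !mxE -cmodE ltrC; apply: lt_trans (zu i) _; lra.
have cx := af _ (small _ zx); have cy := af _ (small _ zy).
rewrite !(addrC z) !subrK in cx cy.
apply: (@cvg_cmod_le _ _ _ _ _ _ _ (cvgB cy cx)).
exists 2%N => // N /= N2; set S := \sum_i _.
pose X i := (x - z) i 0; pose Y i := (y - z) i 0.
have -> : S = \sum_i a (fun j => (j == i) : nat) * (Y i - X i).
  by apply: eq_bigr => i _; congr (_ * _); rewrite /X /Y !mxE; ring.
rewrite -(cube_sum_lin _ _ N2).
rewrite -[X in cmod (X - _)]/(cube_sum a Y N - cube_sum a X N) /cube_sum -!sumrB.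
apply: (@le_trans _ _ (\sum_(al : {ffun 'I_n -> 'I_N})
   cmod (a (fun i => al i)) * r ^+ (\sum_i al i) * (4 * rho / r ^+ 2 * d))).
  apply: le_trans (cmod_sum _ _ _) _; apply: ler_sum => al _.
  rewrite -mulrBr.
  pose m := (\sum_i (al i : nat))%N; rewrite -/m.
  have rhs0 : 0 <= cmod (a (fun i => al i)) * r ^+ m * (4 * rho / r ^+ 2 * d).
    by rewrite !mulr_ge0 ?cmod_ge0 ?exprn_ge0 ?invr_ge0 ?exprn_ge0 // ltW.
  (* Three cases by the degree [m]. From 2 on, the linear form has no term and the increment of the
     monomial is quadratically small; in degree 1 the increment is exactly the term of the linear
     form; in degree 0 it vanishes. *)
  have [m2|] := ltnP 1 m.
    rewrite [X in cmod (_ - X)]big1 ?subr0; last first.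
      move=> i _; case: ifP => // /forallP al_eq.
      have : m = 1%N.
        rewrite /m (bigD1 i) //= (eqP (al_eq i)) eqxx big1 // => j ji.
        by rewrite (eqP (al_eq j)) (negPf ji).
      by move=> m1; rewrite m1 in m2.
    rewrite cmodM -!mulrA; apply: ler_wpM2l; first exact: cmod_ge0.
    rewrite -(ler_pM2r rho0).
    apply: le_trans (@monomial_diff_le _ (fun i => al i) X Y rho d _ d0 _ _ _) _.
    - exact: ltW.
    - by move=> i; rewrite /X !mxE ltW.
    - by move=> i; rewrite /Y !mxE ltW.
    - move=> i; rewrite /X /Y !mxE.
      by rewrite (_ : _ - _ - _ = y i 0 - x i 0) //; ring.
    rewrite -/m; apply: le_trans (ler_wpM2r d0 (monomial_weight m2 rho0 rho_r)) _.
    by rewrite le_eqVlt; apply/orP; left; apply/eqP; field; rewrite gt_eqF.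
  rewrite leq_eqVlt => /orP[/eqP m1|].
    have [i ali] := sum_nat_eq1 m1.
    rewrite [X in cmod (_ - X)](bigD1 i) //= [X in cmod (_ - (_ + X))]big1 ?addr0; last first.
      move=> j ji; case: ifP => // /forallP/(_ i); rewrite ali eqxx.
      by rewrite [i == j]eq_sym (negPf ji).
    rewrite (_ : [forall _, _]); last by apply/forallP => j; rewrite ali.
    have mon (W : 'I_n -> C) : \prod_j W j ^+ al j = W i.
      rewrite (bigD1 i) //= ali eqxx big1 ?mulr1 // => j ji.
      by rewrite ali (negPf ji).
    by rewrite !mon -mulrBr subrr mulr0 cmod0.
  rewrite ltnS leqn0 => /eqP m0.
  have al0 i : (al i : nat) = 0%N.
    by apply/eqP; rewrite -leqn0 -m0 /m (bigD1 i) //= leq_addr.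
  rewrite [X in cmod (_ - X)]big1 ?subr0; last first.
    by move=> i _; case: ifP => // /forallP/(_ i); rewrite al0 eqxx.
  have mon (W : 'I_n -> C) : \prod_j W j ^+ al j = 1.
    by rewrite big1 // => j _; rewrite al0.
  by rewrite !mon subrr mulr0 cmod0.
rewrite -mulr_suml -/(A N) mulrA; apply: ler_wpM2r => //.
apply: (@le_trans _ _ (b * (4 * (e * r ^+ 2 / (4 * b)) / r ^+ 2))).
  apply: ler_pM => //; first by rewrite !mulr_ge0 ?invr_ge0 ?exprn_ge0 // ltW.
  by apply: ler_wpM2r; [rewrite invr_ge0 exprn_ge0 // ltW|rewrite ler_pM2l].
by rewrite le_eqVlt; apply/orP; left; apply/eqP; field; rewrite !gt_eqF.
Qed.

End AnalyticStrict.

(** * The complex exponential and roots of unity *)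

Section ComplexExponential.
Variable R : realType.
Local Notation C := (Cx R).

Lemma derive0_approx (f : R -> R) (df : R) : is_derive (0 : R^o) 1 f df ->
  forall e, 0 < e -> exists2 d, 0 < d &
    forall h, `|h| < d -> `|f h - f 0 - df * h| <= e * `|h|.
Proof.
move=> [fd dE] e e0; rewrite /derivable in fd.
have : (fun h : R => h^-1 *: (f (h *: (1 : R) + 0) - f 0)) @ 0^' --> df.
  by rewrite -dE; exact: fd.
move=> /cvgrPdist_le/(_ e e0)/nbhs_ballP[d /= d0 H].
exists d => // h hd.
have [->|h0] := eqVneq h 0; first by rewrite subrr mulr0 subr0 normr0 mulr0.
have := H h _ h0; rewrite /ball /= sub0r normrN => /(_ hd).
rewrite addr0 /GRing.scale /= mulr1 => He.
have -> : f h - f 0 - df * h = - (df - h^-1 * (f h - f 0)) * h by field.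
by rewrite normrM normrN ler_wpM2r.
Qed.

Lemma cexpD (x y : C) : cexp (x + y) = cexp x * cexp y.
Proof.
case: x => a b; case: y => c d; rewrite /cexp /=.
rewrite expRD cosD sinD; apply/eqP; rewrite eq_complex /=; apply/andP; split; apply/eqP; ring.
Qed.

Lemma cexp0 : cexp (0 : C) = 1.
Proof. by apply/eqP; rewrite eq_complex /= expR0 cos0 sin0 mulr0 mulr1 !eqxx. Qed.

(** In real and imaginary parts, [A], [S] and [K] are the first order remainders at 0 of the real
    functions [expR], [sin] and [cos]. Besides them only the product [(expR a - 1) * b] is left,
    which is quadratic in [h]. *)
Lemma cexp_approx (e : R) : 0 < e -> exists2 d : R, 0 < d &
  forall h : C, cmod h < d -> cmod (cexp h - 1 - h) <= e * cmod h.
Proof.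
move=> e0; pose e' := Num.min (e / 8) 1.
have e'0 : 0 < e' by rewrite lt_min divr_gt0 /= ?ltr01.
have e'1 : e' <= 1 by rewrite ge_min lexx orbT.
have e'e : e' <= e / 8 by rewrite ge_min lexx.
have dexp : is_derive (0 : R^o) 1 (@expR R) 1.
  by rewrite -[X in is_derive _ _ _ X]expR0; exact: is_derive_expR.
have dsin : is_derive (0 : R^o) 1 (@sin R) 1.
  by rewrite -[X in is_derive _ _ _ X]cos0; exact: is_derive_sin.
have dcos : is_derive (0 : R^o) 1 (@cos R) 0.
  by rewrite -[X in is_derive _ _ _ X]oppr0 -[in X in is_derive _ _ _ X]sin0; exact: is_derive_cos.
have [d1 d10 H1] := derive0_approx dexp e'0.
have [d2 d20 H2] := derive0_approx dsin e'0.
have [d3 d30 H3] := derive0_approx dcos e'0.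
set dm := Num.min (Num.min d1 1) (Num.min d2 d3).
have dm0 : 0 < dm by rewrite !lt_min d10 d20 d30 ltr01.
exists (Num.min dm (e / 16)) => [|[a b]]; first by rewrite lt_min dm0 divr_gt0.
rewrite lt_min => /andP[hd he].
move: (reC_le (a +i* b)%C) (Im_le_cmod (a +i* b)%C) => /=.
rewrite /reC /= => aC bC.
have ad : `|a| < dm by exact: le_lt_trans aC hd.
have bd : `|b| < dm by exact: le_lt_trans bC hd.
move: ad bd; rewrite !lt_min => /andP[/andP[a1 a1'] _] /andP[/andP[_ b1] /andP[b2 b3]].
have := H1 _ a1; have := H2 _ b2; have := H3 _ b3.
rewrite expR0 sin0 cos0 !mul1r mul0r !subr0.
set A := expR a - 1 - a; set S := sin b - b; set K := cos b - 1 => hK hS hA.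
set h := (a +i* b)%C in hd he aC bC *.
have -> : cexp h - 1 - h = ((A + expR a * K) +i* (expR a * S + (expR a - 1) * b))%C.
  rewrite /cexp /h; apply/eqP; rewrite eq_complex /=; apply/andP; split; apply/eqP.
    by rewrite /A /K; ring.
  by rewrite /S; ring.
apply: le_trans (cmod_le_ReIm _) _ => /=.
have eA : expR a <= 3.
  have : expR a - 1 - a <= `|A| by exact: ler_norm.
  have := ler_norm a; have : e' * `|a| <= 1 by rewrite mulr_ile1 // ltW.
  lra.
have ea1 : `|expR a - 1| <= 2 * `|a|.
  have -> : expR a - 1 = A + a by rewrite /A; ring.
  apply: le_trans (ler_normD _ _) _; have : e' * `|a| <= `|a| by rewrite ler_piMl.
  lra.
have e0' := expR_ge0 a.
have t1 : `|A + expR a * K| <= e' * cmod h + 3 * (e' * cmod h).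
  apply: le_trans (ler_normD _ _) (lerD _ _).
    by apply: le_trans hA _; rewrite ler_pM2l.
  rewrite normrM ger0_norm //; apply: ler_pM => //.
  by apply: le_trans hK _; rewrite ler_pM2l.
have t2 : `|expR a * S + (expR a - 1) * b| <= 3 * (e' * cmod h) + 2 * `|a| * `|b|.
  apply: le_trans (ler_normD _ _) (lerD _ _).
    rewrite normrM ger0_norm //; apply: ler_pM => //.
    by apply: le_trans hS _; rewrite ler_pM2l.
  by rewrite normrM ler_wpM2r.
have t3 : 2 * `|a| * `|b| <= e / 8 * cmod h.
  have : `|a| * `|b| <= e / 16 * cmod h.
    by apply: ler_pM => //; exact: le_trans aC (ltW he).
  lra.
have t4 : e' * cmod h <= e / 8 * cmod h by rewrite ler_wpM2r ?cmod_ge0.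
lra.
Qed.

(** The functional equation writes both values as multiples of [cexp t], with increments [u = x - t]
    and [h = y - x], so that the expansion at 0 suffices, used once for each increment. *)
Lemma sdiff_cexp (t : C) : sdiff1 (@cexp R) t.
Proof.
apply: (@sdiff1P _ _ _ (cexp t)) => e e0.
have T0 : 0 < 1 + cmod (cexp t) by rewrite ltr_wpDr // cmod_ge0.
have [d1 d10 H1] := cexp_approx ltr01.
pose e' := e / (2 * (1 + cmod (cexp t))).
have e'0 : 0 < e' by rewrite divr_gt0 // mulr_gt0.
pose e2 := Num.min 1 e'; have e20 : 0 < e2 by rewrite lt_min ltr01.
have [d2 d20 H2] := cexp_approx e20.
exists (Num.min (Num.min (d1 / 2) (d2 / 2)) (e2 / 4)) => [|x y].
  by rewrite !lt_min !divr_gt0.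
rewrite !lt_min => /andP[/andP[x1 x2] x3] /andP[/andP[y1 y2] y3].
have yx : cmod (y - x) < d2.
  by have := cmodBD y t x; rewrite (cmodB t x); lra.
have xt : cmod (x - t) < d1 by have := cmod_ge0 (x - t); lra.
have -> : cexp y = cexp t * cexp (x - t) * cexp (y - x).
  by rewrite -!cexpD; congr cexp; ring.
have -> : cexp x = cexp t * cexp (x - t) by rewrite -!cexpD; congr cexp; ring.
set u := x - t in x1 x2 x3 xt *; set h := y - x in yx *.
have -> : cexp t * cexp u * cexp h - cexp t * cexp u - cexp t * h =
   cexp t * ((cexp u - 1) * h + cexp u * (cexp h - 1 - h)) by ring.
have u1 : cmod (cexp u - 1) <= 2 * cmod u.
  have -> : cexp u - 1 = (cexp u - 1 - u) + u by ring.
  by apply: le_trans (cmodD _ _) _; have := H1 _ xt; lra.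
have e21 : e2 <= 1 by rewrite ge_min lexx.
have u2 : cmod (cexp u) <= 3 / 2.
  have -> : cexp u = (cexp u - 1) + 1 by ring.
  by apply: le_trans (cmodD _ _) _; rewrite cmod1; lra.
rewrite cmodM; apply: (@le_trans _ _ (cmod (cexp t) * (2 * e2 * cmod h))).
  apply: ler_wpM2l; first exact: cmod_ge0.
  apply: le_trans (cmodD _ _) _; rewrite !cmodM.
  have -> : 2 * e2 * cmod h = (e2 / 2) * cmod h + 3 / 2 * (e2 * cmod h) by field.
  apply: lerD; first by apply: ler_wpM2r; [exact: cmod_ge0|lra].
  by apply: ler_pM; rewrite ?cmod_ge0 //; exact: H2.
rewrite mulrA; apply: ler_wpM2r; first exact: cmod_ge0.
have e2e' : e2 <= e' by rewrite ge_min lexx orbT.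
apply: (@le_trans _ _ ((1 + cmod (cexp t)) * (2 * e'))).
  by apply: ler_pM; rewrite ?cmod_ge0 ?mulr_ge0 ?ler_pM2l // ?lerDr // ltW.
by rewrite /e' le_eqVlt; apply/orP; left; apply/eqP; field; rewrite gt_eqF.
Qed.

Definition unity_root (N : nat) : C := cexp (0 +i* (pi *+ 2 / N%:R))%C.

Lemma unity_rootX N j : unity_root N ^+ j = cexp (0 +i* (pi *+ 2 / N%:R * j%:R))%C.
Proof.
elim: j => [|j IH]; first by rewrite expr0 mulr0 -[LHS](cexp0).
rewrite exprS IH -cexpD; congr cexp.
apply/eqP; rewrite eq_complex /= addr0 eqxx /=; apply/eqP.
by rewrite -natr1; ring.
Qed.

Lemma unity_root_pow N : (0 < N)%N -> unity_root N ^+ N = 1.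
Proof.
move=> N0; rewrite unity_rootX divfK ?pnatr_eq0 ?gt_eqF //.
by rewrite /cexp expR0 cos2pi sin2pi mulr1 mulr0.
Qed.

Lemma cmod_unity_root N : (0 < N)%N -> cmod (unity_root N) = 1.
Proof.
move=> N0; apply/eqP; rewrite -(@pexpr_eq1 _ _ N) ?cmod_ge0 //.
by rewrite -cmodX unity_root_pow // cmod1.
Qed.

(** The real part of the power is [1 - 2 sin^2 (pi j / N)], and the sine is positive because its
    argument lies strictly between 0 and [pi]. *)
Lemma unity_root_neq1 N j : (0 < j < N)%N -> unity_root N ^+ j != 1.
Proof.
move=> /andP[j0 jN]; have N0 := ltn_trans j0 jN.
have Nr0 : 0 < N%:R :> R by rewrite ltr0n.
set x := pi / N%:R * j%:R : R.
have x0 : 0 < sin x.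
  apply: sin_gt0_pi; rewrite /x mulr_gt0 ?divr_gt0 ?pi_gt0 ?ltr0n //=.
  rewrite mulrAC ltr_pdivrMr // ltr_pM2l ?pi_gt0 // ltr_nat //.
apply/eqP => /(congr1 (@reC R)); rewrite unity_rootX /cexp /reC /= expR0 mul1r.
have -> : pi *+ 2 / N%:R * j%:R = x *+ 2 by rewrite /x; ring.
rewrite cos_mulr2n cos2sin2 => H.
have : 0 < sin x ^+ 2 by rewrite exprn_gt0.
by move: H; rewrite mulr2n; set s := sin x ^+ 2; lra.
Qed.

Lemma unity_root_near1 (e : R) : 0 < e ->
  exists N0, forall N, (N0 < N)%N -> cmod (unity_root N - 1) < e.
Proof.
move=> e0; have [d d0 H] := cexp_approx ltr01.
pose m := Num.min d (e / 4); have m0 : 0 < m by rewrite lt_min d0 divr_gt0.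
exists (Num.bound (pi *+ 2 / m)) => N NN.
have N0 : 0 < N%:R :> R by rewrite ltr0n (leq_ltn_trans _ NN).
set h := (0 +i* (pi *+ 2 / N%:R))%C : C.
have hm : cmod h < m.
  apply: le_lt_trans (cmod_le_ReIm _) _; rewrite /= normr0 add0r.
  have pi2 : 0 <= pi *+ 2 :> R by rewrite mulrn_wge0 // pi_ge0.
  rewrite ger0_norm; last by rewrite divr_ge0 // ltW.
  rewrite ltr_pdivrMr // mulrC -ltr_pdivrMr //.
  have pm : 0 <= pi *+ 2 / m by rewrite divr_ge0 // ltW.
  by apply: lt_trans (archi_boundP pm) _; rewrite ltr_nat.
move: hm; rewrite lt_min => /andP[hd he].
have -> : unity_root N - 1 = (cexp h - 1 - h) + h by rewrite /unity_root -/h; ring.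
by apply: le_lt_trans (cmodD _ _) _; have := H _ hd; have := cmod_ge0 h; lra.
Qed.

End ComplexExponential.

(** * Compact polydiscs and uniformity on compact sets *)

Lemma trmx_continuous (T : ptopologicalType) m n : continuous (@trmx T m n).
Proof.
move=> A P [E nE EP].
exists (fun i j => E j i); first by move=> i j; have := nE j i; rewrite mxE.
by move=> B BE; apply: EP => i j; rewrite mxE.
Qed.

Section Compactness.
Variable R : realType.
Local Notation C := (Cx R).

Lemma continuous_cmod_sub (c : C) : continuous (fun z : C => cmod (z - c)).
Proof.
move=> z.
apply: (iffRL (@cvgrPdist_lt _ _ _ (nbhs z) (nbhs_filter z) (fun z : C => cmod (z - c)) _)) => e e0.
apply/nbhs_C; exists e => // x xz.
have := cmodBD x z c; have := cmodBD z x c.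
rewrite (cmodB z x) => h1 h2; rewrite ltr_norml; apply/andP; split; lra.
Qed.

Lemma closed_cdisc (c : C) (r : R) : closed [set z : C | cmod (z - c) <= r].
Proof.
apply: (@closed_comp _ _ (fun z : C => cmod (z - c)) [set x | x <= r]).
  by move=> z _; exact: continuous_cmod_sub.
exact: closed_le.
Qed.

Lemma compact_cdisc (c : C) (r : R) : compact [set z : C | cmod (z - c) <= r].
Proof.
pose g (p : R * R) : C := (p.1 +i* p.2)%C + c.
have gc : continuous g.
  move=> p; apply: (iffRL (@cvg_cmodP R _ (nbhs p) (nbhs_filter p) g (g p))) => e e0.
  have e20 : 0 < e / 2 by rewrite divr_gt0.
  exists (ball p.1 (e / 2), ball p.2 (e / 2)).
    by split; apply/nbhs_ballP; exists (e / 2).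
  move=> q [/= q1 q2]; apply: le_lt_trans (cmod_le_ReIm _) _.
  rewrite /g (_ : _ - _ = ((q.1 - p.1) +i* (q.2 - p.2))%C) /=; last first.
    by rewrite opprD addrACA subrr addr0; apply/eqP; rewrite eq_complex /= !eqxx.
  by rewrite (splitr e) ltrD // distrC.
have cb : compact (g @` (`[-r, r]%classic `*` `[-r, r]%classic)).
  apply: continuous_compact; first exact: continuous_subspaceT.
  by apply: compact_setX; exact: segment_compact.
apply: subclosed_compact cb _; first exact: closed_cdisc.
move=> z /= zr; exists (complex.Re (z - c), complex.Im (z - c)).
  have := le_trans (reC_le (z - c)) zr; have := le_trans (Im_le_cmod (z - c)) zr.
  by rewrite /reC !ler_norml => i1 i2; split; rewrite /= in_itv.
by rewrite /g /= (_ : (_ +i* _)%C = z - c) ?subrK //; case: (z - c).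
Qed.

Lemma compact_cpolydisc n (a : 'cV[C]_n) (r : R) :
  compact [set z : 'cV[C]_n | forall i, cmod (z i 0 - a i 0) <= r].
Proof.
have := @rV_compact C n (fun i => [set z : C | cmod (z - a i 0) <= r])
  (fun i => @compact_cdisc (a i 0) r).
move=> /(@continuous_compact _ _ (@trmx C 1 n) _ (continuous_subspaceT (@trmx_continuous C 1 n))).
congr compact; apply/seteqP; split=> [_ [v vr <-] i|z zr] /=.
  by rewrite mxE; exact: vr.
by exists z^T => [i|]; rewrite ?trmxK //= mxE; exact: zr.
Qed.

Lemma compact_bounded_closed n (A : set 'cV[C]_n) (r : R) : closed A ->
  (forall z, A z -> forall i, cmod (z i 0) <= r) -> compact A.
Proof.
move=> cA Ar; apply: subclosed_compact cA (@compact_cpolydisc n 0 r) _ => z /Ar zr i.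
by rewrite mxE subr0.
Qed.

Lemma bounded_set_cmod n (A : set 'cV[C]_n) : bounded_set A ->
  exists2 r : R, 0 < r & forall z, A z -> forall i, cmod (z i 0) <= r.
Proof.
move=> [M [Mreal MA]].
exists (`|reC M| + 1) => [|z Az i]; first by rewrite ltr_wpDl.
have ML : M < toC (`|reC M| + 1).
  rewrite -(RRe_real Mreal) -/(toC _) ltrC; have := ler_norm (reC M); rewrite /reC; lra.
have : mx_norm z <= toC (`|reC M| + 1) by exact: MA _ ML z Az.
move=> zM.
have : `|z i 0| <= mx_norm z.
  rewrite mx_normE -[leLHS]nngE num_le /=.
  by apply: (le_bigmax _ (fun ij : 'I_n * 'I_1 => `|z ij.1 ij.2|%:nng) (i, 0)).
by move=> /le_trans/(_ zM); rewrite -cmodE lerC.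
Qed.

End Compactness.

Section UniformStrict.
Variables (R : realType) (n : nat).
Local Notation C := (Cx R).

(** Both linear forms approximate the same increment of [f], along the [i]-th coordinate with a step
    [h] small enough for the two estimates, each up to [e * h]. *)
Lemma sdiff_deriv_close (f : 'cV[C]_n -> C) (c x : 'cV[C]_n) (D E : 'I_n -> C) (e d : R) :
  0 < e -> polydisc c d x ->
  (forall x y, polydisc c d x -> polydisc c d y ->
    forall r, vdist_le x y r ->
      cmod (f y - f x - \sum_i D i * (y i 0 - x i 0)) <= e * r) ->
  (forall e, 0 < e -> exists2 d, 0 < d & forall x' y, polydisc x d x' -> polydisc x d y ->
    forall r, vdist_le x' y r ->
      cmod (f y - f x' - \sum_i E i * (y i 0 - x' i 0)) <= e * r) ->
  forall i, cmod (E i - D i) <= 2 * e.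
Proof.
move=> e0 cx fD fE i; have [d' d'0 {}fE] := fE e e0.
have gap : 0 < d - cmod (x i 0 - c i 0) by rewrite subr_gt0.
pose h := Num.min (d - cmod (x i 0 - c i 0)) d' / 2.
have m0 : 0 < Num.min (d - cmod (x i 0 - c i 0)) d' by rewrite lt_min gap.
have h0 : 0 < h by rewrite divr_gt0.
have hm : h < Num.min (d - cmod (x i 0 - c i 0)) d'.
  by rewrite /h ltr_pdivrMr // mulr_natr mulr2n ltrDl.
move: hm; rewrite lt_min => /andP[hd hd'].
pose y : 'cV[C]_n := \col_j (x j 0 + (j == i)%:R * toC h).
have yx j : y j 0 - x j 0 = (j == i)%:R * toC h by rewrite mxE addrAC subrr add0r.
have cy : polydisc c d y.
  move=> j; have := cmodBD (y j 0) (x j 0) (c j 0); rewrite yx.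
  have [->|ji] := eqVneq j i.
    by rewrite mul1r cmod_toC gtr0_norm //; lra.
  by rewrite mul0r cmod0 add0r => /le_lt_trans; apply.
have xy' : polydisc x d' y.
  move=> j; rewrite yx; have [_|_] := eqVneq j i.
    by rewrite mul1r cmod_toC gtr0_norm.
  by rewrite mul0r cmod0.
have dist : vdist_le x y h.
  split; first exact: ltW.
  move=> j; rewrite yx; have [_|_] := eqVneq j i.
    by rewrite mul1r cmod_toC gtr0_norm.
  by rewrite mul0r cmod0 ltW.
have H1 := fD _ _ cx cy _ dist.
have H2 := fE _ _ (polydisc_center x d'0) xy' _ dist.
have lin (F : 'I_n -> C) : \sum_j F j * (y j 0 - x j 0) = F i * toC h.
  rewrite (bigD1 i) //= yx eqxx mul1r big1 ?addr0 // => j /negPf ji.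
  by rewrite yx ji mul0r mulr0.
rewrite !lin in H1 H2.
have : cmod ((E i - D i) * toC h) <= 2 * e * h.
  have -> : (E i - D i) * toC h = (f y - f x - D i * toC h) - (f y - f x - E i * toC h).
    by ring.
  by apply: le_trans (cmodBle _ _) _; lra.
by rewrite cmodM cmod_toC gtr0_norm // ler_pM2r.
Qed.

(** Strictness makes the derivative continuous: near [z] the derivatives at [x] and at [z] differ
    little, so the estimate with the form [D z] becomes one with [D x], and compactness provides a
    common radius. *)
Lemma sdiff_uniform (f : 'cV[C]_n -> C) (K : set 'cV[C]_n) : compact K ->
  (forall z, K z -> sdiff f z) ->
  exists D : 'cV[C]_n -> 'I_n -> C, forall e : R, 0 < e -> exists2 d : R, 0 < d &
    forall x, K x -> forall y r, vdist_le x y r -> r < d ->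
      cmod (f y - f x - \sum_i D x i * (y i 0 - x i 0)) <= e * r.
Proof.
move=> cK fK.
have /choice[D DP] : forall z : 'cV[C]_n, exists D : 'I_n -> C, K z ->
   forall e, 0 < e -> exists2 d, 0 < d & forall x y, polydisc z d x -> polydisc z d y ->
    forall r, vdist_le x y r ->
      cmod (f y - f x - \sum_i D i * (y i 0 - x i 0)) <= e * r.
  move=> z; have [Kz|nKz] := pselect (K z); last by exists (fun=> 0).
  by have [D ?] := fK z Kz; exists D.
exists D => e e0.
pose P (d : R) (x : 'cV[C]_n) := K x -> forall y r, vdist_le x y r -> r < d ->
      cmod (f y - f x - \sum_i D x i * (y i 0 - x i 0)) <= e * r.
(* Compactness in its near-covering form, the parameter being a radius that tends to 0 from the
   right. The same device yields the other uniform constants on compact sets below. *)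
suff : \forall d \near 0^'+, K `<=` P d.
  move=> [d /= d0 H]; exists (d / 2); first by rewrite divr_gt0.
  move=> x Kx y r xy rd; apply: (H (d / 2)) => //=; rewrite ?divr_gt0 //.
  rewrite sub0r normrN gtr0_norm ?divr_gt0 //.
  by rewrite ltr_pdivrMr // mulr_natr mulr2n ltrDl.
apply: (iffLR (compact_near_coveringP K) cK) => z Kz.
(* One [e'] for the estimate around [z] and [2 * e'] for the change of derivative in each of the [n]
   coordinates. *)
pose e' := e / (2 * n%:R + 1).
have n1 : 0 < 2 * n%:R + 1 :> R by rewrite ltr_wpDl // mulr_ge0.
have e'0 : 0 < e' by rewrite divr_gt0.
have [d d0 H] := DP z Kz e' e'0.
have d20 : 0 < d / 2 by rewrite divr_gt0.
exists (polydisc z (d / 2), [set t | 0 < t < d / 2]).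
  split; first by apply/nbhs_cV; exists (d / 2).
  exists (d / 2) => //= t; rewrite /ball_ /= sub0r normrN => td t0.
  by rewrite t0 -[ltLHS]gtr0_norm.
move=> [x t] [/= zx /andP[t0 td]] Kx y r xy rt.
have zx' : polydisc z d x by apply: polydisc_le zx; lra.
have zy : polydisc z d y.
  move=> i; have := cmodBD (y i 0) (x i 0) (z i 0); have := xy.2 i; have := zx i; lra.
have H1 := H x y zx' zy r xy.
have DD := sdiff_deriv_close e'0 zx' H (DP x Kx).
rewrite -(subrKA (\sum_i D z i * (y i 0 - x i 0))).
apply: le_trans (cmodD _ _) _; rewrite -sumrB.
have -> : e * r = e' * r + 2 * e' * n%:R * r by rewrite /e'; field; rewrite gt_eqF.
apply: lerD => //.
apply: (@le_trans _ _ (\sum_(i < n) 2 * e' * r)); last first.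
  by rewrite sumr_const card_ord -[_ *+ n]mulr_natr [leRHS]mulrAC.
apply: le_trans (cmod_sum _ _ _) _; apply: ler_sum => i _.
rewrite -mulrBl cmodM; apply: ler_pM; rewrite ?cmod_ge0 //.
  by rewrite cmodB; exact: DD.
exact: xy.2.
Qed.

End UniformStrict.

(** * Cauchy's formula on discrete tori *)

Section DiscreteCauchy.
Variables (R : realType) (n : nat).
Local Notation C := (Cx R).

Lemma geom_sum_le (q : R) (N : nat) : 0 <= q -> q <= 2^-1 ->
  \sum_(m < N) q ^+ m <= 2.
Proof.
move=> q0 q2; have q1 : q != 1 by apply/eqP => q1; move: q2; rewrite q1; lra.
have H := subrX1 q N; have qN := exprn_ge0 N q0.
have q10 : 0 < 1 - q by lra.
rewrite -(ler_pM2l q10).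
have -> : (1 - q) * \sum_(m < N) q ^+ m = 1 - q ^+ N by rewrite -[1 - q]opprB mulNr -H opprB.
lra.
Qed.

Lemma root_geom_sum (x : C) (N : nat) : x ^+ N = 1 -> x != 1 ->
  \sum_(j < N) x ^+ j = 0.
Proof.
move=> xN x1; have := subrX1 x N; rewrite xN subrr.
by move/esym/eqP; rewrite mulf_eq0 subr_eq0 (negPf x1) => /eqP.
Qed.

Definition torus_offset (r : R) (N : nat) (j : {ffun 'I_n -> 'I_N}) (i : 'I_n) : C :=
  toC r * unity_root R N ^+ j i.

Definition torus_avg (N : nat) (F : {ffun 'I_n -> 'I_N} -> C) : C :=
  (N%:R ^+ n)^-1 * \sum_j F j.

(* Cauchy's integral for the coefficient of index al, discretised at the N-th roots of unity. *)
Definition cauchy_coef (f : 'cV[C]_n -> C) (a : 'cV[C]_n) (r : R) (N : nat)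
    (al : 'I_n -> nat) : C :=
  @torus_avg N (fun j => f (a + \col_i torus_offset r j i) *
                   \prod_i (torus_offset r j i)^-1 ^+ al i).

Lemma natr_neq0 (N : nat) : (0 < N)%N -> N%:R != 0 :> C.
Proof. by move=> N0; rewrite pnatr_eq0 -lt0n. Qed.

Lemma cmod_natr (N : nat) : cmod (N%:R : C) = N%:R.
Proof.
have -> : N%:R = toC N%:R :> C by rewrite /toC rmorph_nat.
by rewrite cmod_toC ger0_norm.
Qed.

Lemma card_grid (N : nat) : #|{ffun 'I_n -> 'I_N}| = (N ^ n)%N.
Proof. by rewrite card_ffun !card_ord. Qed.

Lemma torus_avg_le (N : nat) (F : {ffun 'I_n -> 'I_N} -> C) (B : R) : (0 < N)%N ->
  (forall j, cmod (F j) <= B) -> cmod (torus_avg F) <= B.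
Proof.
move=> N0 FB; rewrite /torus_avg cmodM cmodV cmodX cmod_natr.
rewrite mulrC ler_pdivrMr ?exprn_gt0 ?ltr0n //.
apply: le_trans (cmod_sum _ _ _) _.
apply: (le_trans (ler_sum _ (fun j _ => FB j))).
by rewrite sumr_const card_grid -[_ *+ _]mulr_natr natrX.
Qed.

Lemma cmod_torus_offset (r : R) (N : nat) (j : {ffun 'I_n -> 'I_N}) i : 0 <= r -> (0 < N)%N ->
  cmod (torus_offset r j i) = r.
Proof.
move=> r0 N0; rewrite cmodM cmodX cmod_unity_root // expr1n mulr1 cmod_toC.
by rewrite ger0_norm.
Qed.

Section FixedGrid.
Variables (a : 'cV[C]_n) (r : R) (N : nat) (u : 'I_n -> C).
Hypotheses (r0 : 0 < r) (N1 : (1 < N)%N) (ur : forall i, cmod (u i) <= r / 2).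
Local Notation grid := {ffun 'I_n -> 'I_N}.
Local Notation w := (unity_root R N).
Let N0 : (0 < N)%N. Proof. exact: ltnW. Qed.
Local Notation zeta := (@torus_offset r N).

(** The Cauchy kernel [zeta / (zeta - u)], expanded in powers of [u / zeta] and cut off at degree
    [N]. *)
Definition trunc_kernel (i : 'I_n) (k : 'I_N) : C :=
  \sum_(m < N) (u i / (toC r * w ^+ k)) ^+ m.

Let w0 : w != 0.
Proof. by rewrite -cmod_gt0 cmod_unity_root. Qed.

Let rC0 : toC r != 0.
Proof. by rewrite -cmod_gt0 cmod_toC normr_gt0 gt_eqF. Qed.

(** Cutting the kernel off costs the factor [1 - (u / r) ^ N], which is the same at all points of
    the grid because [zeta ^ N = r ^ N]. It can therefore be taken out of the averages. *)
Lemma trunc_kernel_mul i (j : grid) :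
  (zeta j i - u i) * trunc_kernel i (j i) = (1 - (u i / toC r) ^+ N) * zeta j i.
Proof.
have z0 : zeta j i != 0 by rewrite mulf_neq0 // expf_neq0.
rewrite /trunc_kernel -/(zeta j i); have := subrX1 (u i / zeta j i) N.
set S := \sum_(_ < _) _ => HS.
have -> : (zeta j i - u i) * S = - zeta j i * ((u i / zeta j i - 1) * S) by field.
rewrite -HS.
have -> : (u i / zeta j i) ^+ N = (u i / toC r) ^+ N.
  rewrite !expr_div_n /torus_offset exprMn -exprM mulnC exprM.
  by rewrite unity_root_pow // expr1n mulr1.
by rewrite mulNr -mulrN opprB mulrC.
Qed.

Lemma cmod_trunc_kernel i k : cmod (trunc_kernel i k) <= 2.
Proof.
apply: le_trans (cmod_sum _ _ _) _.
under eq_bigr do rewrite cmodX cmodM cmodV cmodM cmodX cmod_unity_root // expr1n mulr1 cmod_toC gtr0_norm //.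
apply: geom_sum_le; first by rewrite divr_ge0 ?cmod_ge0 // ltW.
by rewrite ler_pdivrMr // mulrC.
Qed.

Lemma sum_trunc_kernel i : \sum_k trunc_kernel i k = N%:R.
Proof.
rewrite exchange_big /= (bigD1 (Ordinal N0)) //=.
under eq_bigr do rewrite expr0.
rewrite sumr_const card_ord big1 ?addr0 // => m /eqP m0.
have E (k : 'I_N) : (u i / (toC r * w ^+ k)) ^+ m = (u i / toC r) ^+ m * (w ^+ m)^-1 ^+ k.
  by rewrite invfM mulrA exprMn !exprVn -!exprM mulnC.
under eq_bigr do rewrite E.
rewrite -mulr_sumr root_geom_sum ?mulr0 //.
  by rewrite exprVn -exprM mulnC exprM unity_root_pow // expr1n invr1.
rewrite invr_eq1; apply: unity_root_neq1; rewrite ltn_ord andbT lt0n.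
by apply/eqP => mm; apply: m0; apply: val_inj.
Qed.

(* A homotopy of the torus (s = 1) to the point a + u (s = 0): the discrete Cauchy polynomial is
   hsum f 1, the value f (a + u) is hsum f 0, and hsum f is almost constant in s, because turning
   one coordinate of the torus by w does not change the average. *)
Definition hpt (s : R) (j : grid) : 'cV[C]_n :=
  \col_i (a i 0 + (u i + toC s * (zeta j i - u i))).

Definition hsum (f : 'cV[C]_n -> C) (s : R) : C :=
  @torus_avg N (fun j => f (hpt s j) * \prod_i trunc_kernel i (j i)).

Lemma hsum1 f : hsum f 1 = cube_sum (cauchy_coef f a r N) u N.
Proof.
rewrite /hsum /torus_avg /cube_sum /cauchy_coef /torus_avg.
under [RHS]eq_bigr do rewrite -mulrA mulr_suml.
rewrite -mulr_sumr; congr (_ * _); rewrite exchange_big /=.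
apply: eq_bigr => j _; rewrite /trunc_kernel bigA_distr_bigA mulr_sumr /=.
apply: eq_bigr => al _; rewrite -mulrA; congr (f _ * _).
  by apply/colP => i; rewrite !mxE toC1 mul1r; ring.
rewrite -big_split /=; apply: eq_bigr => i _.
by rewrite mulrC exprMn.
Qed.

Lemma hsum0 f : hsum f 0 = f (a + \col_i u i).
Proof.
rewrite /hsum /torus_avg.
under eq_bigr => j _.
  have -> : hpt 0 j = a + \col_i u i.
    by apply/colP => i; rewrite !mxE toC0 mul0r addr0.
  over.
rewrite -mulr_sumr.
have := bigA_distr_bigA trunc_kernel; rewrite /= => <-.
under eq_bigr do rewrite sum_trunc_kernel.
rewrite prodr_const card_ord mulrCA mulVf ?mulr1 //.
by rewrite expf_neq0 // natr_neq0.
Qed.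

Lemma hpt_in (s : R) (j : grid) : 0 <= s <= 1 ->
  forall i, cmod (hpt s j i 0 - a i 0) <= r.
Proof.
move=> /andP[s0 s1] i; rewrite mxE.
have -> : a i 0 + (u i + toC s * (zeta j i - u i)) - a i 0 =
   toC (1 - s) * u i + toC s * zeta j i by rewrite toCB toC1; ring.
apply: le_trans (cmodD _ _) _; rewrite cmodM [cmod (toC s * _)]cmodM !cmod_toC.
rewrite cmod_torus_offset ?(ltW r0) //.
rewrite !ger0_norm ?subr_ge0 //.
have : (1 - s) * cmod (u i) <= (1 - s) * r.
  by apply: ler_wpM2l; [rewrite subr_ge0|move: (r0) (ur i) => p1 p2; lra].
lra.
Qed.

Definition rot (i : 'I_n) (j : grid) : grid :=
  [ffun l => if l == i then ordS (j l) else j l].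

Lemma rot_bij i : bijective (rot i).
Proof.
exists (fun j : grid => [ffun l => if l == i then ord_pred (j l) else j l] : grid).
  by move=> j; apply/ffunP => l; rewrite !ffunE; case: eqP => // _; rewrite ordSK.
by move=> j; apply/ffunP => l; rewrite !ffunE; case: eqP => // _; rewrite ord_predK.
Qed.

Definition rest_kernel (i : 'I_n) (j : grid) : C :=
  \prod_(l | l != i) trunc_kernel l (j l).

Lemma rest_kernel_rot i j : rest_kernel i (rot i j) = rest_kernel i j.
Proof. by apply: eq_bigr => l /negPf li; rewrite ffunE li. Qed.

Lemma cmod_rest_kernel i j : cmod (rest_kernel i j) <= 2 ^+ n.
Proof.
rewrite cmod_prod.
apply: (@le_trans _ _ (\prod_(l < n | l != i) (2 : R))).
  by apply: ler_prod => l _; rewrite cmod_ge0 cmod_trunc_kernel.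
rewrite prodr_const ler_weXn2l ?ler1n //.
by apply: leq_trans (max_card _) _; rewrite card_ord.
Qed.

Lemma cmod_full_kernel (j : grid) : cmod (\prod_i trunc_kernel i (j i)) <= 2 ^+ n.
Proof.
rewrite cmod_prod.
apply: (@le_trans _ _ (\prod_(l < n) (2 : R))).
  by apply: ler_prod => l _; rewrite cmod_ge0 cmod_trunc_kernel.
by rewrite prodr_const card_ord.
Qed.

Lemma sum_rot (g : grid -> C) i :
  \sum_j (g (rot i j) - g j) * rest_kernel i j = 0.
Proof.
under eq_bigr do rewrite mulrBl.
rewrite sumrB [X in _ - X](reindex (rot i)) /=; last exact: onW_bij (rot_bij i).
by under [X in _ - X]eq_bigr do rewrite rest_kernel_rot; rewrite subrr.
Qed.

Lemma zeta_rot i j : zeta (rot i j) i = w * zeta j i.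
Proof.
rewrite /torus_offset ffunE eqxx mulrCA -exprS /=; congr (_ * _).
by rewrite expr_mod // unity_root_pow.
Qed.

Lemma zeta_rot_neq i j l : l != i -> zeta (rot i j) l = zeta j l.
Proof. by move=> /negPf li; rewrite /torus_offset ffunE li. Qed.

Variables (f : 'cV[C]_n -> C) (D : 'cV[C]_n -> 'I_n -> C) (e d : R).
Hypotheses (e0 : 0 < e) (fD : forall x : 'cV[C]_n, (forall i, cmod (x i 0 - a i 0) <= r) ->
   forall y t, vdist_le x y t -> t < d ->
   cmod (f y - f x - \sum_i D x i * (y i 0 - x i 0)) <= e * t).
Hypothesis wd : cmod (w - 1) * r < d.

Let w1 : w != 1.
Proof. by have := @unity_root_neq1 R N 1; rewrite expr1; apply. Qed.

Let cw1 : 0 < cmod (w - 1).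
Proof. by rewrite cmod_gt0 subr_eq0. Qed.

(** Turning the coordinate [i] by [w] moves [hpt s j] by [s (w - 1) zeta j i] in that coordinate
    only. The increments of [f] cancel when summed against [rest_kernel], which does not see this
    coordinate, so their linear parts add up to the remainders alone. For [s = 0] nothing moves;
    there [D] is constant and the roots of unity themselves sum to 0. *)
Lemma rot_sum_le (s : R) i : 0 <= s <= 1 ->
  cmod (\sum_j D (hpt s j) i * zeta j i * rest_kernel i j) <= N%:R ^+ n * (e * r * 2 ^+ n).
Proof.
move=> s01; have /andP[s0 s1] := s01.
have rhs0 : 0 <= N%:R ^+ n * (e * r * 2 ^+ n).
  by rewrite !mulr_ge0 ?exprn_ge0 // ltW.
have [sE|spos] := eqVneq s 0.
  have hE j : hpt s j = a + \col_i u i.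
    by apply/colP => l; rewrite !mxE sE toC0 mul0r addr0.
  have := sum_rot (fun j => zeta j i) i.
  under eq_bigr do rewrite zeta_rot -{2}[zeta _ i]mul1r -mulrBl -mulrA.
  rewrite -mulr_sumr => /eqP; rewrite mulf_eq0 subr_eq0 (negPf w1) /= => /eqP H.
  under eq_bigr do rewrite hE -mulrA.
  by rewrite -mulr_sumr H mulr0 cmod0.
have sgt0 : 0 < s by rewrite lt_def spos.
have sw : 0 < s * cmod (w - 1) by rewrite mulr_gt0.
rewrite -(ler_pM2l sw).
have -> : s * cmod (w - 1) = cmod (toC s * (w - 1)).
  by rewrite cmodM cmod_toC ger0_norm.
rewrite -cmodM mulr_sumr.
have H := sum_rot (fun j => f (hpt s j)) i.
rewrite -[X in cmod X]subr0 -[X in cmod (_ - X)]H -sumrB cmodM cmod_toC ger0_norm //.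
apply: le_trans (cmod_sum _ _ _) _.
apply: (@le_trans _ _ (\sum_(j : grid) s * cmod (w - 1) * (e * r * 2 ^+ n))); last first.
  rewrite sumr_const card_grid -[_ *+ _]mulr_natr natrX.
  by rewrite le_eqVlt; apply/orP; left; apply/eqP; ring.
apply: ler_sum => j _; rewrite mulrA -mulrBl cmodM.
have -> : s * cmod (w - 1) * (e * r * 2 ^+ n) = e * (s * cmod (w - 1) * r) * 2 ^+ n by ring.
apply: ler_pM; rewrite ?cmod_ge0 ?cmod_rest_kernel //.
have diff l : hpt s (rot i j) l 0 - hpt s j l 0 =
   (l == i)%:R * (toC s * (w - 1) * zeta j i).
  rewrite !mxE; have [->|li] := eqVneq l i; first by rewrite zeta_rot mul1r; ring.
  by rewrite zeta_rot_neq // subrr mul0r.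
have dist : vdist_le (hpt s j) (hpt s (rot i j)) (s * cmod (w - 1) * r).
  split; first by rewrite !mulr_ge0 // ltW.
  move=> l; rewrite diff; case: eqP => _; last first.
    by rewrite mul0r cmod0 !mulr_ge0 // ltW.
  by rewrite mul1r cmodM [cmod (toC s * _)]cmodM cmod_toC ger0_norm // cmod_torus_offset // ltW.
have := fD (hpt_in j s01) dist.
have sd : s * cmod (w - 1) * r < d.
  apply: le_lt_trans wd; rewrite -mulrA ler_piMl // mulr_ge0 // ltW //.
move=> /(_ sd); rewrite (bigD1 i) //= big1 ?addr0; last first.
  by move=> l /negPf li; rewrite diff li mul0r mulr0.
rewrite diff eqxx mul1r => H1.
apply: le_trans H1; rewrite cmodB le_eqVlt; apply/orP; left; apply/eqP; congr cmod; ring.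
Qed.

(** To first order the increment is [h] times the average of [D i (zeta i - u i)] against the full
    kernel. By [trunc_kernel_mul] the factor [zeta i - u i] turns the [i]-th kernel into a constant
    multiple of [zeta i], and what is left is the average that [rot_sum_le] shows to be small. *)
Lemma hsum_step (s h : R) : 0 <= s -> 0 <= h -> s + h <= 1 -> 2 * h * r < d ->
  cmod (hsum f (s + h) - hsum f s) <= h * (e * r * 2 ^+ n * (2 * n%:R + 2)).
Proof.
move=> s0 h0 sh hd; have s01 : 0 <= s <= 1 by rewrite s0 /=; lra.
have zu i (j : grid) : cmod (zeta j i - u i) <= 2 * r.
  apply: le_trans (cmodBle _ _) _; rewrite cmod_torus_offset ?ltW //.
  by move: (r0) (ur i) => p1 p2; lra.
have diff i (j : grid) : hpt (s + h) j i 0 - hpt s j i 0 = toC h * (zeta j i - u i).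
  by rewrite !mxE toCD; ring.
pose A := torus_avg (fun j : grid => (f (hpt (s + h) j) - f (hpt s j) -
   \sum_i D (hpt s j) i * (hpt (s + h) j i 0 - hpt s j i 0)) * \prod_i trunc_kernel i (j i)).
pose B i := torus_avg (fun j : grid => D (hpt s j) i * zeta j i * rest_kernel i j).
have -> : hsum f (s + h) - hsum f s =
   A + toC h * \sum_i (1 - (u i / toC r) ^+ N) * B i.
  rewrite /hsum /A /B /torus_avg.
  have -> : \sum_i (1 - (u i / toC r) ^+ N) * ((N%:R ^+ n)^-1 *
      (\sum_(j : grid) D (hpt s j) i * zeta j i * rest_kernel i j)) =
     (N%:R ^+ n)^-1 * \sum_(j : grid) \sum_i (1 - (u i / toC r) ^+ N) *
       (D (hpt s j) i * zeta j i * rest_kernel i j).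
    rewrite exchange_big /= mulr_sumr; apply: eq_bigr => i _.
    by rewrite -mulr_sumr mulrCA.
  rewrite [toC h * _]mulrCA -mulrBr -mulrDr; congr (_ * _).
  rewrite -sumrB mulr_sumr -big_split /=; apply: eq_bigr => j _.
  have -> : toC h * (\sum_i (1 - (u i / toC r) ^+ N) * (D (hpt s j) i * zeta j i * rest_kernel i j))
    = (\sum_i D (hpt s j) i * (hpt (s + h) j i 0 - hpt s j i 0)) * \prod_i trunc_kernel i (j i).
    rewrite mulr_sumr mulr_suml; apply: eq_bigr => i _.
    rewrite diff (bigD1 (P := xpredT) i) //= -/(rest_kernel i j).
    rewrite [RHS](_ : _ = toC h * D (hpt s j) i *
       ((zeta j i - u i) * trunc_kernel i (j i)) * rest_kernel i j); last by ring.
    by rewrite trunc_kernel_mul; ring.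
  by ring.
have -> : h * (e * r * 2 ^+ n * (2 * n%:R + 2)) =
   e * (h * (2 * r)) * 2 ^+ n + h * (n%:R * (2 * (e * r * 2 ^+ n))) by ring.
apply: le_trans (cmodD _ _) (lerD _ _).
  apply: torus_avg_le => // j; rewrite cmodM.
  apply: ler_pM; rewrite ?cmod_ge0 ?cmod_full_kernel //.
  apply: fD; first exact: hpt_in.
    split; first by rewrite !mulr_ge0 // ltW.
    move=> i; rewrite diff cmodM cmod_toC ger0_norm //.
    exact: ler_wpM2l.
  by rewrite mulrA (mulrC h).
rewrite cmodM cmod_toC ger0_norm //; apply: ler_wpM2l => //.
apply: le_trans (cmod_sum _ _ _) _.
apply: (@le_trans _ _ (\sum_(i < n) 2 * (e * r * 2 ^+ n))); last first.
  by rewrite sumr_const card_ord -[_ *+ n]mulr_natr [leRHS]mulrC.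
apply: ler_sum => i _; rewrite cmodM; apply: ler_pM; rewrite ?cmod_ge0 //.
  apply: le_trans (cmodBle _ _) _; rewrite cmod1 cmodX cmodM cmodV cmod_toC gtr0_norm //.
  have q1 : cmod (u i) / r <= 1 by rewrite ler_pdivrMr // mul1r; move: (r0) (ur i) => p1 p2; lra.
  have : (cmod (u i) / r) ^+ N <= 1.
    by apply: exprn_ile1 => //; rewrite divr_ge0 ?cmod_ge0 // ltW.
  lra.
rewrite /B /torus_avg cmodM cmodV cmodX cmod_natr mulrC ler_pdivrMr; last first.
  by rewrite exprn_gt0 // ltr0n.
by rewrite mulrC; exact: rot_sum_le.
Qed.

End FixedGrid.

Lemma discrete_cauchy (f : 'cV[C]_n -> C) (a : 'cV[C]_n) (r : R) : 0 < r ->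
  (forall x : 'cV[C]_n, (forall i, cmod (x i 0 - a i 0) <= r) -> sdiff f x) ->
  forall e : R, 0 < e -> exists N0, forall N, (N0 < N)%N ->
   forall u : 'I_n -> C, (forall i, cmod (u i) <= r / 2) ->
     cmod (cube_sum (cauchy_coef f a r N) u N - f (a + \col_i u i)) <= e.
Proof.
move=> r0 fd e e0.
have [D DP] := sdiff_uniform (@compact_cpolydisc _ _ a r) fd.
set c := r * 2 ^+ n * (2 * n%:R + 2).
have c0 : 0 < c by rewrite !mulr_gt0 ?exprn_gt0 // ltr_wpDl // mulr_ge0.
have ec0 : 0 < e / c by rewrite divr_gt0.
have [d d0 fD] := DP _ ec0.
have dr0 : 0 < d / r by rewrite divr_gt0.
have [N0 NP] := unity_root_near1 dr0.
exists (maxn N0 1) => N; rewrite gtn_max => /andP[N0N N1] u ur.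
have wd : cmod (unity_root R N - 1) * r < d by rewrite -ltr_pdivlMr // NP.
(* The way from [s = 0] to [s = 1] is cut into [K] steps; in each of them the points move by at most
   [2 * r / K < d]. *)
pose K := (Num.bound (2 * r / d)).+1.
have K0 : 0 < K%:R :> R by rewrite ltr0n.
have hd : 2 * K%:R^-1 * r < d.
  rewrite mulrAC ltr_pdivrMr // [ltRHS]mulrC -ltr_pdivrMr //.
  have p0 : 0 <= 2 * r / d by rewrite divr_ge0 ?mulr_ge0 // ltW.
  by apply: lt_trans (archi_boundP p0) _; rewrite ltr_nat.
rewrite -hsum1 -(@hsum0 a r N u N1 f).
have step m : (m <= K)%N -> cmod (hsum a r N u f (m%:R / K%:R) - hsum a r N u f 0) <=
   m%:R / K%:R * e.
  elim: m => [_|m IH mK]; first by rewrite !mul0r subrr cmod0.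
  have := IH (ltnW mK) => {}IH.
  apply: le_trans (cmodBD _ (hsum a r N u f (m%:R / K%:R)) _) _.
  have -> : m.+1%:R / K%:R = m%:R / K%:R + K%:R^-1 :> R.
    by rewrite -natr1 mulrDl mul1r.
  rewrite mulrDl addrC; apply: lerD => //.
  have mK0 : 0 <= m%:R / K%:R :> R by rewrite divr_ge0.
  have K1 : 0 <= K%:R^-1 :> R by rewrite invr_ge0.
  have mK1 : m%:R / K%:R + K%:R^-1 <= 1 :> R.
    by rewrite -{2}[K%:R^-1]mul1r -mulrDl natr1 ler_pdivrMr // mul1r ler_nat.
  apply: le_trans (hsum_step r0 N1 ur ec0 fD wd mK0 K1 mK1 hd) _.
  rewrite -!mulrA ler_pM2l ?invr_gt0 //.
  rewrite le_eqVlt; apply/orP; left; apply/eqP; rewrite /c; field.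
  by rewrite !gt_eqF ?exprn_gt0 // ltr_wpDl // mulr_ge0.
by have := step K (leqnn K); rewrite divff ?mul1r // gt_eqF.
Qed.

End DiscreteCauchy.

(** * Convergence of the interpolating polynomials *)

Section PolynomialApproximation.
Variables (R : realType) (n : nat).
Local Notation C := (Cx R).

Lemma cx_cauchy_cvg (u : nat -> C) :
  (forall e : R, 0 < e -> exists N, forall m l, (N <= m)%N -> (N <= l)%N ->
     cmod (u m - u l) <= e) -> exists l : C, u N @[N --> \oo] --> l.
Proof.
move=> cu.
have real_cvg (p : C -> R) : (forall x y, `|p x - p y| <= cmod (x - y)) ->
    exists l : R, (p \o u) N @[N --> \oo] --> l.
  move=> pu; apply/(@cvg_ex R).
  apply: R_complete; apply: cauchy_exP => e e0.
  have e20 : 0 < e / 2 by rewrite divr_gt0.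
  have [N NP] := cu _ e20; exists (p (u N)); exists N => // m /= Nm.
  rewrite /ball /=; apply: le_lt_trans (pu _ _) _.
  apply: le_lt_trans (NP N m (leqnn N) Nm) _.
  by rewrite ltr_pdivrMr // mulr_natr mulr2n ltrDl.
have ReB (x y : C) : `|complex.Re x - complex.Re y| <= cmod (x - y).
  by have := reC_le (x - y); rewrite reCB.
have ImB (x y : C) : `|complex.Im x - complex.Im y| <= cmod (x - y).
  by case: x y => [x1 x2] [y1 y2]; exact: (Im_le_cmod ((x1 - y1) +i* (x2 - y2))%C).
have [a /cvgrPdist_lt ua] := real_cvg _ ReB.
have [b /cvgrPdist_lt ub] := real_cvg _ ImB.
exists (a +i* b)%C; apply/cvg_cmodP => e e0.
have e20 : 0 < e / 2 by rewrite divr_gt0.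
apply: filterS2 (ua _ e20) (ub _ e20) => N /= aN bN.
have le : cmod (u N - (a +i* b)%C) <= `|complex.Re (u N) - a| + `|complex.Im (u N) - b|.
  by case: (u N) => [x1 x2]; exact: (cmod_le_ReIm ((x1 - a) +i* (x2 - b))%C).
by apply: le_lt_trans le _; rewrite (splitr e) ltrD // distrC.
Qed.

Lemma unity_root_inj_mod (N p q : nat) : (0 < N)%N ->
  unity_root R N ^+ p = unity_root R N ^+ q -> p = q %[mod N].
Proof.
move=> N0; wlog pq : p q / (p %% N <= q %% N)%N.
  move=> H pq; have /orP[|] := leq_total (p %% N) (q %% N) => le; first exact: H.
  by apply/esym/H.
rewrite -(expr_mod p (unity_root_pow _ N0)) -(expr_mod q (unity_root_pow _ N0)) => H.
apply/eqP; rewrite eqn_leq pq /= leqNgt; apply/negP => lt.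
have := @unity_root_neq1 R N (q %% N - p %% N).
rewrite subn_gt0 lt (leq_ltn_trans (leq_subr _ _) (ltn_pmod _ N0)) => /(_ isT) /eqP; apply.
have w0 : unity_root R N ^+ (p %% N) != 0.
  by rewrite -cmod_gt0 cmodX cmod_unity_root // expr1n.
by apply: (mulfI w0); rewrite -exprD subnKC // mulr1.
Qed.

Section Torus.
Variables (rho : R) (M : nat).
Hypotheses (rho0 : 0 < rho) (M0 : (0 < M)%N).
Local Notation grid := {ffun 'I_n -> 'I_M}.
Local Notation w := (unity_root R M).
Local Notation zeta := (@torus_offset R n rho M).

Lemma torus_offset_neq0 (j : grid) i : zeta j i != 0.
Proof. by rewrite -cmod_gt0 cmod_torus_offset // ltW. Qed.

(** The sum over the grid factors over the coordinates, and the factor of [i0] is a full geometric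
    sum of an [M]-th root of unity different from 1. *)
Lemma torus_orth0 (p q : 'I_n -> nat) (i0 : 'I_n) : p i0 != q i0 %[mod M] ->
  torus_avg (fun j : grid => \prod_i (zeta j i ^+ p i * (zeta j i)^-1 ^+ q i)) = 0.
Proof.
move=> pq; rewrite /torus_avg.
have := bigA_distr_bigA (fun i (k : 'I_M) =>
   (toC rho * w ^+ k) ^+ p i * (toC rho * w ^+ k)^-1 ^+ q i).
rewrite /= => <-; rewrite (bigD1 i0) //=.
have E (k : 'I_M) : (toC rho * w ^+ k) ^+ p i0 * (toC rho * w ^+ k)^-1 ^+ q i0 =
   toC rho ^+ p i0 * (toC rho)^-1 ^+ q i0 * (w ^+ p i0 / w ^+ q i0) ^+ k.
  rewrite invfM !exprMn mulrACA; congr (_ * _).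
  by rewrite !exprVn -!exprM mulnC [(k * _)%N]mulnC.
under eq_bigr do rewrite E.
rewrite -mulr_sumr root_geom_sum ?mulr0 ?mul0r ?mulr0 //.
  by rewrite exprMn exprVn -!exprM mulnC exprM [(_ * M)%N]mulnC exprM unity_root_pow // !expr1n invr1 mulr1.
have wq : w ^+ q i0 != 0 by rewrite -cmod_gt0 cmodX cmod_unity_root // expr1n.
apply/eqP => /(congr1 (fun x => x * w ^+ q i0)); rewrite divfK // mul1r => H.
by move/eqP: pq; apply; exact: unity_root_inj_mod.
Qed.

Lemma torus_avg1 (F : grid -> C) (c : C) : (forall j, F j = c) -> torus_avg F = c.
Proof.
move=> Fc; rewrite /torus_avg (eq_bigr (fun=> c)) //.
rewrite sumr_const card_grid -[c *+ _]mulr_natr mulrCA natrX mulVf ?mulr1 //.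
by rewrite expf_neq0 // natr_neq0.
Qed.

Lemma torus_avgD (F G : grid -> C) :
  torus_avg (fun j => F j + G j) = torus_avg F + torus_avg G.
Proof. by rewrite /torus_avg big_split mulrDr. Qed.

Lemma torus_avgZ (c : C) (F : grid -> C) :
  torus_avg (fun j => c * F j) = c * torus_avg F.
Proof. by rewrite /torus_avg -mulr_sumr mulrCA. Qed.

Lemma torus_avg_sum (I : finType) (F : I -> grid -> C) :
  torus_avg (fun j => \sum_i F i j) = \sum_i torus_avg (F i).
Proof. by rewrite /torus_avg exchange_big mulr_sumr. Qed.

(** Discrete Fourier inversion. The condition [L <= M] excludes aliasing: exponents below [L] that
    differ also differ modulo [M]. *)
Lemma coef_extract (c : ('I_n -> nat) -> C) (L : nat) (al : 'I_n -> nat) :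
  (L <= M)%N -> (forall i, (al i < L)%N) ->
  torus_avg (fun j : grid => cube_sum c (zeta j) L * \prod_i (zeta j i)^-1 ^+ al i) = c al.
Proof.
move=> LM alL.
transitivity (torus_avg (fun j : grid => \sum_(be : {ffun 'I_n -> 'I_L})
    c (fun i => be i) * \prod_i (zeta j i ^+ be i * (zeta j i)^-1 ^+ al i))).
  congr torus_avg; apply/funext => j; rewrite mulr_suml; apply: eq_bigr => be _.
  by rewrite -mulrA -big_split.
rewrite torus_avg_sum (bigD1 [ffun i => Ordinal (alL i)]) //=.
rewrite torus_avgZ (@torus_avg1 _ 1); last first.
  move=> j; rewrite big1 // => i _; rewrite ffunE /= exprVn mulfV //.
  by rewrite expf_neq0 // torus_offset_neq0.
rewrite mulr1 big1 ?addr0.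
  by congr c; apply/funext => i; rewrite ffunE.
move=> be /eqP be_neq; rewrite torus_avgZ.
have [i0 bi|be_al] := pickP (fun i => be i != al i :> nat).
  rewrite (@torus_orth0 (fun i => be i) al i0) ?mulr0 //.
  by rewrite !modn_small // (leq_trans _ LM).
case: be_neq; apply/ffunP => i; apply: val_inj; rewrite ffunE /=.
by apply/eqP; rewrite -[_ == _]negbK be_al.
Qed.

(** In the coordinate [i0] all exponents of the product lie strictly between 0 and [M], so every
    monomial averages to 0. *)
Lemma coef_pos_zero (c : ('I_n -> nat) -> C) (L : nat) (al : 'I_n -> nat) (i0 : 'I_n) :
  (0 < al i0)%N -> (L + al i0 <= M)%N ->
  torus_avg (fun j : grid => cube_sum c (zeta j) L * \prod_i zeta j i ^+ al i) = 0.
Proof.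
move=> al0 alM.
transitivity (torus_avg (fun j : grid => \sum_(be : {ffun 'I_n -> 'I_L})
    c (fun i => be i) * \prod_i (zeta j i ^+ (be i + al i) * (zeta j i)^-1 ^+ 0))).
  congr torus_avg; apply/funext => j; rewrite mulr_suml; apply: eq_bigr => be _.
  rewrite -mulrA -big_split /=; congr (_ * _); apply: eq_bigr => i _.
  by rewrite expr0 mulr1 exprD.
rewrite torus_avg_sum big1 // => be _; rewrite torus_avgZ.
rewrite (@torus_orth0 (fun i => be i + al i)%N (fun=> 0%N) i0) ?mulr0 //.
rewrite mod0n modn_small ?addn_eq0 ?negb_and -?lt0n ?al0 ?orbT //.
by apply: leq_trans alM; rewrite ltn_add2r.
Qed.

Lemma torus_avg_dom (F G : grid -> C) : (forall j, cmod (F j) <= reC (G j)) ->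
  cmod (torus_avg F) <= reC (torus_avg G).
Proof.
move=> FG; rewrite /torus_avg cmodM cmodV cmodX cmod_natr.
have -> : (M%:R ^+ n)^-1 = toC (M%:R ^+ n)^-1 :> C.
  by rewrite /toC fmorphV rmorphXn rmorph_nat.
rewrite reC_toCM reC_sum; apply: ler_wpM2l; first by rewrite invr_ge0 exprn_ge0.
by apply: le_trans (cmod_sum _ _ _) _; apply: ler_sum.
Qed.

End Torus.

Lemma cmod_monomial_inv (rho : R) (M : nat) (j : {ffun 'I_n -> 'I_M}) (al : 'I_n -> nat) :
  0 < rho -> (0 < M)%N ->
  cmod (\prod_i (torus_offset rho j i)^-1 ^+ al i) = \prod_(i < n) rho^-1 ^+ al i.
Proof.
move=> r0 M0; rewrite cmod_prod; apply: eq_bigr => i _.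
by rewrite cmodX cmodV cmod_torus_offset // ltW.
Qed.

Lemma coef_le (rho B : R) (c : ('I_n -> nat) -> C) (L : nat) (al : 'I_n -> nat) :
  0 < rho -> (forall i, (al i < L)%N) -> (0 < L)%N ->
  (forall u : 'I_n -> C, (forall i, cmod (u i) <= rho) -> cmod (cube_sum c u L) <= B) ->
  cmod (c al) * \prod_i rho ^+ al i <= B.
Proof.
move=> rho0 alL L0 cB; rewrite -(coef_extract rho0 L0 c (leqnn L) alL).
have pr0 : 0 < \prod_i rho ^+ al i by apply: prodr_gt0 => i _; rewrite exprn_gt0.
rewrite -ler_pdivlMr //; apply: torus_avg_le => // j.
rewrite cmodM cmod_monomial_inv //.
have -> : \prod_(i < n) rho^-1 ^+ al i = (\prod_i rho ^+ al i)^-1.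
  by rewrite -prodfV; apply: eq_bigr => i _; rewrite exprVn.
apply: ler_pM; rewrite ?cmod_ge0 ?invr_ge0 ?(ltW pr0) //.
by apply: cB => i; rewrite cmod_torus_offset // ltW.
Qed.

Lemma cube_sumB (c c' : ('I_n -> nat) -> C) u N :
  cube_sum c u N - cube_sum c' u N = cube_sum (fun al => c al - c' al) u N.
Proof. by rewrite /cube_sum -sumrB; apply: eq_bigr => al _; rewrite mulrBl. Qed.

Lemma geometric_cube_le (N : nat) : \sum_(al : {ffun 'I_n -> 'I_N})
   \prod_i 2^-1 ^+ al i <= 2 ^+ n :> R.
Proof.
have := bigA_distr_bigA (fun (i : 'I_n) (k : 'I_N) => (2^-1 : R) ^+ k); rewrite /= => <-.
apply: (@le_trans _ _ (\prod_(i < n) (2 : R))); last by rewrite prodr_const card_ord.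
apply: ler_prod => i _; rewrite geom_sum_le ?invr_ge0 // andbT.
by apply: sumr_ge0 => k _; rewrite exprn_ge0.
Qed.

Lemma multi_index_bound (al : 'I_n -> nat) (L : nat) : (\sum_i al i < L)%N ->
  forall i, (al i < L)%N.
Proof.
by move=> alL i; apply: leq_ltn_trans alL; rewrite (bigD1 i) //= leq_addr.
Qed.

(** Cauchy's estimate for the difference of two polynomials of different sizes. [M] exceeds both, so
    one grid reads off both coefficients. This is what makes the coefficients of the interpolating
    polynomials converge. *)
Lemma coef_diff_le (rho eps : R) (c c' : ('I_n -> nat) -> C) (L L' : nat)
    (g : ('I_n -> C) -> C) (al : 'I_n -> nat) :
  0 < rho -> (forall i, al i < L)%N -> (forall i, al i < L')%N ->
  (forall u : 'I_n -> C, (forall i, cmod (u i) <= rho) -> cmod (cube_sum c u L - g u) <= eps) ->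
  (forall u : 'I_n -> C, (forall i, cmod (u i) <= rho) -> cmod (cube_sum c' u L' - g u) <= eps) ->
  cmod (c al - c' al) * \prod_i rho ^+ al i <= 2 * eps.
Proof.
move=> rho0 alL alL' cg cg'.
pose M := (maxn L L').+1; have M0 : (0 < M)%N by [].
have LM : (L <= M)%N by rewrite ltnW // ltnS leq_maxl.
have LM' : (L' <= M)%N by rewrite ltnW // ltnS leq_maxr.
rewrite -(coef_extract rho0 M0 c LM alL) -(coef_extract rho0 M0 c' LM' alL').
have pr0 : 0 < \prod_i rho ^+ al i by apply: prodr_gt0 => i _; rewrite exprn_gt0.
rewrite -ler_pdivlMr // /torus_avg -mulrBr -sumrB.
apply: torus_avg_le => // j; rewrite -mulrBl cmodM cmod_monomial_inv //.
have -> : \prod_(i < n) rho^-1 ^+ al i = (\prod_i rho ^+ al i)^-1.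
  by rewrite -prodfV; apply: eq_bigr => i _; rewrite exprVn.
apply: ler_pM; rewrite ?cmod_ge0 ?invr_ge0 ?(ltW pr0) //.
have on i : cmod (torus_offset rho j i) <= rho by rewrite cmod_torus_offset // ltW.
apply: le_trans (cmodBD _ (g (torus_offset rho j)) _) _.
by rewrite mulr2n mulrDl mul1r lerD ?cg // cmodB cg'.
Qed.

(** The coefficients may change with [N]; their convergence is a consequence and not part of the
    definition. *)
Definition cube_approx (g : 'cV[C]_n -> C) (a : 'cV[C]_n) (rho : R)
    (c : nat -> ('I_n -> nat) -> C) : Prop :=
  forall e : R, 0 < e -> exists N0, forall N, (N0 < N)%N ->
   forall u : 'I_n -> C, (forall i, cmod (u i) <= rho) ->
     cmod (cube_sum (c N) u N - g (a + \col_i u i)) <= e.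

Lemma cube_sum_bounded (c : ('I_n -> nat) -> C) (N : nat) (rho : R) : 0 <= rho ->
  exists B, forall u : 'I_n -> C, (forall i, cmod (u i) <= rho) ->
    cmod (cube_sum c u N) <= B.
Proof.
move=> rho0; exists (\sum_(al : {ffun 'I_n -> 'I_N}) cmod (c (fun i => al i)) *
   \prod_(i < n) rho ^+ al i) => u ur.
apply: le_trans (cmod_sum _ _ _) _; apply: ler_sum => al _.
rewrite cmodM; apply: ler_wpM2l; first exact: cmod_ge0.
rewrite cmod_prod; apply: ler_prod => i _; rewrite cmod_ge0 /= cmodX.
by apply: lerXn2r; rewrite ?nnegrE ?cmod_ge0.
Qed.

(** The coefficients form Cauchy sequences by [coef_diff_le], and the limits inherit Cauchy's
    estimate. Halving the radius makes the errors of the coefficients summable. *)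
Lemma cube_approx_coefs (g : 'cV[C]_n -> C) (a : 'cV[C]_n) (rho : R)
    (c : nat -> ('I_n -> nat) -> C) : 0 < rho -> cube_approx g a rho c ->
  exists (A : ('I_n -> nat) -> C) (B : R),
   (forall al, cmod (A al) * \prod_(i < n) rho ^+ al i <= B) /\
   (forall u : 'I_n -> C, (forall i, cmod (u i) <= rho / 2) ->
     cube_sum A u N @[N --> \oo] --> g (a + \col_i u i)).
Proof.
move=> rho0 gc.
have /choice[A AP] : forall al : 'I_n -> nat, exists l : C,
    c N al @[N --> \oo] --> l.
  move=> al; apply: cx_cauchy_cvg => e e0.
  have pr0 : 0 < \prod_i rho ^+ al i by apply: prodr_gt0 => i _; rewrite exprn_gt0.
  have e'0 : 0 < e * \prod_i rho ^+ al i / 2 by rewrite divr_gt0 // mulr_gt0.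
  have [N0 NP] := gc _ e'0.
  exists (maxn N0 (\sum_i al i)).+1 => m l; rewrite !gtn_max => /andP[m1 m2] /andP[l1 l2].
  have := coef_diff_le rho0 (multi_index_bound m2) (multi_index_bound l2) (NP m m1) (NP l l1).
  by rewrite [leRHS]mulrC divfK // ler_pM2r.
have Adiff e : 0 < e -> exists N0, forall N, (N0 < N)%N -> forall al, (forall i, al i < N)%N ->
    cmod (A al - c N al) * \prod_i rho ^+ al i <= e.
  move=> e0; have e20 : 0 < e / 2 by rewrite divr_gt0.
  have [N0 NP] := gc _ e20.
  exists N0 => N N0N al alN.
  have pr0 : 0 < \prod_i rho ^+ al i by apply: prodr_gt0 => i _; rewrite exprn_gt0.
  rewrite -ler_pdivlMr //; apply: (cvg_cmod_le (AP al)).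
  exists (maxn N0 (\sum_i al i)).+1 => // m /=; rewrite gtn_max => /andP[m1 m2].
  rewrite ler_pdivlMr //.
  by have := coef_diff_le rho0 (multi_index_bound m2) alN (NP m m1) (NP N N0N); rewrite [leRHS]mulrC divfK.
have [N1 N1P] := gc 1 ltr01.
have [B0 B0P] := @cube_sum_bounded (c N1.+1) N1.+1 rho (ltW rho0).
(* [B0] bounds the polynomial of size [N1.+1], which is within 1 of [g]; every later polynomial is
   again within 1 of [g]. *)
exists A, (B0 + 2); split=> [al|u ur].
  have pr0 : 0 < \prod_i rho ^+ al i by apply: prodr_gt0 => i _; rewrite exprn_gt0.
  rewrite -ler_pdivlMr // -[A al]subr0; apply: (cvg_cmod_le (AP al)).
  exists (maxn N1 (\sum_i al i)).+1 => // m /=; rewrite gtn_max => /andP[m1 m2].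
  rewrite subr0 ler_pdivlMr //; apply: (@coef_le _ _ (c m) m) => //.
  - exact: multi_index_bound.
  - exact: (leq_ltn_trans (leq0n _) m1).
  move=> u ur; have h1 := N1P m m1 u ur; have h2 := N1P _ (ltnSn N1) u ur.
  have h3 := B0P u ur.
  have := cmodBD (cube_sum (c m) u m) (g (a + \col_i u i)) 0.
  have := cmodBD (g (a + \col_i u i)) (cube_sum (c N1.+1) u N1.+1) 0.
  rewrite (cmodB (g _) (cube_sum _ _ _)) !subr0; lra.
apply/cvg_cmodP => e e0.
have e20 : 0 < e / 2 by rewrite divr_gt0.
(* On the halved polydisc the error of the coefficient [al] is multiplied by [2 ^ (- |al|)], and
   these weights sum to at most [2 ^ n] for every [N]. *)
have e2n : 0 < e / 4 / 2 ^+ n by rewrite !divr_gt0 // exprn_gt0.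
have e40 : 0 < e / 4 by rewrite divr_gt0.
have [N2 N2P] := Adiff _ e2n; have [N3 N3P] := gc _ e40.
exists (maxn N2 N3).+1 => // N /=; rewrite gtn_max => /andP[NN2 NN3].
have ur' i : cmod (u i) <= rho by apply: le_trans (ur i) _; lra.
apply: le_lt_trans (cmodBD _ (cube_sum (c N) u N) _) _.
apply: (@le_lt_trans _ _ (e / 4 + e / 4)); last by lra.
apply: lerD; last exact: N3P.
rewrite cube_sumB; apply: le_trans (cmod_sum _ _ _) _.
apply: (@le_trans _ _ (\sum_(al : {ffun 'I_n -> 'I_N}) e / 4 / 2 ^+ n * \prod_i 2^-1 ^+ al i)).
  apply: ler_sum => al _; rewrite cmodM.
  apply: (@le_trans _ _ (cmod (A (fun i => al i) - c N (fun i => al i)) *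
     ((\prod_i rho ^+ al i) * \prod_i 2^-1 ^+ al i))).
    apply: ler_wpM2l; first exact: cmod_ge0.
    rewrite -big_split /= cmod_prod; apply: ler_prod => i _.
    rewrite cmod_ge0 /= cmodX -exprMn; apply: lerXn2r; rewrite ?nnegrE ?cmod_ge0 //.
    by rewrite mulr_ge0 ?invr_ge0 // ltW.
  rewrite mulrA; apply: ler_wpM2r.
    by apply: prodr_ge0 => i _; rewrite exprn_ge0 // invr_ge0.
  exact: N2P.
rewrite -mulr_sumr; apply: (@le_trans _ _ (e / 4 / 2 ^+ n * 2 ^+ n)).
  by rewrite ler_pM2l // geometric_cube_le.
by rewrite divfK // expf_neq0.
Qed.

Lemma cube_approx_analytic (g : 'cV[C]_n -> C) (a : 'cV[C]_n) (rho : R)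
    (c : nat -> ('I_n -> nat) -> C) : 0 < rho -> cube_approx g a rho c ->
  analytic_at g a.
Proof.
move=> rho0 /(cube_approx_coefs rho0)[A [B [AB Ag]]].
have r20 : 0 < rho / 2 by rewrite divr_gt0.
exists A, (toC (rho / 2)), (toC (B * 2 ^+ n)); split; first by rewrite ltrC.
  move=> N; rewrite /cube_sum.
  have -> : \sum_(al : {ffun 'I_n -> 'I_N}) `|A (fun i => al i)| * \prod_(i < n) toC (rho / 2) ^+ al i
    = toC (\sum_(al : {ffun 'I_n -> 'I_N}) cmod (A (fun i => al i)) * \prod_(i < n) (rho / 2) ^+ al i).
    rewrite toC_sum; apply: eq_bigr => al _; rewrite [RHS]toCM cmodE; congr (_ * _).
    rewrite (big_morph (@toC R) (@toCM R) (@toC1 R)).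
    by apply: eq_bigr => i _; rewrite toCX.
  rewrite lerC; apply: (@le_trans _ _ (\sum_(al : {ffun 'I_n -> 'I_N}) B * \prod_i 2^-1 ^+ al i)).
    apply: ler_sum => al _.
    have -> : \prod_(i < n) (rho / 2) ^+ al i = \prod_(i < n) rho ^+ al i * \prod_i 2^-1 ^+ al i.
      by rewrite -big_split; apply: eq_bigr => i _; rewrite exprMn.
    rewrite mulrA; apply: ler_wpM2r; last exact: AB.
    by apply: prodr_ge0 => i _; rewrite exprn_ge0 // invr_ge0.
  rewrite -mulr_sumr ler_wpM2l ?geometric_cube_le //.
  have := AB (fun=> 0%N); rewrite big1 // mulr1; apply: le_trans; exact: cmod_ge0.
move=> h hr; have -> : h = \col_i h i 0 by apply/colP => i; rewrite mxE.
under eq_cvg do under [cube_sum _ _ _]eq_bigr do under eq_bigr do rewrite mxE.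
by apply: Ag => i; have := hr i; rewrite -cmodE ltrC; exact: ltW.
Qed.

Lemma cauchy_coef_sum_le (f : 'cV[C]_n -> C) (a : 'cV[C]_n) (r B : R) (N : nat) (u : 'I_n -> C) :
  0 < r -> (1 < N)%N -> (forall i, cmod (u i) <= r / 2) ->
  (forall x : 'cV[C]_n, (forall i, cmod (x i 0 - a i 0) <= r) -> cmod (f x) <= B) ->
  cmod (cube_sum (cauchy_coef f a r N) u N) <= B * 2 ^+ n.
Proof.
move=> r0 N1 ur fB; rewrite -hsum1; apply: torus_avg_le => [|j]; first exact: ltnW.
rewrite cmodM; apply: ler_pM; rewrite ?cmod_ge0 ?cmod_full_kernel //.
by apply: fB; apply: hpt_in => //; rewrite ler01 lexx.
Qed.

Lemma cauchy_coefB (f g : 'cV[C]_n -> C) a r N al :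
  cauchy_coef (fun x => f x - g x) a r N al = cauchy_coef f a r N al - cauchy_coef g a r N al.
Proof.
rewrite /cauchy_coef /torus_avg -mulrBr -sumrB; congr (_ * _).
by apply: eq_bigr => j _; rewrite mulrBl.
Qed.

(* Stability under uniform limits: the interpolation operators are bounded uniformly in N. *)
Lemma cauchy_cube_approx (g : 'cV[C]_n -> C) (a : 'cV[C]_n) (r : R) : 0 < r ->
  (forall e : R, 0 < e -> exists h : 'cV[C]_n -> C,
     (forall x : 'cV[C]_n, (forall i, cmod (x i 0 - a i 0) <= r) -> sdiff h x) /\
     (forall x : 'cV[C]_n, (forall i, cmod (x i 0 - a i 0) <= r) -> cmod (g x - h x) <= e)) ->
  cube_approx g a (r / 2) (cauchy_coef g a r).
Proof.
move=> r0 gh e e0; pose e' := e / 2 / (2 ^+ n + 1).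
have p0 : 0 < 2 ^+ n + 1 :> R by rewrite ltr_wpDl // exprn_ge0.
have e'0 : 0 < e' by rewrite !divr_gt0.
have [h [hd ghe]] := gh _ e'0.
have e20 : 0 < e / 2 by rewrite divr_gt0.
have [N0 NP] := discrete_cauchy r0 hd e20.
exists (maxn N0 1) => N; rewrite gtn_max => /andP[N0N N1] u ur.
have h1 := cauchy_coef_sum_le r0 N1 ur ghe.
have h2 := NP N N0N u ur.
have au i : cmod ((a + \col_i u i) i 0 - a i 0) <= r.
  by rewrite !mxE addrC addKr; apply: le_trans (ur i) _; lra.
have h3 := ghe _ au.
have E : cube_sum (cauchy_coef (fun x => g x - h x) a r N) u N =
   cube_sum (cauchy_coef g a r N) u N - cube_sum (cauchy_coef h a r N) u N.
  by rewrite cube_sumB; apply: eq_bigr => al _; rewrite cauchy_coefB.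
rewrite E in h1; set P := cube_sum (cauchy_coef g a r N) u N in h1 *.
set Q := cube_sum (cauchy_coef h a r N) u N in h1 h2.
have -> : P - g (a + \col_i u i) = (P - Q) + (Q - h (a + \col_i u i)) +
   (- (g (a + \col_i u i) - h (a + \col_i u i))) by ring.
apply: le_trans (cmodD _ _) _; rewrite cmodN.
have := cmodD (P - Q) (Q - h (a + \col_i u i)).
have : e' * 2 ^+ n + e' = e / 2.
  by rewrite /e'; field; rewrite gt_eqF.
lra.
Qed.

Lemma sdiff_cube_approx (g : 'cV[C]_n -> C) (a : 'cV[C]_n) (r : R) : 0 < r ->
  (forall x : 'cV[C]_n, (forall i, cmod (x i 0 - a i 0) <= r) -> sdiff g x) ->
  cube_approx g a (r / 2) (cauchy_coef g a r).
Proof.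
move=> r0 gd; apply: cauchy_cube_approx => // e e0; exists g; split=> // x _.
by rewrite subrr cmod0 ltW.
Qed.

Lemma open_cpolydisc (U : set 'cV[C]_n) (a : 'cV[C]_n) : open U -> U a ->
  exists2 r : R, 0 < r & forall x : 'cV[C]_n, (forall i, cmod (x i 0 - a i 0) <= r) -> U x.
Proof.
move=> oU Ua; have /nbhs_cV[d d0 dU] : nbhs a U by exact: open_nbhs_nbhs.
exists (d / 2) => [|x xa]; first by rewrite divr_gt0.
apply: dU => i; apply: le_lt_trans (xa i) _.
by rewrite ltr_pdivrMr // mulr_natr mulr2n ltrDl.
Qed.

(** Weierstrass's theorem; the approximants are only asked to be strictly differentiable.
    Completeness of the function space and holomorphy in [t] of all limits rest on it. *)
Lemma uniform_limit_analytic (U : set 'cV[C]_n) (g : 'cV[C]_n -> C) : open U ->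
  (forall e : R, 0 < e -> exists h : 'cV[C]_n -> C,
     (forall x, U x -> sdiff h x) /\ (forall x, U x -> cmod (g x - h x) <= e)) ->
  analytic_on U g.
Proof.
move=> oU gh a Ua; have [r r0 rU] := open_cpolydisc oU Ua.
have r20 : 0 < r / 2 by rewrite divr_gt0.
apply: (cube_approx_analytic r20 (c := cauchy_coef g a r)).
apply: cauchy_cube_approx => // e e0; have [h [hd ghe]] := gh e e0.
by exists h; split=> x xr; [apply: hd|apply: ghe]; exact: rU.
Qed.

Lemma sdiff_analytic (U : set 'cV[C]_n) (g : 'cV[C]_n -> C) : open U ->
  (forall x, U x -> sdiff g x) -> analytic_on U g.
Proof.
move=> oU gd; apply: uniform_limit_analytic => // e e0; exists g; split=> // x _.
by rewrite subrr cmod0 ltW.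
Qed.

End PolynomialApproximation.

(** * Harnack's inequality *)

Section Harnack.
Variables (R : realType) (n : nat).
Local Notation C := (Cx R).

(** Small enough for [(1 - harnack_ratio) ^ (- n) <= 5 / 4]. The monomials of positive degree then
    have total weight at most [1 / 4], so that coefficients of weighted size at most [2 * S]
    contribute at most [S / 2]. *)
Definition harnack_ratio : R := (8 * (n%:R + 1))^-1.

Lemma harnack_ratio_gt0 : 0 < harnack_ratio.
Proof. by rewrite invr_gt0 mulr_gt0 // ltr_wpDl. Qed.

Lemma bernoulli (x : R) (m : nat) : 0 <= x -> x <= 1 -> 1 - m%:R * x <= (1 - x) ^+ m.
Proof.
move=> x0 x1; elim: m => [|m IH]; first by rewrite mul0r subr0 expr0.
have x1' : 0 <= 1 - x by rewrite subr_ge0.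
rewrite exprS; apply: le_trans (ler_wpM2l x1' IH).
have : 0 <= m%:R * x * x by rewrite !mulr_ge0.
rewrite -natr1; lra.
Qed.

Lemma geometric_cube_harnack (N : nat) : (0 < N)%N ->
  \sum_(al : {ffun 'I_n -> 'I_N} | [exists i, (0 < al i)%N])
    \prod_i harnack_ratio ^+ al i <= 1 / 4.
Proof.
move=> N0; set q := harnack_ratio; have q0 := harnack_ratio_gt0; rewrite -/q in q0.
have q8 : q * (8 * (n%:R + 1)) = 1.
  by rewrite mulVf // gt_eqF // mulr_gt0 // ltr_wpDl.
have nq : n%:R * q <= 1 / 8 by lra.
have n0 : 0 <= n%:R * q by rewrite mulr_ge0 // ltW.
have q1 : q <= 1 / 8 by lra.
have tot : \sum_(al : {ffun 'I_n -> 'I_N}) \prod_i q ^+ al i <= 5 / 4.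
  have := bigA_distr_bigA (fun (i : 'I_n) (k : 'I_N) => q ^+ k); rewrite /= => <-.
  apply: (@le_trans _ _ (\prod_(i < n) (1 - q)^-1)).
    apply: ler_prod => i _; apply/andP; split.
      by apply: sumr_ge0 => k _; rewrite exprn_ge0 // ltW.
    have q10 : 0 < 1 - q by lra.
    rewrite -(ler_pM2l q10) mulfV ?gt_eqF //.
    have -> : (1 - q) * \sum_(m < N) q ^+ m = 1 - q ^+ N.
      by rewrite -[1 - q]opprB mulNr -subrX1 opprB.
    by rewrite gerBl exprn_ge0 // ltW.
  rewrite prodr_const card_ord exprVn -[leRHS]invrK lef_pV2 ?posrE ?exprn_gt0 ?invr_gt0 //; last by lra.
  apply: le_trans (bernoulli n _ _); rewrite ?ltW //; last by lra.
  by rewrite invf_div; lra.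
move: tot; rewrite (bigID (fun al : {ffun 'I_n -> 'I_N} => [exists i, (0 < al i)%N])) /=.
set S := \sum_(_ | _) _; set T := \sum_(_ | _) _.
suff : 1 <= T by lra.
rewrite /T (bigD1 [ffun=> Ordinal N0]) /=; last first.
  by rewrite negb_exists; apply/forallP => i; rewrite ffunE.
rewrite big1 => [|i _]; last by rewrite ffunE expr0.
by rewrite lerDl; apply: sumr_ge0 => al _; apply: prodr_ge0 => i _; rewrite exprn_ge0 // ltW.
Qed.

(* The coefficients of P other than the constant one are, up to rho^|al|, the moments
   of the nonnegative function 2 (Re P + e) on the torus, since conj P contributes only
   nonpositive frequencies. *)
Lemma caratheodory_coef (c : ('I_n -> nat) -> C) (N : nat) (rho e : R) (al : 'I_n -> nat) (i0 : 'I_n) :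
  0 < rho -> (forall i, (al i < N)%N) -> (0 < al i0)%N ->
  (forall u : 'I_n -> C, (forall i, cmod (u i) <= rho) -> - e <= reC (cube_sum c u N)) ->
  cmod (c al) * \prod_i rho ^+ al i <= 2 * (reC (c (fun=> 0%N)) + e).
Proof.
move=> rho0 alN al0 cpos.
(* The products of [P] with the monomial [al] have exponents below [N + N]; a grid of this size sees
   no aliasing between them and the constant. *)
pose M := (N + N)%N; have N0 : (0 < N)%N := leq_ltn_trans (leq0n _) (alN i0).
have M0 : (0 < M)%N by rewrite addn_gt0 N0.
have NM : (N <= M)%N by rewrite leq_addr.
pose zeta := @torus_offset R n rho M.
pose P (j : {ffun 'I_n -> 'I_M}) := cube_sum c (zeta j) N.
pose mu (j : {ffun 'I_n -> 'I_M}) := \prod_i (zeta j i)^-1 ^+ al i.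
pose rr := \prod_(i < n) rho ^+ al i.
have rr0 : 0 < rr by apply: prodr_gt0 => i _; rewrite exprn_gt0.
have A1 : torus_avg (fun j => P j * mu j) = c al by exact: coef_extract.
have A3 : torus_avg (fun j : {ffun 'I_n -> 'I_M} => mu j) = 0.
  rewrite -(@torus_orth0 R n rho M M0 (fun=> 0%N) al i0).
    by congr torus_avg; apply/funext => j; apply: eq_bigr => i _; rewrite expr0 mul1r.
  rewrite mod0n modn_small; last exact: leq_trans (alN _) NM.
  by rewrite eq_sym -lt0n.
have conj_avg (F : {ffun 'I_n -> 'I_M} -> C) :
    torus_avg (fun j => ((F j)^*)%C) = ((torus_avg F)^*)%C.
  rewrite /torus_avg rmorphM rmorph_sum /= fmorphV rmorphXn /=; congr (_^-1 * _).
  by congr (_ ^+ _); rewrite rmorph_nat.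
have zz j i : zeta j i * ((zeta j i)^*)%C = toC (rho ^+ 2).
  by rewrite -sqr_normc -[X in X ^+ 2]cmodE cmod_torus_offset ?toCX // ltW.
have A2 : torus_avg (fun j => ((P j)^*)%C * mu j) = 0.
  have E j : ((P j)^*)%C * mu j = (toC (rr ^+ 2))^-1 * ((P j * \prod_i zeta j i ^+ al i)^*)%C.
    rewrite rmorphM /= mulrCA; congr (_ * _).
    have -> : toC (rr ^+ 2) = \prod_i (zeta j i * ((zeta j i)^*)%C) ^+ al i.
      transitivity (\prod_(i < n) toC ((rho ^+ 2) ^+ al i)).
        rewrite /rr -prodrXl (big_morph (@toC R) (@toCM R) (@toC1 R)).
        by apply: eq_bigr => i _; rewrite -!exprM mulnC.
      by apply: eq_bigr => i _; rewrite toCX zz.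
    rewrite rmorph_prod /= -prodfV -big_split /=; apply: eq_bigr => i _.
    have z0 : zeta j i != 0 by exact: torus_offset_neq0.
    have zc0 : ((zeta j i)^*)%C != 0 by rewrite conjc_eq0.
    move: (zeta j i) z0 zc0 => z z0 zc0; by rewrite rmorphXn /= exprMn invfM exprVn -mulrA mulVf ?mulr1 // expf_neq0.
  rewrite (_ : (fun j => _) = fun j => (toC (rr ^+ 2))^-1 * ((P j * \prod_i zeta j i ^+ al i)^*)%C); last first.
    by apply/funext.
  rewrite torus_avgZ conj_avg (@coef_pos_zero R n rho M M0 c N al i0) // ?leq_add2l 1?ltnW //.
  by rewrite rmorph0 mulr0.
have A4 : torus_avg (fun j => P j) = c (fun=> 0%N).
  rewrite -(coef_extract rho0 M0 c NM (fun i => N0)).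
  by congr torus_avg; apply/funext => j; rewrite big1 ?mulr1 // => i _; rewrite expr0.
have A5 : c al = torus_avg (fun j => (toC (2 * (reC (P j) + e))) * mu j).
  have -> : (fun j => (toC (2 * (reC (P j) + e))) * mu j) =
     (fun j => (P j * mu j + ((P j)^*)%C * mu j) + toC (2 * e) * mu j).
    apply/funext => j; rewrite -!mulrDl; congr (_ * _).
    by rewrite addcJ mulrDr toCD toCM; congr (_ * _ + _); rewrite /toC rmorph_nat.
  by rewrite !torus_avgD torus_avgZ A1 A2 A3 mulr0 !addr0.
rewrite -ler_pdivlMr // A5.
have -> : 2 * (reC (c (fun=> 0%N)) + e) / rr =
   reC (torus_avg (fun j : {ffun 'I_n -> 'I_M} => toC (2 / rr) * (P j + toC e))).
  rewrite torus_avgZ torus_avgD A4 (@torus_avg1 _ _ _ M0 _ (toC e)) //.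
  by rewrite reC_toCM reCD reC_toC; ring.
apply: torus_avg_dom => // j; rewrite cmodM cmod_monomial_inv //.
rewrite reC_toCM reCD reC_toC cmod_toC.
have zr i : cmod (zeta j i) <= rho by rewrite cmod_torus_offset // ltW.
have pos : 0 <= reC (P j) + e by have := cpos _ zr; rewrite -/(P j); lra.
rewrite ger0_norm ?mulr_ge0 //.
have -> : \prod_(i < n) rho^-1 ^+ al i = rr^-1.
  by rewrite -prodfV; apply: eq_bigr => i _; rewrite exprVn.
by rewrite mulrAC.
Qed.

(** Carathéodory's bound on the coefficients, summed over all positive degrees at the radius reduced
    by [harnack_ratio]. It is applied to interpolating polynomials, whose real parts are only known
    to be at least [- e']; hence the slack in [caratheodory_coef]. *)
Lemma harnack_local (g : 'cV[C]_n -> C) (a : 'cV[C]_n) (r : R) : 0 < r ->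
  (forall x : 'cV[C]_n, (forall i, cmod (x i 0 - a i 0) <= r) -> sdiff g x /\ 0 <= reC (g x)) ->
  forall x : 'cV[C]_n, (forall i, cmod (x i 0 - a i 0) <= harnack_ratio * (r / 2)) ->
    cmod (g x - g a) <= 1 / 2 * reC (g a).
Proof.
move=> r0 gd x xa; have q0 := harnack_ratio_gt0.
pose rho := r / 2; have rho0 : 0 < rho by rewrite divr_gt0.
have approx := sdiff_cube_approx r0 (fun x xr => (gd x xr).1).
apply/ler_addgt0Pl => e e0.
pose e' := e / 4; have e'0 : 0 < e' by rewrite divr_gt0.
have [N0 NP] := approx _ e'0.
pose N := N0.+1; have := NP N (ltnSn N0); set c := cauchy_coef g a r N => cP.
pose u i := x i 0 - a i 0.
have xE : x = a + \col_i u i by apply/colP => i; rewrite !mxE addrC subrK.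
have aE : a = a + \col_(i < n) 0 by apply/colP => i; rewrite !mxE addr0.
have q1 : harnack_ratio <= 1.
  rewrite -(ler_pM2r (_ : 0 < 8 * (n%:R + 1))) ?mulr_gt0 ?ltr_wpDl //.
  rewrite mulVf ?mul1r; last by rewrite gt_eqF // mulr_gt0 // ltr_wpDl.
  have : 0 <= n%:R :> R by []; lra.
have ur i : cmod (u i) <= rho.
  by apply: le_trans (xa i) _; rewrite ler_piMl // ltW.
have ar (v : 'I_n -> C) : (forall i, cmod (v i) <= rho) ->
    forall i, cmod ((a + \col_i v i) i 0 - a i 0) <= r.
  by move=> vr i; rewrite !mxE addrC addKr; apply: le_trans (vr i) _; rewrite /rho; lra.
have cpos (v : 'I_n -> C) : (forall i, cmod (v i) <= rho) -> - e' <= reC (cube_sum c v N).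
  move=> vr; have := cP v vr; have := (gd _ (ar v vr)).2.
  by have := reC_ge_cmod (cube_sum c v N - g (a + \col_i v i)); rewrite reCB; lra.
have c0E : cube_sum c (fun=> 0) N = c (fun=> 0%N).
  rewrite /cube_sum (bigD1 [ffun=> ord0]) //= big1 ?mulr1; last first.
    by move=> i _; rewrite ffunE expr0.
  rewrite big1 ?addr0; first by congr c; apply/funext => i; rewrite ffunE.
  move=> al al0; have [i i0|ali] := pickP (fun i => (0 < al i)%N).
    by rewrite (bigD1 i) //= expr0n eqn0Ngt i0 /= mul0r mulr0.
  case/eqP: al0; apply/ffunP => i; apply/val_inj; rewrite ffunE /=.
  by apply/eqP; rewrite -leqn0 leqNgt ali.
have h0 := cP (fun=> 0) (fun i => eq_ind_r (fun z => z <= rho) (ltW rho0) (cmod0 R)).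
rewrite -aE c0E in h0.
have h1 := cP u ur; rewrite -xE in h1.
set S := reC (c (fun=> 0%N)) + e'.
have S0 : 0 <= S.
  have := cpos (fun=> 0) (fun i => eq_ind_r (fun z => z <= rho) (ltW rho0) (cmod0 R)).
  by rewrite c0E /S; lra.
have h2 : cmod (cube_sum c u N - c (fun=> 0%N)) <= 1 / 2 * S.
  rewrite -c0E /cube_sum -sumrB.
  rewrite (bigID (fun al : {ffun 'I_n -> 'I_N} => [exists i, (0 < al i)%N])) /=.
  rewrite [X in cmod (_ + X)]big1 ?addr0; last first.
    move=> al; rewrite negb_exists => /forallP al0.
    have alE i : (al i : nat) = 0%N by apply/eqP; rewrite -leqn0 leqNgt al0.
    by rewrite !big1 ?subrr // => i _; rewrite alE expr0.
  apply: le_trans (cmod_sum _ _ _) _.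
  apply: (@le_trans _ _ (\sum_(al : {ffun 'I_n -> 'I_N} | [exists i, (0 < al i)%N])
     2 * S * \prod_i harnack_ratio ^+ al i)).
    apply: ler_sum => al /existsP[i0 al0].
    rewrite [X in _ - _ * X](bigD1 i0) //= expr0n eqn0Ngt al0 /= mul0r mulr0 subr0.
    have := caratheodory_coef rho0 (fun i => ltn_ord (al i)) al0 cpos; rewrite -/S => cS.
    apply: (@le_trans _ _ (cmod (c (fun i => al i)) * \prod_i rho ^+ al i *
       \prod_i harnack_ratio ^+ al i)); last first.
      apply: ler_wpM2r => //; apply: prodr_ge0 => i _; rewrite exprn_ge0 // ltW //.
    rewrite -mulrA cmodM; apply: ler_wpM2l; first exact: cmod_ge0.
    rewrite cmod_prod -big_split /=; apply: ler_prod => i _.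
    rewrite cmod_ge0 /= cmodX -exprMn; apply: lerXn2r; rewrite ?nnegrE ?cmod_ge0 //.
      by rewrite mulr_ge0 // ltW.
    by rewrite mulrC; exact: xa.
  rewrite -mulr_sumr.
  have := ler_wpM2l (mulr_ge0 (ler0n R 2) S0) (geometric_cube_harnack (ltn0Sn N0)).
  by rewrite -/N; lra.
have h3 : reC (c (fun=> 0%N)) <= reC (g a) + e'.
  by have := le_trans (reC_le_cmod _) h0; rewrite reCB; lra.
have := cmodBD (g x) (cube_sum c u N) (g a).
have := cmodBD (cube_sum c u N) (c (fun=> 0%N)) (g a).
rewrite (cmodB (g x) (cube_sum _ _ _)) /S /e' in h0 h1 h2 h3 *; lra.
Qed.

Section Chain.
Variable U : set 'cV[C]_n.
Hypotheses (oU : open U) (cU : connected U).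

Definition pos_hol (g : 'cV[C]_n -> C) : Prop :=
  forall x, U x -> sdiff g x /\ 0 <= reC (g x).

Lemma harnack_near (a : 'cV[C]_n) : U a -> exists2 d : R, 0 < d &
  forall x, polydisc a d x -> U x /\ forall g, pos_hol g ->
    1 / 2 * reC (g a) <= reC (g x) <= 3 / 2 * reC (g a).
Proof.
move=> Ua; have [r r0 rU] := open_cpolydisc oU Ua.
have q0 := harnack_ratio_gt0.
exists (Num.min r (harnack_ratio * (r / 2))).
  by rewrite lt_min r0 /= mulr_gt0 // divr_gt0.
move=> x ax; split.
  by apply: rU => i; apply: ltW; apply: lt_le_trans (ax i) _; rewrite ge_min lexx.
move=> g gp.
have := harnack_local r0 (fun x xr => gp x (rU x xr)) (x := x).
have ax' i : cmod (x i 0 - a i 0) <= harnack_ratio * (r / 2).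
  by apply: ltW; apply: lt_le_trans (ax i) _; rewrite ge_min lexx orbT.
move=> /(_ ax') H; have := le_trans (reC_le _) H; rewrite reCB ler_norml.
by move=> /andP[h1 h2]; apply/andP; split; lra.
Qed.

(** The points comparable with [x0] form a nonempty, open and relatively closed subset of the
    connected set [U]: being comparable propagates both ways along [harnack_near]. The constant is
    chosen before [g], and compactness makes it uniform on [K]. *)
Lemma harnack_compact (K : set 'cV[C]_n) (x0 : 'cV[C]_n) : compact K -> K `<=` U -> U x0 ->
  exists2 k : R, 0 < k & forall x, K x -> forall g, pos_hol g -> k * reC (g x0) <= reC (g x).
Proof.
move=> cK KU Ux0.
pose S := [set x | U x /\ exists2 k : R, 0 < k & forall g, pos_hol g -> k * reC (g x0) <= reC (g x)].
have SU : S = U.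
  apply: cU.
  - exists x0; split=> //; exists 1 => // g _; by rewrite mul1r.
  - exists S; last by apply/seteqP; split=> [x [Ux Sx]|x [_ Sx]] //; split.
    rewrite openE => x [Ux [k k0 kP]]; have [d d0 dP] := harnack_near Ux.
    apply/nbhs_cV; exists d => // y yx; have [Uy Hy] := dP y yx.
    split=> //; exists (k / 2) => [|g gp]; first by rewrite divr_gt0.
    have /andP[h1 h2] := Hy g gp; have := kP g gp; lra.
  - exists (closure S); first exact: closed_closure.
    apply/seteqP; split=> [x Sx|x [Ux cSx]].
      by split; [exact: Sx.1|exact: subset_closure].
    split=> //; have [d d0 dP] := harnack_near Ux.
    have : nbhs x (polydisc x d) by apply/nbhs_cV; exists d.
    move=> /cSx[y [[Uy [k k0 kP]] xy]]; have [_ Hy] := dP y xy.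
    (* Here [y] is the comparable point and [x] the new one, so the upper factor [3 / 2] of
       [harnack_near] gets inverted. *)
    exists (2 / 3 * k) => [|g gp]; first by rewrite mulr_gt0 // divr_gt0.
    have /andP[h1 h2] := Hy g gp; have := kP g gp; lra.
pose P (k : R) (x : 'cV[C]_n) := K x -> forall g, pos_hol g -> k * reC (g x0) <= reC (g x).
suff : \forall k \near 0^'+, K `<=` P k.
  move=> [d /= d0 H]; exists (d / 2); first by rewrite divr_gt0.
  move=> x Kx g gp; apply: (H (d / 2)) => //=; rewrite ?divr_gt0 //.
  rewrite sub0r normrN gtr0_norm ?divr_gt0 //.
  by rewrite ltr_pdivrMr // mulr_natr mulr2n ltrDl.
apply: (iffLR (compact_near_coveringP K) cK) => z Kz.
have [d d0 dP] := harnack_near (KU _ Kz).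
have [_ [k k0 kP]] : S z by rewrite SU; exact: KU.
have k20 : 0 < k / 2 by rewrite divr_gt0.
exists (polydisc z d, [set t | 0 < t < k / 2]).
  split; first by apply/nbhs_cV; exists d.
  exists (k / 2) => //= t; rewrite /ball_ /= sub0r normrN => td t0.
  by rewrite t0 -[ltLHS]gtr0_norm.
move=> [x t] [/= zx /andP[t0 tk]] Kx g gp.
have [_ Hx] := dP x zx; have /andP[h1 h2] := Hx g gp; have h3 := kP g gp.
have h4 : 0 <= reC (g x0) by exact: (gp x0 Ux0).2.
have : t * reC (g x0) <= k / 2 * reC (g x0) by apply: ler_wpM2r => //; exact: ltW.
lra.
Qed.

End Chain.

End Harnack.

(** * The space of analytic functions *)

Section AinfTheory.
Variables (R : realType) (n : nat) (U : set 'cV[Cx R]_n).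
Hypothesis oU : open U.
Local Notation C := (Cx R).

(** Continuous extendability as the existence of limits, point by point. In this form it passes to
    sums, products and uniform limits without constructing an extension each time. *)
Definition ext_lim (f : 'cV[C]_n -> C) : Prop :=
  forall z, closure U z -> exists c : C, f x @[x --> within U (nbhs z)] --> c.

Lemma within_cvgP (A : set 'cV[C]_n) (f : 'cV[C]_n -> C) z (c : C) :
  f x @[x --> within A (nbhs z)] --> c <->
  forall e : R, 0 < e -> exists2 d : R, 0 < d &
    forall x, A x -> polydisc z d x -> cmod (f x - c) < e.
Proof.
split=> [/cvg_cmodP fc e e0|fc].
  by have /nbhs_cV[d d0 H] := fc e e0; exists d => // x Ux zx; apply: H.
apply/cvg_cmodP => e e0; have [d d0 H] := fc e e0.
by apply/nbhs_cV; exists d => // x zx Ux; apply: H.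
Qed.

Lemma within_closure_proper z : closure U z -> ProperFilter (within U (nbhs z)).
Proof. by move=> Uz; apply: within_nbhs_proper. Qed.

Lemma within_lim_le (f : 'cV[C]_n -> C) z (c a : C) (b : R) : closure U z ->
  f x @[x --> within U (nbhs z)] --> c -> (forall x, U x -> cmod (f x - a) <= b) ->
  cmod (c - a) <= b.
Proof.
move=> Uz fc fb; have PF := within_closure_proper Uz.
apply: (cvg_cmod_le fc); near=> x; apply: fb; near: x; exact: withinT.
Unshelve. all: by end_near.
Qed.

(** Limits taken at each point of the closure automatically form a continuous function: near [z] the
    values of [f] are close to the limit at [z], hence so are the limits at the neighbouring points
    of the closure. *)
Lemma in_AinfP (f : 'cV[C]_n -> C) :
  in_Ainf U f <-> (forall z, U z -> sdiff f z) /\ ext_lim f.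
Proof.
split=> [[fan [g [gc gf]]]|[fd fl]].
  split=> [z Uz|z Uz]; first exact/analytic_sdiff/fan.
  exists (g z); move/subspace_continuousP: gc => /(_ z Uz)/within_cvgP gz.
  apply/within_cvgP => e e0; have [d d0 H] := gz e e0.
  exists d; first exact: d0.
  by move=> x Ux zx; have := H x (subset_closure Ux) zx; rewrite (gf x Ux).
split; first exact: sdiff_analytic.
have /choice[g gP] : forall z, exists c : C, closure U z ->
    f x @[x --> within U (nbhs z)] --> c.
  by move=> z; have [/fl[c ?]|nU] := pselect (closure U z); [exists c|exists 0].
exists g; split.
  apply/subspace_continuousP => z Uz; apply/within_cvgP => e e0.
  have e20 : 0 < e / 2 by rewrite divr_gt0.
  have [d d0 H] := (iffLR (within_cvgP _ _ _ _) (gP z Uz)) _ e20.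
  exists (d / 2); first by rewrite divr_gt0.
  move=> x Ux zx; apply: (@le_lt_trans _ _ (e / 2)); last by lra.
  apply: (@cvg_cmod_le R _ (within U (nbhs x)) (within_closure_proper Ux) f (g x) (g z) _ (gP x Ux)).
  apply/nbhs_cV; exists (d / 2); first by rewrite divr_gt0.
  move=> y xy Uy; apply: ltW; apply: H => // i.
  by have := cmodBD (y i 0) (x i 0) (z i 0); have := xy i; have := zx i; lra.
move=> z Uz; apply/eqP; rewrite -subr_eq0 -cmod_eq0 eq_le cmod_ge0 andbT.
apply/ler_addgt0Pr => e e0; rewrite add0r.
have [d d0 H] := (iffLR (within_cvgP _ _ _ _) (gP z (subset_closure Uz))) _ e0.
by rewrite cmodB ltW // H //; exact: polydisc_center.
Qed.

Lemma ext_lim_bounded (f : 'cV[C]_n -> C) : bounded_set U -> ext_lim f ->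
  exists2 B : R, 0 < B & forall z, U z -> cmod (f z) <= B.
Proof.
move=> bU fl; have [r r0 Ur] := bounded_set_cmod bU.
have cr : closure U `<=` [set z | forall i, cmod (z i 0) <= r].
  have cl : closed [set z : 'cV[C]_n | forall i, cmod (z i 0 - (0 : 'cV[C]_n) i 0) <= r].
    exact: compact_closed (@norm_hausdorff _ _) (@compact_cpolydisc _ _ 0 r).
  move=> z Uz i; have : [set z : 'cV[C]_n | forall i, cmod (z i 0 - (0 : 'cV[C]_n) i 0) <= r] z.
    rewrite (iffLR (closure_id _) cl).
    by apply: closure_subset Uz => y /Ur yr j; rewrite mxE subr0.
  by move=> /(_ i); rewrite mxE subr0.
have cK : compact (closure U).
  by apply: compact_bounded_closed cr; exact: closed_closure.
(* The bound is written [d^-1] so that it becomes weaker as [d] tends to 0, as the filter [0^'+]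
   requires. *)
pose P (d : R) (z : 'cV[C]_n) := U z -> cmod (f z) <= d^-1.
suff [d d0 H] : exists2 d : R, 0 < d & closure U `<=` P d.
  exists d^-1; first by rewrite invr_gt0.
  by move=> z Uz; exact: H (subset_closure Uz) Uz.
suff : \forall d \near 0^'+, closure U `<=` P d.
  move=> [d /= d0 H]; exists (d / 2); first by rewrite divr_gt0.
  apply: (H (d / 2)) => //=; rewrite ?divr_gt0 //.
  rewrite sub0r normrN gtr0_norm ?divr_gt0 //.
  by rewrite ltr_pdivrMr // mulr_natr mulr2n ltrDl.
apply: (iffLR (compact_near_coveringP _) cK) => z Uz.
have [c /within_cvgP/(_ 1 ltr01)[d d0 H]] := fl z Uz.
have B0 : 0 < cmod c + 1 by rewrite ltr_wpDl // cmod_ge0.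
exists (polydisc z d, [set t | 0 < t < (cmod c + 1)^-1]).
  split; first by apply/nbhs_cV; exists d.
  exists (cmod c + 1)^-1 => /=; first by rewrite invr_gt0.
  move=> t; rewrite /ball_ /= sub0r normrN => td t0.
  by rewrite t0 -[ltLHS]gtr0_norm.
move=> [x t] [/= zx /andP[t0 tk]] Ux.
have h1 := H x Ux zx; have := cmodBD (f x) c 0; rewrite !subr0.
have : cmod c + 1 <= t^-1 by rewrite -[leLHS]invrK lef_pV2 ?posrE ?invr_gt0 // ltW.
lra.
Qed.

Lemma Ainf_in (f : Ainf U) : in_Ainf U f.
Proof. by case: f => f /= /asboolP[]. Qed.

Lemma Ainf_out (f : Ainf U) z : ~ U z -> f z = 0.
Proof. by case: f => f /= /asboolP[_]; apply. Qed.

Lemma Ainf_sdiff (f : Ainf U) z : U z -> sdiff f z.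
Proof. by have /in_AinfP[] := Ainf_in f; move=> + _; apply. Qed.

Lemma Ainf_ext_lim (f : Ainf U) : ext_lim f.
Proof. by have /in_AinfP[] := Ainf_in f. Qed.

Lemma Ainf_ext (f g : Ainf U) : (forall z, U z -> f z = g z) -> f = g.
Proof.
move=> fg; apply: val_inj => /=; apply/funext => z.
by have [/fg//|nU] := pselect (U z); rewrite !Ainf_out.
Qed.

Lemma Ainf_build (f : 'cV[C]_n -> C) : (forall z, U z -> sdiff f z) -> ext_lim f ->
  exists g : Ainf U, forall z, U z -> g z = f z.
Proof.
move=> fd fl; pose g z := if `[< U z >] then f z else 0.
have gf z : U z -> g z = f z by move=> Uz; rewrite /g asboolT.
have gA : g \in Ainf_pred U.
  apply/asboolP; split; last by move=> z nU; rewrite /g asboolF.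
  apply/in_AinfP; split=> [z Uz|z Uz].
    have [r r0 rU] := open_cpolydisc oU Uz.
    by apply: (sdiff_near r0) (fd z Uz) => x zx; rewrite gf //; apply: rU => i; exact: ltW.
  have [c /within_cvgP fc] := fl z Uz; exists c; apply/within_cvgP => e e0.
  by have [d d0 H] := fc e e0; exists d => // x Ux zx; rewrite gf // H.
by exists (MkAinf gA).
Qed.

Lemma AinfDE (f g : Ainf U) z : (f + g) z = f z + g z.
Proof. by []. Qed.

Lemma AinfZE (c : C) (f : Ainf U) z : (c *: f) z = c * f z.
Proof. by []. Qed.

Lemma AinfNE (f : Ainf U) z : (- f) z = - f z.
Proof. by rewrite -scaleN1r AinfZE mulN1r. Qed.

(** Inside [U] this is Weierstrass's theorem. At a point of the closure the limits of the [u m] are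
    a Cauchy sequence, being no further apart than the functions, and their limit is that of the
    limit function. *)
Lemma Ainf_complete (u : nat -> Ainf U) :
  (forall e : R, 0 < e -> exists N, forall m l, (N <= m)%N -> (N <= l)%N ->
     forall z, U z -> cmod (u m z - u l z) <= e) ->
  exists f : Ainf U, forall e : R, 0 < e -> exists N, forall m, (N <= m)%N ->
     forall z, U z -> cmod (u m z - f z) <= e.
Proof.
move=> cu.
have /choice[g gP] : forall z, exists c : C, U z -> u N z @[N --> \oo] --> c.
  move=> z; have [Uz|nU] := pselect (U z); last by exists 0.
  have [c uc] : exists l : C, u N z @[N --> \oo] --> l.
    apply: cx_cauchy_cvg => e /cu[N NP]; exists N => m l Nm Nl; exact: NP.
  by exists c.
have ug e : 0 < e -> exists N, forall m, (N <= m)%N -> forall z, U z -> cmod (u m z - g z) <= e.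
  move=> /cu[N NP]; exists N => m Nm z Uz; rewrite cmodB.
  apply: (cvg_cmod_le (gP z Uz)); exists N => // l /= Nl; exact: NP.
suff [f fg] : exists f : Ainf U, forall z, U z -> f z = g z.
  exists f => e /ug[N NP]; exists N => m Nm z Uz; rewrite fg //; exact: NP.
apply: Ainf_build.
  move=> z Uz; apply: analytic_sdiff; move: z Uz; apply: uniform_limit_analytic => // e /ug[N NP].
  exists (u N); split=> x Ux; first exact: Ainf_sdiff.
  by rewrite cmodB; exact: NP.
move=> z Uz.
have /choice[c cP] := fun m => Ainf_ext_lim (u m) Uz.
have [l lP] : exists l : C, c N @[N --> \oo] --> l.
  apply: cx_cauchy_cvg => e /cu[N NP]; exists N => m l Nm Nl.
  rewrite -[c m - c l]subr0; apply: (within_lim_le Uz (cvgB (cP m) (cP l))) => x Ux.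
  by rewrite subr0; exact: NP.
exists l; apply/within_cvgP => e e0; have e40 : 0 < e / 4 by rewrite divr_gt0.
have [N NP] := ug _ e40.
move: lP => /cvg_cmodP/(_ _ e40)[N' _ N'P].
pose m := maxn N N'.
have h1 := NP m (leq_maxl _ _); have h2 := N'P m (leq_maxr _ _).
have [d d0 H] := (iffLR (within_cvgP _ _ _ _) (cP m)) _ e40.
exists d => // x Ux zx; have h3 := H x Ux zx; have := h1 x Ux; move: h2 => /=.
have := cmodBD (g x) (u m x) l; have := cmodBD (u m x) (c m) l.
rewrite (cmodB (g x) (u m x)); lra.
Qed.

Lemma Ainf_bounded (f : Ainf U) : bounded_set U ->
  exists2 B : R, 0 < B & forall z, U z -> cmod (f z) <= B.
Proof. by move=> bU; apply: ext_lim_bounded => //; exact: Ainf_ext_lim. Qed.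

Lemma Ainf_norm_ge (f : Ainf U) z : bounded_set U -> U z -> cmod (f z) <= Ainf_norm f.
Proof.
move=> bU Uz; have [B B0 fB] := Ainf_bounded f bU.
apply: sup_upper_bound; last by exists z.
by split; [exists (cmod (f z)); exists z|exists B => _ [x Ux <-]; exact: fB].
Qed.

Lemma Ainf_norm_le (f : Ainf U) (B : R) : U !=set0 ->
  (forall z, U z -> cmod (f z) <= B) -> Ainf_norm f <= B.
Proof.
move=> [z0 Uz0] fB; apply: sup_le_ub; first by exists (cmod (f z0)); exists z0.
by move=> _ [z Uz <-]; exact: fB.
Qed.

End AinfTheory.

(** * Taylor expansion in one variable *)

Section OneVariable.
Variable R : realType.
Local Notation C := (Cx R).

Lemma cube_sum1 (a : ('I_1 -> nat) -> C) (h : 'I_1 -> C) (N : nat) :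
  cube_sum a h N = \sum_(m < N) a (fun=> m : nat) * h ord0 ^+ m.
Proof.
rewrite /cube_sum (reindex (fun m : 'I_N => [ffun _ : 'I_1 => m])) /=; last first.
  exists (fun al : {ffun 'I_1 -> 'I_N} => al ord0) => [m _|al _]; first by rewrite ffunE.
  by apply/ffunP => i; rewrite ffunE (ord1 i).
apply: eq_bigr => m _; rewrite big_ord1 ffunE; congr (a _ * _).
by apply/funext => i; rewrite ffunE.
Qed.

Definition cdisc (t0 : C) (r : R) : set C := [set t | cmod (t - t0) < r].

Lemma open_cdisc1 (t0 : C) (r : R) : open [set z : 'cV[C]_1 | cmod (z 0 0 - t0) < r].
Proof.
rewrite openE => z /= zr; apply/nbhs_cV; exists (r - cmod (z 0 0 - t0)); first by rewrite subr_gt0.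
by move=> x /(_ 0) xz /=; have := cmodBD (x 0 0) (z 0 0) t0; lra.
Qed.

Lemma sdiff1_uniform_limit (t0 : C) (r : R) (g : C -> C) :
  (forall e : R, 0 < e -> exists h : C -> C,
     (forall t, cdisc t0 r t -> sdiff1 h t) /\ (forall t, cdisc t0 r t -> cmod (g t - h t) <= e)) ->
  forall t, cdisc t0 r t -> sdiff1 g t.
Proof.
move=> gh t tr; apply: analytic_sdiff.
apply: (uniform_limit_analytic (@open_cdisc1 t0 r)); last by rewrite /= mxE.
move=> e e0; have [h [hd hg]] := gh e e0.
exists (fun z => h (z 0 0)); split=> z zr; last exact: hg.
have -> : z = const_mx (z 0 0) by apply/matrixP => i j; rewrite mxE !ord1.
by apply: hd.
Qed.

(** The bounds involve [B] itself, since the lemma is applied to a family of functions, one for each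
    evaluation point, with estimates common to all. The radius [r / 4] results from two halvings:
    interpolation on the circle of radius [r] converges on [r / 2], and the limit series is obtained
    on [r / 4]. *)
Lemma taylor1 (g : C -> C) (t0 : C) (r B : R) : 0 < r ->
  (forall t, cmod (t - t0) <= r -> sdiff1 g t) ->
  (forall t, cmod (t - t0) <= r -> cmod (g t) <= B) ->
  exists A : nat -> C,
    (forall m, cmod (A m) * (r / 4) ^+ m <= B) /\
    forall u N, 4 * cmod u / r <= 1 / 2 ->
      cmod (g (t0 + u) - \sum_(m < N) A m * u ^+ m) <= 2 * B * (4 * cmod u / r) ^+ N.
Proof.
move=> r0 gd gB.
have gd' (x : 'cV[C]_1) : (forall i, cmod (x i 0 - (const_mx t0 : 'cV[C]_1) i 0) <= r) ->
    sdiff (fun z => g (z 0 0)) x.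
  move=> /(_ 0); rewrite mxE => xr.
  have -> : x = const_mx (x 0 0) by apply/matrixP => i j; rewrite mxE !ord1.
  exact: gd.
have r20 : 0 < r / 2 by rewrite divr_gt0.
have [A' [B' [AB' Ag']]] := cube_approx_coefs r20 (sdiff_cube_approx r0 gd').
pose A m := A' (fun=> m : nat).
have B'0 : 0 <= B'.
  by have := AB' (fun=> 0%N); rewrite big_ord1 mulr1; apply: le_trans; exact: cmod_ge0.
pose rr := r / 4; have rr0 : 0 < rr by rewrite divr_gt0.
have Ag u : cmod u <= rr -> \sum_(m < N) A m * u ^+ m @[N --> \oo] --> g (t0 + u).
  move=> ur; have := Ag' (fun=> u); rewrite !mxE => H.
  under eq_cvg do rewrite -/(A _) -(cube_sum1 A' (fun=> u)).
  apply: H => _; rewrite /rr in ur; lra.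
have Arr m : cmod (A m) * rr ^+ m <= B' * 2^-1 ^+ m.
  have := AB' (fun=> m); rewrite big_ord1 -/(A m) => H.
  have -> : rr = r / 2 * 2^-1 by rewrite /rr; field.
  by rewrite exprMn mulrA ler_wpM2r // exprn_ge0 // invr_ge0.
have tailg (D q : R) (u : C) (N M : nat) : 0 <= D -> 0 <= q -> q <= 2^-1 ->
    (forall m, cmod (A m * u ^+ m) <= D * q ^+ m) -> (N <= M)%N ->
    cmod (\sum_(m < M) A m * u ^+ m - \sum_(m < N) A m * u ^+ m) <= 2 * D * q ^+ N.
  move=> D0 q0 q2 HD NM.
  have [d ->] : exists d, M = (N + d)%N by exists (M - N)%N; rewrite subnKC.
  rewrite big_split_ord /= addrAC subrr add0r; apply: le_trans (cmod_sum _ _ _) _.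
  apply: (@le_trans _ _ (\sum_(m < d) D * q ^+ N * q ^+ m)).
    by apply: ler_sum => m _; apply: le_trans (HD _) _; rewrite exprD mulrA mulrAC.
  rewrite -mulr_sumr [leRHS](_ : _ = D * q ^+ N * 2); last by ring.
  by apply: ler_wpM2l; [rewrite mulr_ge0 // exprn_ge0|exact: geom_sum_le].
(* The constant [B'] is uncontrolled and only gives a geometric rate for the partial sums on the
   disc of radius [rr]. There they are at most [B + e], and Cauchy's estimate for polynomials
   applies to them. *)
have Abound m : cmod (A m) * rr ^+ m <= B.
  apply/ler_addgt0Pr => e e0.
  have [L LP] : exists L, (m < L)%N /\ 2 * B' * 2^-1 ^+ L <= e.
    have b0 : 0 <= 2 * B' / e by rewrite divr_ge0 ?mulr_ge0 // ltW.
    exists (maxn m.+1 (Num.bound (2 * B' / e))); split; first by rewrite leq_max ltnSn.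
    set L := maxn _ _.
    rewrite exprVn ler_pdivrMr ?exprn_gt0 // [leRHS]mulrC -ler_pdivrMr //.
    apply: le_trans (ltW (archi_boundP b0)) _; apply: (@le_trans _ _ L%:R).
      by rewrite ler_nat leq_maxr.
    exact: natr_le_exp2.
  have := @coef_le R 1 rr (B + e) (fun al => A (al ord0)) L (fun=> m) rr0.
  rewrite big_ord1; apply.
  - by move=> _; exact: LP.1.
  - exact: leq_ltn_trans LP.1.
  move=> u ur; rewrite cube_sum1.
  set h := u ord0; have hr : cmod h <= rr by exact: ur.
  have gh := Ag h hr.
  have gth : cmod (g (t0 + h)) <= B.
    by apply: gB; rewrite addrC addKr; apply: le_trans hr _; rewrite /rr; lra.
  have close : cmod (g (t0 + h) - \sum_(m < L) A m * h ^+ m) <= 2 * B' * 2^-1 ^+ L.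
    apply: (cvg_cmod_le gh); exists L => // M /= LM.
    apply: tailg => //.
    move=> k; apply: le_trans (Arr k); rewrite cmodM cmodX.
    apply: ler_wpM2l; first exact: cmod_ge0.
    by apply: lerXn2r; rewrite ?nnegrE ?cmod_ge0 // ltW.
  have := cmodBD (\sum_(m < L) A m * h ^+ m) (g (t0 + h)) 0.
  rewrite (cmodB _ (g _)) !subr0; have := LP.2; lra.
have B0 : 0 <= B by have := Abound 0%N; rewrite mulr1; apply: le_trans; exact: cmod_ge0.
exists A; split=> [m|u N uq]; first exact: Abound.
have ur : cmod u <= rr by rewrite ler_pdivrMr // in uq; rewrite /rr; have := cmod_ge0 u; lra.
apply: (cvg_cmod_le (Ag u ur)); exists N => // M /= NM.
apply: tailg => //.
- by rewrite divr_ge0 ?mulr_ge0 ?cmod_ge0 // ltW.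
- by move: uq; rewrite div1r.
move=> m; have -> : 4 * cmod u / r = cmod u / rr by rewrite /rr; field; rewrite gt_eqF.
rewrite cmodM cmodX.
have -> : cmod (A m) * cmod u ^+ m = cmod (A m) * rr ^+ m * (cmod u / rr) ^+ m.
  by rewrite -mulrA -exprMn mulrC [rr * _]mulrC divfK ?gt_eqF // mulrC.
apply: ler_wpM2r => //; rewrite exprn_ge0 // divr_ge0 ?cmod_ge0 // ltW //.
Qed.

End OneVariable.

(** * Perturbation of an operator contracting oscillations *)

Section SpectralGap.
Variables (R : realType) (E : lmodType (Cx R)) (X : Type) (ev : X -> E -> Cx R).
Variables (x0 : X) (e : E).
Local Notation C := (Cx R).
Hypothesis ev_lin : forall x c f g, ev x (c *: f + g) = c * ev x f + ev x g.
Hypothesis ev_inj : forall f g, (forall x, ev x f = ev x g) -> f = g.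
Hypothesis ev_e : forall x, ev x e = 1.

Hypothesis ev_bounded : forall f, exists B, forall x, cmod (ev x f) <= B.

Definition bdd (f : E) (B : R) := forall x, cmod (ev x f) <= B.
Definition osc (f : E) (d : R) := forall x y, cmod (ev x f - ev y f) <= d.

Hypothesis ev_complete : forall u : nat -> E,
  (forall eps : R, 0 < eps -> exists N, forall m l, (N <= m)%N -> (N <= l)%N ->
     bdd (u m - u l) eps) ->
  exists f, forall eps : R, 0 < eps -> exists N, forall m, (N <= m)%N -> bdd (u m - f) eps.

Lemma ev0f x : ev x 0 = 0.
Proof.
have := ev_lin x 1 0 0; rewrite scale1r addr0 mul1r => H.
by apply: (addrI (ev x 0)); rewrite addr0 -H.
Qed.

Lemma evZ x c f : ev x (c *: f) = c * ev x f.
Proof. by rewrite -[c *: f]addr0 ev_lin ev0f addr0. Qed.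

Lemma evD x f g : ev x (f + g) = ev x f + ev x g.
Proof. by rewrite -[f in LHS]scale1r ev_lin mul1r. Qed.

Lemma evB x f g : ev x (f - g) = ev x f - ev x g.
Proof. by rewrite evD -scaleN1r evZ mulN1r. Qed.

Lemma ev_sum x (I : Type) (s : seq I) (P : pred I) (F : I -> E) :
  ev x (\sum_(i <- s | P i) F i) = \sum_(i <- s | P i) ev x (F i).
Proof. by apply: (big_morph _ (evD x) (ev0f x)). Qed.

Lemma bdd_ge0 f B : bdd f B -> 0 <= B.
Proof. by move=> /(_ x0); apply: le_trans; exact: cmod_ge0. Qed.

Lemma osc_ge0 f d : osc f d -> 0 <= d.
Proof. by move=> /(_ x0 x0); apply: le_trans; exact: cmod_ge0. Qed.

Lemma bdd_le f B B' : B <= B' -> bdd f B -> bdd f B'.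
Proof. by move=> BB fB x; exact: le_trans (fB x) BB. Qed.

Lemma osc_le f d d' : d <= d' -> osc f d -> osc f d'.
Proof. by move=> dd fd x y; exact: le_trans (fd x y) dd. Qed.

Lemma bddD f g B B' : bdd f B -> bdd g B' -> bdd (f + g) (B + B').
Proof. by move=> fB gB x; rewrite evD; apply: le_trans (cmodD _ _) (lerD _ _). Qed.

Lemma bddB f g B B' : bdd f B -> bdd g B' -> bdd (f - g) (B + B').
Proof. by move=> fB gB x; rewrite evB; apply: le_trans (cmodBle _ _) (lerD _ _). Qed.

Lemma bddZ c f B : bdd f B -> bdd (c *: f) (cmod c * B).
Proof. by move=> fB x; rewrite evZ cmodM ler_wpM2l // cmod_ge0. Qed.

Lemma oscD f g d d' : osc f d -> osc g d' -> osc (f + g) (d + d').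
Proof.
by move=> fd gd x y; rewrite !evD opprD addrACA; apply: le_trans (cmodD _ _) (lerD _ _).
Qed.

Lemma oscZ c f d : osc f d -> osc (c *: f) (cmod c * d).
Proof. by move=> fd x y; rewrite !evZ -mulrBr cmodM ler_wpM2l // cmod_ge0. Qed.

Lemma oscB f g d d' : osc f d -> osc g d' -> osc (f - g) (d + d').
Proof.
move=> fd gd; rewrite -scaleN1r; apply: oscD => //.
by have := oscZ (-1) gd; rewrite cmodN cmod1 mul1r.
Qed.

Lemma bdd_osc f B : bdd f B -> osc f (2 * B).
Proof.
move=> fB x y; apply: le_trans (cmodBle _ _) _.
by rewrite mulr2n mulrDl mul1r lerD.
Qed.

Lemma osc_bdd f d : ev x0 f = 0 -> osc f d -> bdd f d.
Proof. by move=> f0 fd x; have := fd x x0; rewrite f0 subr0. Qed.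

Lemma osc_e : osc e 0.
Proof. by move=> x y; rewrite !ev_e subrr cmod0. Qed.

Lemma bdd_e : bdd e 1.
Proof. by move=> x; rewrite ev_e cmod1. Qed.

Lemma bdd_small f : (forall eps : R, 0 < eps -> bdd f eps) -> f = 0.
Proof.
move=> fs; apply: ev_inj => x; rewrite ev0f; apply/eqP.
rewrite -cmod_eq0 eq_le cmod_ge0 andbT; apply/ler_addgt0Pr => eps eps0.
by rewrite add0r; exact: fs.
Qed.

Lemma geometric_small (K q eps : R) : 0 <= K -> 0 <= q -> q < 1 -> 0 < eps ->
  exists N, forall m, (N <= m)%N -> K * q ^+ m <= eps.
Proof.
move=> K0 q0 q1 eps0.
have K1 : 0 < K + 1 by rewrite ltr_wpDl.
have qn : `|q| < 1 by rewrite ger0_norm.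
have eK : 0 < eps / (K + 1) by rewrite divr_gt0.
have /cvgrPdist_le/(_ _ eK)[N _ NP] := cvg_expr qn.
exists N => m Nm; have := NP m Nm; rewrite /= sub0r normrN ger0_norm ?exprn_ge0 // => H.
apply: le_trans (ler_wpM2l K0 H) _.
rewrite mulrCA -[leRHS]mulr1; apply: ler_wpM2l; first exact: ltW.
by rewrite ler_pdivrMr // mul1r lerDl.
Qed.

(** [F] stands for any distance, so that vectors evaluated at a point and scalars share the
    argument. The factor [1 - q ^ k] in [main] is what the induction preserves. *)
Lemma geometric_cauchy (F : nat -> nat -> R) (K q : R) : 0 <= K -> 0 <= q -> q < 1 ->
  (forall m, F m m = 0) -> (forall m l k, F m k <= F m l + F l k) ->
  (forall m, F m m.+1 <= K * q ^+ m) ->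
  forall m l, (m <= l)%N -> F m l <= K / (1 - q) * q ^+ m.
Proof.
move=> K0 q0 q1 F0 FD FS m l ml.
have q10 : 0 < 1 - q by rewrite subr_gt0.
have main k : F m (m + k)%N <= K / (1 - q) * (q ^+ m * (1 - q ^+ k)).
  elim: k => [|k IH]; first by rewrite addn0 F0 expr0 subrr !mulr0.
  apply: le_trans (FD m (m + k)%N _) _; rewrite addnS.
  apply: (le_trans (lerD IH (FS (m + k)%N))).
  rewrite le_eqVlt; apply/orP; left; apply/eqP; rewrite exprD exprS; field.
  by rewrite gt_eqF.
have := main (l - m)%N; rewrite subnKC // => /le_trans; apply.
apply: ler_wpM2l; first by rewrite divr_ge0 // ltW.
by rewrite ler_piMr ?exprn_ge0 // gerBl exprn_ge0.
Qed.

Lemma geometric_limit (u : nat -> E) (K q : R) : 0 <= K -> 0 <= q -> q < 1 ->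
  (forall m, bdd (u m.+1 - u m) (K * q ^+ m)) ->
  exists f, forall m, bdd (u m - f) (K / (1 - q) * q ^+ m).
Proof.
move=> K0 q0 q1 uK.
have q10 : 0 < 1 - q by rewrite subr_gt0.
have gc m l : (m <= l)%N -> bdd (u l - u m) (K / (1 - q) * q ^+ m).
  move=> ml x; apply: (geometric_cauchy (F := fun m l => cmod (ev x (u l - u m))) K0 q0 q1) => //.
  - by move=> j; rewrite subrr ev0f cmod0.
  - by move=> i j k; rewrite !evB [leRHS]addrC; exact: cmodBD.
  - by move=> j; exact: uK.
have [f fP] : exists f, forall eps : R, 0 < eps -> exists N, forall m, (N <= m)%N -> bdd (u m - f) eps.
  apply: ev_complete => eps eps0.
  have K10 : 0 <= K / (1 - q) by rewrite divr_ge0 // ltW.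
  have [N NP] := geometric_small K10 q0 q1 eps0.
  exists N => m l Nm Nl; have [ml|lm] := leqP m l.
    by move=> x; rewrite evB cmodB -evB; apply: le_trans (gc _ _ ml x) (NP m Nm).
  by apply: bdd_le (gc _ _ (ltnW lm)); exact: NP.
exists f => m x; apply/ler_addgt0Pr => eps eps0.
have [N NP] := fP eps eps0; pose l := maxn N m.
have h1 := NP l (leq_maxl _ _) x; have h2 := gc m l (leq_maxr _ _) x.
move: h1 h2; rewrite !evB => h1 h2.
apply: le_trans (cmodBD _ (ev x (u l)) _) _; rewrite (cmodB (ev x (u m))).
exact: lerD.
Qed.

Lemma geometric_limitC (z : nat -> C) (K q : R) : 0 <= K -> 0 <= q -> q < 1 ->
  (forall m, cmod (z m.+1 - z m) <= K * q ^+ m) ->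
  exists l, forall m, cmod (z m - l) <= K / (1 - q) * q ^+ m.
Proof.
move=> K0 q0 q1 zK.
have q10 : 0 < 1 - q by rewrite subr_gt0.
have gc m l : (m <= l)%N -> cmod (z l - z m) <= K / (1 - q) * q ^+ m.
  move=> ml; apply: (geometric_cauchy (F := fun m l => cmod (z l - z m)) K0 q0 q1) => //.
  - by move=> j; rewrite subrr cmod0.
  - by move=> i j k; rewrite [leRHS]addrC; exact: cmodBD.
have [l lP] : exists l : C, z N @[N --> \oo] --> l.
  apply: cx_cauchy_cvg => eps eps0.
  have K10 : 0 <= K / (1 - q) by rewrite divr_ge0 // ltW.
  have [N NP] := geometric_small K10 q0 q1 eps0.
  exists N => m k Nm Nk; have [mk|km] := leqP m k.
    by rewrite cmodB; apply: le_trans (gc _ _ mk) (NP m Nm).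
  by apply: le_trans (gc _ _ (ltnW km)) (NP _ _).
exists l => m; rewrite cmodB; apply: (cvg_cmod_le lP).
by exists m => // k /= mk; exact: gc.
Qed.

Section FixedOperator.
Variables (L : E -> E) (gam eta : R).
Hypothesis L_lin : linear L.
Hypotheses (gam0 : 0 <= gam) (gam1 : gam < 1).
(** [s] is the gap of the unperturbed operator and [rho] the oscillation allowed to an eigenvector.
    [g1] is the contraction rate that survives the perturbation, and [q] bounds [g1 / |beta|], the
    rate after normalising by the eigenvalue. *)
Let s := 1 - gam.
Let rho := s / 64.
Let g1 := 1 - s / 2.
Let q := 1 - s / 4.
Hypotheses (eta0 : 0 <= eta) (eta_le : eta <= s * rho / 8).
Hypothesis L_osc : forall w B d, bdd w B -> osc w d -> osc (L w) (gam * d + 2 * eta * B).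
Hypothesis L_bdd : forall w B, bdd w B -> bdd (L w) ((1 + eta) * B).
Hypothesis L_e : bdd (L e - e) eta.

Let s0 : 0 < s. Proof. by rewrite subr_gt0. Qed.
Let s1 : s <= 1. Proof. by rewrite gerBl. Qed.
Let rho0 : 0 < rho. Proof. by rewrite divr_gt0. Qed.
Let eta_rho : eta <= rho / 8.
Proof.
apply: le_trans eta_le _; rewrite -[s * rho / 8]mulrA; apply: ler_piMl => //.
by rewrite divr_ge0 // ltW.
Qed.

Let LD f g : L (f + g) = L f + L g.
Proof. by have := L_lin 1 f g; rewrite !scale1r. Qed.

Let L0 : L 0 = 0.
Proof. by apply: (addrI (L 0)); rewrite -LD !addr0. Qed.

Let LZ c f : L (c *: f) = c *: L f.
Proof. by have := L_lin c f 0; rewrite L0 !addr0. Qed.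

Let LB f g : L (f - g) = L f - L g.
Proof. by rewrite LD -scaleN1r LZ scaleN1r. Qed.

(* normalize is a contraction of slice; its fixed point is the dominant eigenvector. *)
Definition slice (v : E) : Prop := ev x0 v = 1 /\ osc v rho.

Definition normalize (v : E) : E := (ev x0 (L v))^-1 *: L v.

Lemma slice_diff v : slice v -> bdd (v - e) rho.
Proof.
move=> [v1 vr]; apply: osc_bdd; first by rewrite evB v1 ev_e subrr.
by rewrite -[rho]addr0; apply: oscB => //; exact: osc_e.
Qed.

Lemma slice_bdd v : slice v -> bdd v 2.
Proof.
move=> /slice_diff vr; have := bddD vr bdd_e; rewrite subrK; apply: bdd_le.
move: s1; rewrite /rho; lra.
Qed.

Lemma slice_eig v : slice v -> cmod (ev x0 (L v) - 1) <= 2 * rho.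
Proof.
move=> sv; have := L_bdd (slice_diff sv) x0; have := L_e x0.
rewrite LB !evB ev_e => h1 h2.
apply: le_trans (cmodBD _ (ev x0 (L e)) _) _.
have : eta * rho <= eta by rewrite ler_piMr //; move: s1; rewrite /rho; lra.
move: eta_rho rho0 h1 h2; lra.
Qed.

Lemma slice_osc v : slice v -> osc (L v) (rho * (1 - s / 2)).
Proof.
move=> sv; have vr := slice_diff sv; have or : osc (v - e) rho.
  by rewrite -[rho]addr0; apply: oscB osc_e; exact: sv.2.
have := oscD (L_osc vr or) (bdd_osc L_e); rewrite -[X in osc X]/(L (v - e) + (L e - e)).
rewrite LB addrA subrK => h.
have := oscD h osc_e; rewrite subrK addr0; apply: osc_le.
have er : eta * rho <= eta by rewrite ler_piMr //; move: s1; rewrite /rho; lra.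
have -> : rho * (1 - s / 2) = gam * rho + s * rho / 2 by rewrite /s; field.
move: eta_le er; lra.
Qed.

Lemma slice_inv v : slice v ->
  ev x0 (L v) != 0 /\ cmod (ev x0 (L v))^-1 <= 1 + 4 * rho.
Proof.
move=> sv; have h := slice_eig sv; set a := ev x0 (L v) in h *.
have r64 : rho <= 1 / 64 by move: s1; rewrite /rho; lra.
have a1 : 1 - 2 * rho <= cmod a.
  by have := cmodBD 1 a 0; rewrite !subr0 cmod1 (cmodB 1 a); lra.
have a0 : 0 < cmod a by lra.
split; first by rewrite -cmod_gt0.
rewrite cmodV -(ler_pM2l a0) mulfV ?gt_eqF //.
have p : 0 <= 1 + 4 * rho by move: rho0; lra.
apply: le_trans (ler_wpM2r p a1).
have : rho * rho <= rho * (1 / 64) by rewrite ler_pM2l.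
move: rho0; lra.
Qed.

(** Dividing by the value at [x0] enlarges the oscillation by at most [1 + 4 * rho = 1 + s / 16],
    which the factor [1 - s / 2] of [slice_osc] outweighs. *)
Lemma normalize_slice v : slice v -> slice (normalize v).
Proof.
move=> sv; have [a0 ai] := slice_inv sv; split; first by rewrite evZ mulVf.
apply: osc_le (oscZ _ (slice_osc sv)).
have p0 : 0 <= rho * (1 - s / 2) by rewrite mulr_ge0 ?ltW //; move: s1; lra.
apply: le_trans (ler_wpM2r p0 ai) _.
have -> : 4 * rho = s / 16 by rewrite /rho; field.
have -> : (1 + s / 16) * (rho * (1 - s / 2)) = rho * ((1 + s / 16) * (1 - s / 2)) by ring.
rewrite -[leRHS]mulr1 ler_pM2l //.
have : 0 <= s * s by rewrite mulr_ge0 // ltW.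
move: s0; lra.
Qed.

(** The difference equals [a^-1] times [L (v - v') + (a' - a) normalize v']. The first term is
    contracted; the second has oscillation at most [|a' - a| rho], small because elements of the
    slice oscillate little. All losses fit into [g1 = gam + 32 * rho]. *)
Lemma normalize_contract v v' d : slice v -> slice v' -> osc (v - v') d ->
  osc (normalize v - normalize v') (g1 * d).
Proof.
move=> sv sv' vd; have [a0 ai] := slice_inv sv; have [a0' _] := slice_inv sv'.
have d0 := osc_ge0 vd.
have bd : bdd (v - v') d by apply: osc_bdd => //; rewrite evB sv.1 sv'.1 subrr.
set a := ev x0 (L v) in a0 ai; set a' := ev x0 (L v') in a0'.
have aa : cmod (a' - a) <= (1 + eta) * d.
  by have := L_bdd bd x0; rewrite LB evB cmodB.
have -> : normalize v - normalize v' = a^-1 *: (L (v - v') + (a' - a) *: normalize v').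
  apply: ev_inj => x; rewrite LB evB /normalize !evZ evD evB !evZ -/a -/a'; field.
  by rewrite a0 a0'.
have := oscZ a^-1 (oscD (L_osc bd vd) (oscZ (a' - a) (normalize_slice sv').2)).
apply: osc_le.
set W := gam * d + 2 * eta * d + cmod (a' - a) * rho.
have r64 : rho <= 1 / 64 by move: s1; rewrite /rho; lra.
have W1 : W <= (gam + 3 * rho) * d.
  have : cmod (a' - a) * rho <= (1 + eta) * d * rho by rewrite ler_wpM2r // ltW.
  have : eta * d <= rho / 8 * d by rewrite ler_wpM2r.
  have : (1 + eta) * d * rho <= 2 * d * rho.
    apply: ler_wpM2r; first exact: ltW.
    apply: ler_wpM2r => //; move: eta_rho r64; lra.
  have : 0 <= rho * d by rewrite mulr_ge0 // ltW.
  rewrite /W; lra.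
have W0 : 0 <= W.
  by rewrite /W !addr_ge0 // !mulr_ge0 ?cmod_ge0 // ltW.
apply: le_trans (ler_wpM2r W0 ai) _.
have p : 0 <= 1 + 4 * rho by move: rho0; lra.
apply: le_trans (ler_wpM2l p W1) _; rewrite mulrA; apply: ler_wpM2r => //.
have : rho * rho <= rho * (1 / 64) by rewrite ler_pM2l.
have : rho * gam <= rho by rewrite ler_piMr // ltW.
have -> : g1 = gam + 32 * rho by rewrite /g1 /rho /s; field.
move: rho0; lra.
Qed.

Let g10 : 0 <= g1. Proof. by move: s1; rewrite /g1; lra. Qed.
Let g1_lt1 : g1 < 1. Proof. by move: s0; rewrite /g1; lra. Qed.
Let s_neq0 : s != 0. Proof. by rewrite gt_eqF. Qed.

Definition power_iter (m : nat) : E := iter m normalize e.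

Lemma power_iter_slice m : slice (power_iter m).
Proof.
elim: m => [|m IH]; last exact: normalize_slice.
by split; [exact: ev_e|apply: osc_le osc_e; exact: ltW].
Qed.

(** Banach's fixed point argument. The rate is part of the statement, with constants that depend on
    [gam] only: for a family of operators the convergence is then uniform, and the eigenvector
    inherits holomorphy in the parameter from the iterates. *)
Lemma eigenvector_exists : exists v : E, [/\ slice v, L v = ev x0 (L v) *: v &
  forall m, bdd (power_iter m - v) (2 * rho * (1 + rho) / (1 - g1) * g1 ^+ m)].
Proof.
have step m : osc (power_iter m.+1 - power_iter m) (2 * rho * g1 ^+ m).
  elim: m => [|m IH].
    rewrite mulr1; have -> : 2 * rho = rho + rho by ring.
    by apply: oscB; [exact: (power_iter_slice 1).2|exact: (power_iter_slice 0).2].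
  rewrite exprS mulrCA;
  exact: (normalize_contract (power_iter_slice m.+1) (power_iter_slice m) IH).
have r2 : 0 <= 2 * rho by rewrite mulr_ge0 // ltW.
have stepb m : bdd (power_iter m.+1 - power_iter m) (2 * rho * g1 ^+ m).
  apply: osc_bdd (step m).
  by rewrite evB (power_iter_slice m.+1).1 (power_iter_slice m).1 subrr.
have [v vP] := geometric_limit r2 g10 g1_lt1 stepb.
set K := 2 * rho / (1 - g1) in vP.
have K0 : 0 <= K by rewrite divr_ge0 // subr_ge0 ltW.
have v1 : ev x0 v = 1.
  apply/eqP; rewrite -subr_eq0 -cmod_eq0 eq_le cmod_ge0 andbT.
  apply/ler_addgt0Pr => eps eps0; rewrite add0r.
  have [N NP] := geometric_small K0 g10 g1_lt1 eps0.
  have := vP N x0; rewrite evB (power_iter_slice N).1 cmodB => /le_trans; apply.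
  exact: NP.
have sv : slice v.
  split=> // x y; apply/ler_addgt0Pr => eps eps0.
  have eps20 : 0 < eps / 2 by rewrite divr_gt0.
  have [N NP] := geometric_small K0 g10 g1_lt1 eps20.
  have := vP N x; have := vP N y; rewrite !evB; have := NP N (leqnn N).
  have := (power_iter_slice N).2 x y; set p := power_iter N.
  have := cmodBD (ev x v) (ev x p) (ev y v); have := cmodBD (ev x p) (ev y p) (ev y v).
  rewrite (cmodB (ev x v) (ev x p)); lra.
exists v; split=> //; last first.
  move=> m; apply: bdd_le (vP m); apply: ler_wpM2r; first by rewrite exprn_ge0.
  rewrite /K; apply: ler_wpM2r; first by rewrite invr_ge0 subr_ge0 ltW.
  by rewrite ler_peMr // lerDl ltW.
have [a0 _] := slice_inv sv.
suff H : normalize v - v = 0.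
  move/eqP: H; rewrite subr_eq0 => /eqP H.
  by rewrite -[X in _ = _ *: X]H /normalize scalerA mulfV // scale1r.
apply: bdd_small => eps eps0.
have K20 : 0 <= 2 * K + K by rewrite !addr_ge0 // mulr_ge0.
have [N NP] := geometric_small K20 g10 g1_lt1 eps0.
apply: bdd_le (NP N (leqnn N)) _.
have -> : normalize v - v = (normalize v - normalize (power_iter N)) + (power_iter N.+1 - v).
  by rewrite addrA subrK.
rewrite mulrDl; apply: bddD.
  apply: osc_bdd; first by rewrite evB (normalize_slice sv).1 (normalize_slice (power_iter_slice N)).1 subrr.
  have vp : osc (v - power_iter N) (2 * (K * g1 ^+ N)).
    by apply: bdd_osc => x; rewrite evB cmodB -evB; exact: vP.
  apply: osc_le (normalize_contract sv (power_iter_slice N) vp).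
  rewrite -[2 * K * _]mulrA; apply: ler_piMl; last exact: ltW.
  by apply: mulr_ge0 => //; apply: mulr_ge0 => //; exact: exprn_ge0.
apply: bdd_le (vP N.+1); apply: ler_wpM2l => //.
by rewrite exprS ler_piMl ?exprn_ge0 // ltW.
Qed.

Section Functional.
Variable v : E.
Hypotheses (sv : slice v) (Lv : L v = ev x0 (L v) *: v).
Let beta := ev x0 (L v).

Let beta0 : beta != 0. Proof. by have [] := slice_inv sv. Qed.

Lemma beta_lower : 1 - s / 32 <= cmod beta.
Proof.
have h := slice_eig sv; rewrite -/beta in h.
have := cmodBD 1 beta 0; rewrite !subr0 cmod1 (cmodB 1 beta); rewrite /rho in h; lra.
Qed.

Lemma gap_ratio : g1 / cmod beta <= q.
Proof.
have bl := beta_lower; have b0 : 0 < cmod beta by rewrite cmod_gt0.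
rewrite ler_pdivrMr //; have qn : 0 <= q by move: s1; rewrite /q; lra.
apply: le_trans (ler_wpM2l qn bl).
have : 0 <= s * s by rewrite mulr_ge0 // ltW.
move: s0; rewrite /g1 /q; lra.
Qed.

(** The projection along [v] onto the vectors vanishing at [x0]. It is explicit, unlike the spectral
    projection, and on such vectors oscillation and size control each other. *)
Definition defect (w : E) : E := w - ev x0 w *: v.

Lemma defect_ev0 w : ev x0 (defect w) = 0.
Proof. by rewrite evB evZ sv.1 mulr1 subrr. Qed.

Lemma defect_osc w B : bdd w B -> osc (defect w) (3 * B).
Proof.
move=> wB; have B0 := bdd_ge0 wB.
apply: osc_le (oscB (bdd_osc wB) (oscZ _ sv.2)).
have : cmod (ev x0 w) * rho <= B * 1.
  apply: ler_pM; [exact: cmod_ge0|exact: ltW|exact: wB|move: s0 s1; rewrite /rho; lra].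
lra.
Qed.

Lemma defect_step w d : ev x0 w = 0 -> osc w d -> osc (defect (L w)) (g1 * d).
Proof.
move=> w0 wd; have wb := osc_bdd w0 wd; have d0 := osc_ge0 wd.
apply: osc_le (oscB (L_osc wb wd) (oscZ _ sv.2)).
have h : cmod (ev x0 (L w)) * rho <= (1 + eta) * d * rho.
  by apply: ler_wpM2r; [exact: ltW|exact: L_bdd].
have r64 : rho <= 1 / 64 by move: s1; rewrite /rho; lra.
have : eta * d <= rho / 8 * d by rewrite ler_wpM2r.
have : (1 + eta) * d * rho <= 2 * d * rho.
  apply: ler_wpM2r; first exact: ltW.
  apply: ler_wpM2r => //; move: eta_rho r64; lra.
have -> : g1 * d = gam * d + 32 * (rho * d) by rewrite /g1 /rho /s; field.
have : 0 <= rho * d by rewrite mulr_ge0 // ltW.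
lra.
Qed.

(** With respect to the multiples of [v] and the defects, [L] is triangular because [L v = beta v]:
    defects evolve among themselves, and merely feed the coefficient of [v]. *)
Lemma iterL_decomp w m : iter m.+1 L w =
   (beta * ev x0 (iter m L w) + ev x0 (L (defect (iter m L w)))) *: v +
   defect (L (defect (iter m L w))).
Proof.
rewrite iterS; set y := iter m L w.
have {1}-> : y = ev x0 y *: v + defect y by rewrite addrC subrK.
rewrite LD LZ Lv -/beta {3}/defect scalerDl scalerA [_ * beta]mulrC -addrA; congr (_ + _).
by rewrite addrC subrK.
Qed.

Lemma iterL_coef w m : ev x0 (iter m.+1 L w) =
   beta * ev x0 (iter m L w) + ev x0 (L (defect (iter m L w))).
Proof. by rewrite iterL_decomp evD evZ sv.1 mulr1 defect_ev0 addr0. Qed.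

Lemma iterL_defect w m : defect (iter m.+1 L w) = defect (L (defect (iter m L w))).
Proof. by rewrite {1}/defect iterL_coef iterL_decomp addrC addKr. Qed.

Lemma iterL_defect_osc w B m : bdd w B -> osc (defect (iter m L w)) (3 * B * g1 ^+ m).
Proof.
move=> wB; elim: m => [|m IH]; first by rewrite mulr1; exact: defect_osc.
by rewrite iterL_defect exprS mulrCA; apply: defect_step => //; exact: defect_ev0.
Qed.

Let q_ge0 : 0 <= q. Proof. by move: s1; rewrite /q; lra. Qed.
Let q_lt1 : q < 1. Proof. by move: s0; rewrite /q; lra. Qed.

(** The normalised value at [x0] changes only by what the defect feeds in, of order [g1 ^ m] against
    [beta ^ m.+1]. The constant 8 is the product of [(1 + eta) * 3 <= 4] and [1 / |beta| <= 2]. *)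
Lemma functional_step w B m : bdd w B ->
  cmod (ev x0 (iter m.+1 L w) / beta ^+ m.+1 - ev x0 (iter m L w) / beta ^+ m) <= 8 * B * q ^+ m.
Proof.
move=> wB; have B0 := bdd_ge0 wB; rewrite iterL_coef.
have -> : (beta * ev x0 (iter m L w) + ev x0 (L (defect (iter m L w)))) / beta ^+ m.+1 -
     ev x0 (iter m L w) / beta ^+ m = ev x0 (L (defect (iter m L w))) / beta ^+ m.+1.
  by rewrite exprS; field; rewrite expf_neq0 // beta0.
have b0 : 0 < cmod beta by rewrite cmod_gt0.
have h := L_bdd (osc_bdd (defect_ev0 _) (iterL_defect_osc m wB)) x0.
rewrite cmodM cmodV cmodX.
apply: (@le_trans _ _ ((1 + eta) * (3 * B * g1 ^+ m) / cmod beta ^+ m.+1)).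
  by rewrite ler_wpM2r // invr_ge0 exprn_ge0 // ltW.
have -> : (1 + eta) * (3 * B * g1 ^+ m) / cmod beta ^+ m.+1 =
   (1 + eta) * 3 * (cmod beta)^-1 * B * (g1 / cmod beta) ^+ m.
  by rewrite exprS expr_div_n; field; rewrite expf_neq0 gt_eqF.
apply: ler_pM.
- by rewrite !mulr_ge0 ?invr_ge0 ?addr_ge0 // ltW.
- by rewrite exprn_ge0 // divr_ge0 // ltW.
- apply: ler_wpM2r => //.
  have bl := beta_lower.
  have bi : (cmod beta)^-1 <= 2.
    rewrite -(ler_pM2l b0) mulfV ?gt_eqF //; move: bl s1; lra.
  have e1 : (1 + eta) * 3 <= 4 by move: eta_rho s1; rewrite /rho; lra.
  have p1 : 0 <= (1 + eta) * 3 by rewrite mulr_ge0 // addr_ge0.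
  have p2 : 0 <= (cmod beta)^-1 by rewrite invr_ge0 ltW.
  by have := ler_pM p1 p2 e1 bi; lra.
- apply: lerXn2r; rewrite ?nnegrE ?divr_ge0 ?gap_ratio //; exact: ltW.
Qed.

Lemma iterL_lin m : linear (iter m L).
Proof.
by elim: m => [|m IH] c f g //; rewrite !iterS IH L_lin.
Qed.

Lemma functional_exists : exists phi : E -> C,
  [/\ forall w B m, bdd w B ->
        cmod (ev x0 (iter m L w) / beta ^+ m - phi w) <= 32 / s * B * q ^+ m,
      forall c f g, phi (c *: f + g) = c * phi f + phi g,
      phi v = 1,
      forall w, phi (L w) = beta * phi w &
      forall w B, bdd w B -> cmod (phi w) <= 33 / s * B].
Proof.
have ex_bdd w : exists B, bdd w B by exact: ev_bounded.
have /choice[phi phiP] : forall w, exists l : C, forall B m, bdd w B ->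
    cmod (ev x0 (iter m L w) / beta ^+ m - l) <= 32 / s * B * q ^+ m.
  move=> w; have [B1 wB1] := ex_bdd w.
  have [l0 l0P] := @geometric_limitC (fun m => ev x0 (iter m L w) / beta ^+ m)
     (8 * B1) q (mulr_ge0 (ler0n _ 8) (bdd_ge0 wB1)) q_ge0 q_lt1
     (fun m => functional_step m wB1).
  exists l0 => B m wB.
  have [l lP] := @geometric_limitC (fun m => ev x0 (iter m L w) / beta ^+ m)
     (8 * B) q (mulr_ge0 (ler0n _ 8) (bdd_ge0 wB)) q_ge0 q_lt1
     (fun m => functional_step m wB).
  have q1 : 1 - q = s / 4 by rewrite /q; ring.
  suff -> : l0 = l.
    apply: le_trans (lP m) _; rewrite q1 le_eqVlt; apply/orP; left; apply/eqP.
    by field.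
  apply/eqP; rewrite -subr_eq0 -cmod_eq0 eq_le cmod_ge0 andbT.
  apply/ler_addgt0Pr => eps eps0; rewrite add0r.
  have K0 : 0 <= 8 * B1 / (1 - q) + 8 * B / (1 - q).
    have s40 : 0 <= s / 4 by rewrite divr_ge0 // ltW.
    by rewrite q1 addr_ge0 // divr_ge0 // mulr_ge0 // (bdd_ge0 wB1, bdd_ge0 wB).
  have [N NP] := geometric_small K0 q_ge0 q_lt1 eps0.
  apply: le_trans (NP N (leqnn N)).
  apply: le_trans (cmodBD _ (ev x0 (iter N L w) / beta ^+ N) _) _.
  by rewrite mulrDl (cmodB l0) lerD.
have uniq w z K : 0 <= K -> (forall m, cmod (ev x0 (iter m L w) / beta ^+ m - z) <= K * q ^+ m) ->
    phi w = z.
  move=> K0 zP; have [B wB] := ex_bdd w.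
  apply/eqP; rewrite -subr_eq0 -cmod_eq0 eq_le cmod_ge0 andbT.
  apply/ler_addgt0Pr => eps eps0; rewrite add0r.
  have K20 : 0 <= 32 / s * B + K.
    by rewrite addr_ge0 // mulr_ge0 ?(bdd_ge0 wB) // divr_ge0 // ltW.
  have [N NP] := geometric_small K20 q_ge0 q_lt1 eps0.
  apply: le_trans (NP N (leqnn N)).
  apply: le_trans (cmodBD _ (ev x0 (iter N L w) / beta ^+ N) _) _.
  by rewrite mulrDl (cmodB (phi w)) lerD // phiP.
have s32 B : 0 <= B -> 0 <= 32 / s * B by move=> B0; rewrite mulr_ge0 // divr_ge0 // ltW.
exists phi; split.
- by move=> w B m wB; exact: phiP.
- move=> c f g; have [Bf fB] := ex_bdd f; have [Bg gB] := ex_bdd g.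
  apply: (uniq _ _ (cmod c * (32 / s * Bf) + 32 / s * Bg)).
    apply: addr_ge0; last exact: s32 (bdd_ge0 gB).
    by apply: mulr_ge0; [exact: cmod_ge0|exact: s32 (bdd_ge0 fB)].
  move=> m; rewrite iterL_lin evD evZ.
  have -> : (c * ev x0 (iter m L f) + ev x0 (iter m L g)) / beta ^+ m - (c * phi f + phi g) =
     c * (ev x0 (iter m L f) / beta ^+ m - phi f) + (ev x0 (iter m L g) / beta ^+ m - phi g).
    by ring.
  apply: le_trans (cmodD _ _) _; rewrite cmodM mulrDl -[cmod c * _ * q ^+ m]mulrA; apply: lerD; last exact: phiP.
  by apply: ler_wpM2l; [exact: cmod_ge0|exact: phiP].
- apply: (uniq _ _ 0) => // m; rewrite mul0r.
  have -> : iter m L v = beta ^+ m *: v.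
    elim: m => [|m IH]; first by rewrite scale1r.
    by rewrite iterS IH LZ Lv scalerA -exprSr.
  by rewrite evZ sv.1 mulr1 mulfV ?expf_neq0 // subrr cmod0.
- move=> w; have [B wB] := ex_bdd w.
  apply: (uniq _ _ (cmod beta * (32 / s * B))).
    by apply: mulr_ge0; [exact: cmod_ge0|exact: s32 (bdd_ge0 wB)].
  move=> m; rewrite -iterSr.
  have -> : ev x0 (iter m.+1 L w) / beta ^+ m - beta * phi w =
     beta * (ev x0 (iter m.+1 L w) / beta ^+ m.+1 - phi w).
    by rewrite exprS; field; rewrite expf_neq0 // beta0.
  rewrite cmodM -[leRHS]mulrA; apply: ler_wpM2l; first exact: cmod_ge0.
  apply: le_trans (phiP w B m.+1 wB) _; apply: ler_wpM2l; first exact: s32 (bdd_ge0 wB).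
  by rewrite exprS ler_piMl ?exprn_ge0 // ltW.
- move=> w B wB; have B0 := bdd_ge0 wB.
  have := phiP w B 0%N wB; rewrite expr0 divr1 mulr1 /=.
  pose z := s^-1 * B.
  have -> : 32 / s * B = 32 * z by rewrite /z; ring.
  have -> : 33 / s * B = 33 * z by rewrite /z; ring.
  have zB : B <= z by apply: ler_peMl => //; rewrite -invr1 lef_pV2 ?posrE.
  have := cmodBD (phi w) (ev x0 w) 0; rewrite !subr0 (cmodB (phi w)).
  have := wB x0; lra.
Qed.

(** In the kernel of [phi] the coefficient of [v] is [- phi] of the defect, so the decay of the
    defect is the decay of the whole vector. The constant is [33 * 3 * 2 + 3 = 201]: the bound of
    [phi], that of the defect, that of [v], and the defect itself. *)
Lemma kernel_decay (phi : E -> C) w B m :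
  (forall c f g, phi (c *: f + g) = c * phi f + phi g) -> phi v = 1 ->
  (forall w, phi (L w) = beta * phi w) ->
  (forall w B, bdd w B -> cmod (phi w) <= 33 / s * B) ->
  bdd w B -> phi w = 0 -> bdd (iter m L w) (201 / s * B * g1 ^+ m).
Proof.
move=> phi_lin phiv phiL phiB wB w0; have B0 := bdd_ge0 wB.
set y := iter m L w.
have y0 : phi y = 0.
  by rewrite /y; elim: (m) => [//|l IH]; rewrite iterS phiL IH mulr0.
have dy : bdd (defect y) (3 * B * g1 ^+ m).
  by apply: osc_bdd; [exact: defect_ev0|exact: iterL_defect_osc].
have yE : y = ev x0 y *: v + defect y by rewrite addrC subrK.
have c0 : ev x0 y = - phi (defect y).
  by apply/eqP; rewrite -subr_eq0 opprK -[X in X + _]mulr1 -phiv -phi_lin -yE y0.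
have h1 := phiB _ _ dy.
rewrite yE; apply: bdd_le (bddD (bddZ _ (slice_bdd sv)) dy).
rewrite c0 cmodN.
have G0 : 0 <= B * g1 ^+ m by rewrite mulr_ge0 // exprn_ge0.
pose u := B * g1 ^+ m; pose z := s^-1 * u.
have zu : u <= z by apply: ler_peMl => //; rewrite -invr1 lef_pV2 ?posrE.
have -> : 201 / s * B * g1 ^+ m = 201 * z by rewrite /z /u; ring.
have h2 : cmod (phi (defect y)) <= 99 * z.
  by apply: le_trans h1 _; rewrite le_eqVlt; apply/orP; left; apply/eqP; rewrite /z /u; ring.
have -> : 3 * B * g1 ^+ m = 3 * u by rewrite /u; ring.
lra.
Qed.

End Functional.
End FixedOperator.
End SpectralGap.

(** * Taylor series of holomorphic operator families *)

Section OperatorTaylor.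
Variables (R : realType) (E : lmodType (Cx R)) (X : Type) (ev : X -> E -> Cx R).
Variables (x0 : X).
Local Notation C := (Cx R).
Hypothesis ev_lin : forall x c f g, ev x (c *: f + g) = c * ev x f + ev x g.
Hypothesis ev_inj : forall f g, (forall x, ev x f = ev x g) -> f = g.
Hypothesis ev_bounded : forall f, exists B, forall x, cmod (ev x f) <= B.
Hypothesis ev_complete : forall u : nat -> E,
  (forall eps : R, 0 < eps -> exists N, forall m l, (N <= m)%N -> (N <= l)%N ->
     bdd ev (u m - u l) eps) ->
  exists f, forall eps : R, 0 < eps -> exists N, forall m, (N <= m)%N -> bdd ev (u m - f) eps.
Local Notation bdd := (bdd ev).

Definition bnorm (f : E) : R := sup [set cmod (ev x f) | x in [set: X]].

Lemma bdd_bnorm f : bdd f (bnorm f).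
Proof.
have [B fB] := ev_bounded f => x; apply: sup_upper_bound; last by exists x.
by split; [exists (cmod (ev x0 f)); exists x0|exists B => _ [y _ <-]; exact: fB].
Qed.

Lemma bnorm_le f B : bdd f B -> bnorm f <= B.
Proof.
move=> fB; apply: sup_le_ub; first by exists (cmod (ev x0 f)); exists x0.
by move=> _ [x _ <-]; exact: fB.
Qed.

Lemma bnorm_ge0 f : 0 <= bnorm f.
Proof. exact (bdd_ge0 x0 (bdd_bnorm f)). Qed.

Variables (F : C -> E -> E) (t0 : C) (r K : R).
Hypotheses (r0 : 0 < r) (K0 : 0 <= K).
Hypothesis F_lin : forall t, cmod (t - t0) <= r -> linear (F t).
Hypothesis F_bdd : forall t, cmod (t - t0) <= r -> forall w B, bdd w B -> bdd (F t w) (K * B).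
Hypothesis F_hol : forall t, cmod (t - t0) <= r -> forall w x, sdiff1 (fun t => ev x (F t w)) t.

(** Cauchy's formula for the [m]-th coefficient as a finite average. It is a vector of [E] and
    linear in [w], whereas the Taylor coefficients themselves are at first only numbers, one for
    each evaluation. *)
Definition cauchy_op (m N : nat) (w : E) : E :=
  (N%:R ^+ 1)^-1 *: \sum_(j : {ffun 'I_1 -> 'I_N})
     (torus_offset (r / 8) j ord0)^-1 ^+ m *: F (t0 + torus_offset (r / 8) j ord0) w.

Let r80 : 0 < r / 8. Proof. by rewrite divr_gt0. Qed.

Let offset_in (N : nat) (j : {ffun 'I_1 -> 'I_N}) : (0 < N)%N ->
  cmod (t0 + torus_offset (r / 8) j ord0 - t0) <= r.
Proof.
move=> N0; rewrite addrC addKr cmod_torus_offset ?ltW //.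
by move: r0 => p; lra.
Qed.

Lemma cauchy_op_lin m N : (0 < N)%N -> linear (cauchy_op m N).
Proof.
move=> N0 c f g; apply: ev_inj => x.
rewrite ev_lin /cauchy_op !(evZ ev_lin) !(ev_sum ev_lin) mulrCA -mulrDr; congr (_ * _).
rewrite mulr_sumr -big_split; apply: eq_bigr => j _ /=.
by rewrite !(evZ ev_lin) (F_lin (offset_in j N0)) ev_lin; ring.
Qed.

(** Uniformly in [x], the evaluations of [cauchy_op m N w] converge geometrically to the scalar
    coefficients, so by completeness these are the evaluations of a vector. On the circle of radius
    [r / 8] the ratio [4 * |z| / r] is exactly [1 / 2]. *)
Lemma op_coef_exists (w : E) : exists a : nat -> E,
  [/\ forall m, bdd (a m) (K * bnorm w / (r / 4) ^+ m),
      forall h N, 4 * cmod h / r <= 1 / 2 ->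
        bdd (F (t0 + h) w - \sum_(m < N) h ^+ m *: a m) (2 * (K * bnorm w) * (4 * cmod h / r) ^+ N) &
      forall m N, (m < N)%N ->
        bdd (cauchy_op m N w - a m) (2 * (K * bnorm w) * (1 / 2) ^+ N / (r / 8) ^+ m)].
Proof.
have wB := bdd_bnorm w; have B0 := bnorm_ge0 w; set B := bnorm w in wB B0 *.
have KB0 : 0 <= K * B by rewrite mulr_ge0.
have /choice[A AP] : forall x, exists A : nat -> C,
    (forall m, cmod (A m) * (r / 4) ^+ m <= K * B) /\
    forall u N, 4 * cmod u / r <= 1 / 2 ->
      cmod (ev x (F (t0 + u) w) - \sum_(m < N) A m * u ^+ m) <= 2 * (K * B) * (4 * cmod u / r) ^+ N.
  move=> x; apply: (@taylor1 _ (fun t => ev x (F t w)) t0 r (K * B)) => // t tr.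
    exact: F_hol.
  exact: (F_bdd tr wB).
have close m N x : (m < N)%N ->
    cmod (ev x (cauchy_op m N w) - A x m) <= 2 * (K * B) * (1 / 2) ^+ N / (r / 8) ^+ m.
  move=> mN; have N0 : (0 < N)%N by apply: leq_ltn_trans mN.
  have -> : A x m = @torus_avg R 1 N (fun j => cube_sum (fun al => A x (al ord0)) (torus_offset (r / 8) j) N *
      \prod_i (torus_offset (r / 8) j i)^-1 ^+ m).
    by rewrite (@coef_extract _ _ _ _ r80 N0 _ N (fun=> m)).
  rewrite /cauchy_op (evZ ev_lin) (ev_sum ev_lin) /torus_avg -mulrBr -sumrB.
  apply: torus_avg_le => // j; rewrite (evZ ev_lin) big_ord1 mulrC -mulrBl cube_sum1.
  set z := torus_offset (r / 8) j ord0.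
  have zr : cmod z = r / 8 by rewrite cmod_torus_offset // ltW.
  rewrite cmodM cmodX cmodV zr exprVn; apply: ler_wpM2r.
    by rewrite invr_ge0 exprn_ge0 // ltW.
  have zq : 4 * cmod z / r = 1 / 2 by rewrite zr; field; rewrite gt_eqF.
  by have := (AP x).2 z N; rewrite zq => /(_ (lexx _)).
have /choice[a aP] : forall m, exists f : E, forall x, ev x f = A x m.
  move=> m; pose M := 2 * (K * B) / (r / 8) ^+ m.
  have M0 : 0 <= M by rewrite divr_ge0 ?mulr_ge0 ?exprn_ge0 // ltW.
  have h0 : 0 <= 1 / 2 :> R by lra.
  have h1 : 1 / 2 < 1 :> R by lra.
  have sm (eps : R) : 0 < eps -> exists N, forall l, (N <= l)%N -> forall x,
      cmod (ev x (cauchy_op m l w) - A x m) <= eps.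
    move=> /(geometric_small M0 h0 h1)[N NP]; exists (maxn N m.+1) => l.
    rewrite geq_max => /andP[Nl ml] x; apply: le_trans (close m l x ml) _.
    by apply: le_trans (NP l Nl); rewrite /M mulrAC.
  have [f fP] : exists f, forall eps : R, 0 < eps -> exists N, forall l, (N <= l)%N -> bdd (cauchy_op m l w - f) eps.
    apply: ev_complete => eps eps0.
    have eps20 : 0 < eps / 2 by rewrite divr_gt0.
    have [N NP] := sm _ eps20; exists N => k l Nk Nl x; rewrite (evB ev_lin).
    apply: le_trans (cmodBD _ (A x m) _) _.
    by rewrite (cmodB (A x m)) [leRHS](splitr eps) lerD // NP.
  exists f => x; apply/eqP; rewrite -subr_eq0 -cmod_eq0 eq_le cmod_ge0 andbT.
  apply/ler_addgt0Pr => eps eps0; rewrite add0r.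
  have eps20 : 0 < eps / 2 by rewrite divr_gt0.
  have [N NP] := sm _ eps20; have [N' NP'] := fP _ eps20.
  have := NP (maxn N N') (leq_maxl _ _) x; have := NP' (maxn N N') (leq_maxr _ _) x.
  rewrite (evB ev_lin) => p1 p2.
  apply: le_trans (cmodBD _ (ev x (cauchy_op m (maxn N N') w)) _) _.
  by rewrite (cmodB (ev x f)) [leRHS](splitr eps) lerD.
exists a; split=> [m x|h N hq x|m N mN x].
- by rewrite aP ler_pdivlMr ?exprn_gt0 ?divr_gt0 //; exact: (AP x).1.
- rewrite (evB ev_lin) (ev_sum ev_lin).
  have := (AP x).2 h N hq; congr (cmod (_ - _) <= _); apply: eq_bigr => m _.
  by rewrite (evZ ev_lin) aP mulrC.
- by rewrite (evB ev_lin) aP; exact: close.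
Qed.

(** The coefficients were chosen separately for each vector; they depend linearly on it as limits of
    the linear maps [cauchy_op m N]. *)
Lemma op_taylor : exists a : nat -> E -> E,
  [/\ forall m, linear (a m),
      forall m w B, bdd w B -> bdd (a m w) (K / (r / 4) ^+ m * B) &
      forall h N, 4 * cmod h / r <= 1 / 2 -> forall w B, bdd w B ->
        bdd (F (t0 + h) w - \sum_(m < N) h ^+ m *: a m w) (2 * K * (4 * cmod h / r) ^+ N * B)].
Proof.
have /choice[a' aP] := op_coef_exists.
exists (fun m w => a' w m); split=> [m c f g|m w B wB|h N hq w B wB].
- have h0 : 0 <= 1 / 2 :> R by lra.
  have h1 : 1 / 2 < 1 :> R by lra.
  pose M w := 2 * (K * bnorm w) / (r / 8) ^+ m.
  have M0 w : 0 <= M w.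
    by rewrite divr_ge0 ?mulr_ge0 ?exprn_ge0 ?bnorm_ge0 // ltW.
  have T0 : 0 <= M (c *: f + g) + (cmod c * M f + M g).
    by rewrite !addr_ge0 // mulr_ge0 ?cmod_ge0.
  have close w N : (m < N)%N -> bdd (cauchy_op m N w - a' w m) (M w * (1 / 2) ^+ N).
    by move=> mN; have [_ _ /(_ m N mN)] := aP w; rewrite /M mulrAC.
  apply/eqP; rewrite -subr_eq0; apply/eqP; apply: (bdd_small ev_lin ev_inj) => eps eps0.
  have [N NP] := geometric_small T0 h0 h1 eps0.
  pose l := maxn N m.+1.
  have ml : (m < l)%N by rewrite leq_max ltnSn orbT.
  apply: bdd_le (NP l (leq_maxl _ _)) _.
  have -> : a' (c *: f + g) m - (c *: a' f m + a' g m) =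
     (c *: (cauchy_op m l f - a' f m) + (cauchy_op m l g - a' g m)) -
      (cauchy_op m l (c *: f + g) - a' (c *: f + g) m).
    apply: ev_inj => x; rewrite cauchy_op_lin ?(leq_ltn_trans _ ml) //.
    by rewrite !(evB ev_lin, ev_lin); ring.
  rewrite mulrDl [X in bdd _ X]addrC; apply: (bddB ev_lin); last exact: close.
  rewrite mulrDl -mulrA; apply: (bddD ev_lin); last exact: close.
  by apply: (bddZ ev_lin); exact: close.
- have [h1 _ _] := aP w; apply: bdd_le (h1 m).
  rewrite mulrAC; apply: ler_wpM2l; last exact: bnorm_le.
  by rewrite divr_ge0 // exprn_ge0 // divr_ge0 // ltW.
- have [_ h2 _] := aP w; apply: bdd_le (h2 h N hq).
  have -> : 2 * (K * bnorm w) * (4 * cmod h / r) ^+ N = 2 * K * (4 * cmod h / r) ^+ N * bnorm w by ring.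
  apply: ler_wpM2l; last exact: bnorm_le.
  by rewrite !mulr_ge0 ?exprn_ge0 ?divr_ge0 ?mulr_ge0 ?cmod_ge0 // ltW.
Qed.

Variables (nm : E -> R) (kap : R).
Hypotheses (kap0 : 0 < kap) (nm_ev : forall f, bdd f (kap * nm f)) (nm_le : forall f B, bdd f B -> nm f <= B).

Lemma nm_ge0 f : 0 <= nm f.
Proof. by have := bdd_ge0 x0 (nm_ev f); rewrite pmulr_rge0. Qed.

Lemma opnorm_ge0 (T : E -> E) : (0 <= opnorm nm T)%E.
Proof.
apply: le_trans (ereal_sup_ubound _); last first.
  exists 0 => //=; apply: le_trans ler01; apply: nm_le => x.
  by rewrite (ev0f ev_lin) cmod0.
by rewrite lee_fin nm_ge0.
Qed.

Lemma opnorm_le (T : E -> E) (M : R) : 0 <= M -> (forall w B, bdd w B -> bdd (T w) (M * B)) ->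
  (opnorm nm T <= (M * kap)%:E)%E.
Proof.
move=> M0 TM; apply: ge_ereal_sup => _ [w /= w1 <-]; rewrite lee_fin; apply: nm_le.
apply: bdd_le (TM _ _ (nm_ev w)); apply: ler_wpM2l => //.
by rewrite ler_piMr // ltW.
Qed.

Lemma bounded_op_of_bdd (T : E -> E) (M : R) : 0 <= M -> linear T ->
  (forall w B, bdd w B -> bdd (T w) (M * B)) -> bounded_op nm T.
Proof.
move=> M0 Tl TM; split=> //; exists (M * kap) => w; apply: nm_le.
by rewrite -mulrA; exact: TM.
Qed.

Lemma cvge0_squeeze (T : Type) (G : set_system T) {FG : Filter G} (f : T -> \bar R) :
  (forall t, (0 <= f t)%E) ->
  (forall eps : R, 0 < eps -> \forall t \near G, (f t <= eps%:E)%E) -> f t @[t --> G] --> 0%E.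
Proof.
move=> f0 fs; apply/fine_cvgP; split.
  apply: filterS (fs 1 ltr01) => t f1; rewrite fin_numE; apply/andP; split.
    by apply/eqP => fE; have := f0 t; rewrite fE.
  by apply/eqP => fE; rewrite fE in f1.
apply/cvgrPdist_le => eps eps0; apply: filterS (fs eps eps0) => t ft /=.
rewrite sub0r normrN ger0_norm ?fine_ge0 //.
by have := f0 t; case: (f t) ft => [y|//|//] /=; rewrite lee_fin.
Qed.

Lemma op_taylor_analytic : op_analytic_at nm F t0.
Proof.
have [a [a_lin a_bdd a_tail]] := op_taylor.
exists a, (r / 8); split=> // [m|h hr].
  by apply: bounded_op_of_bdd (a_bdd m); rewrite // divr_ge0 // exprn_ge0 // divr_ge0 // ltW.
set q := 4 * cmod h / r.
have q0 : 0 <= q by rewrite divr_ge0 ?mulr_ge0 ?cmod_ge0 // ltW.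
have q2 : q <= 1 / 2 by rewrite ler_pdivrMr //; lra.
have q1 : q < 1 by lra.
apply: cvge0_squeeze; first by move=> N; exact: opnorm_ge0.
move=> eps eps0.
have M0 : 0 <= 2 * K * kap by rewrite !mulr_ge0 // ltW.
have [N NP] := geometric_small M0 q0 q1 eps0.
exists N => // l /= Nl.
have l0 : 0 <= 2 * K * q ^+ l by rewrite !mulr_ge0 // exprn_ge0.
apply: le_trans (opnorm_le l0 (a_tail h l q2)) _; rewrite lee_fin.
by apply: le_trans (NP l Nl); rewrite mulrAC.
Qed.

(** The derivative is the first Taylor coefficient. The remainder of order 2, divided by [h], gives
    [2 K (4 |h| / r) ^ 2 / |h| = 32 K / r ^ 2 |h|]. *)
Lemma op_taylor_derivative : exists D, op_derivative nm F t0 D /\ (opnorm nm D < +oo)%E.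
Proof.
have [a [a_lin a_bdd a_tail]] := op_taylor.
have K4 : 0 <= K / (r / 4) ^+ 1 by rewrite divr_ge0 // exprn_ge0 // divr_ge0 // ltW.
exists (a 1%N); split; last first.
  by apply: le_lt_trans (opnorm_le K4 (a_bdd 1%N)) _; rewrite ltry.
split=> //; apply: cvge0_squeeze; first by move=> h; exact: opnorm_ge0.
move=> eps eps0.
pose M := 32 * K / r ^+ 2 * kap + 1.
have M0 : 0 < M by rewrite ltr_wpDl // mulr_ge0 ?divr_ge0 ?mulr_ge0 ?exprn_ge0 // ltW.
apply/nbhs_C; exists (Num.min (r / 8) (eps / M)); first by rewrite lt_min r80 divr_gt0.
move=> h; rewrite subr0 lt_min => /andP[hr he] h0.
have ch0 : 0 < cmod h by rewrite cmod_gt0.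
have q2 : 4 * cmod h / r <= 1 / 2 by rewrite ler_pdivrMr //; lra.
have a0E w : F t0 w = a 0%N w.
  have z2 : 4 * cmod (0 : C) / r <= 1 / 2 by rewrite cmod0 mulr0 mul0r; lra.
  have := a_tail 0 1%N z2 w _ (bdd_bnorm w).
  rewrite big_ord1 expr0 scale1r addr0 cmod0 mulr0 mul0r expr1 mulr0 mul0r => H.
  apply/eqP; rewrite -subr_eq0; apply/eqP; apply: (bdd_small ev_lin ev_inj) => e' e'0.
  by apply: bdd_le H; exact: ltW.
have MM0 : 0 <= 32 * K / r ^+ 2 * cmod h.
  by rewrite !mulr_ge0 ?invr_ge0 ?exprn_ge0 ?cmod_ge0 // ltW.
apply: (@le_trans _ _ ((32 * K / r ^+ 2 * cmod h * kap)%:E)).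
  apply: opnorm_le => // w B wB.
  have -> : h^-1 *: (F (t0 + h) w - F t0 w) - a 1%N w =
      h^-1 *: (F (t0 + h) w - \sum_(m < 2) h ^+ m *: a m w).
    rewrite big_ord_recl big_ord1 /= expr0 expr1 scale1r -a0E opprD addrA.
    by rewrite [RHS]scalerBr scalerA mulVf // scale1r.
  apply: bdd_le (bddZ ev_lin _ (a_tail h 2%N q2 w B wB)).
  rewrite cmodV le_eqVlt; apply/orP; left; apply/eqP; field.
  by rewrite !gt_eqF.
rewrite lee_fin; apply: (@le_trans _ _ (M * cmod h)).
  rewrite mulrAC; apply: ler_wpM2r; first exact: ltW.
  by rewrite /M lerDl.
by rewrite mulrC -ler_pdivlMr // ltW.
Qed.

End OperatorTaylor.

(** * Neumann series and the spectrum *)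

Section Perturbation.
Variables (R : realType) (E : lmodType (Cx R)) (X : Type) (ev : X -> E -> Cx R).
Variables (x0 : X) (e : E).
Local Notation C := (Cx R).
Hypothesis ev_lin : forall x c f g, ev x (c *: f + g) = c * ev x f + ev x g.
Hypothesis ev_inj : forall f g, (forall x, ev x f = ev x g) -> f = g.
Hypothesis ev_e : forall x, ev x e = 1.
Hypothesis ev_bounded : forall f, exists B, forall x, cmod (ev x f) <= B.
Hypothesis ev_complete : forall u : nat -> E,
  (forall eps : R, 0 < eps -> exists N, forall m l, (N <= m)%N -> (N <= l)%N ->
     bdd ev (u m - u l) eps) ->
  exists f, forall eps : R, 0 < eps -> exists N, forall m, (N <= m)%N -> bdd ev (u m - f) eps.
Local Notation bdd := (bdd ev).
Local Notation osc := (osc ev).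
Variables (nm : E -> R) (kap : R).
Hypotheses (kap0 : 0 < kap) (nm_ev : forall f, bdd f (kap * nm f)) (nm_le : forall f B, bdd f B -> nm f <= B).

Lemma evN x f : ev x (- f) = - ev x f.
Proof. by rewrite -scaleN1r (evZ ev_lin) mulN1r. Qed.

Lemma eq_bdd (f g : E) : (forall eps : R, 0 < eps -> bdd (f - g) eps) -> f = g.
Proof.
by move=> H; apply/eqP; rewrite -subr_eq0; apply/eqP; exact: (bdd_small ev_lin ev_inj).
Qed.

Section Spectrum.
Variables (Q : E -> E) (K g : R).
Hypotheses (Q_lin : linear Q) (K0 : 0 <= K) (g0 : 0 <= g).
Hypothesis Q_pow : forall m w B, bdd w B -> bdd (iter m Q w) (K * B * g ^+ m).

Let QD f h : Q (f + h) = Q f + Q h.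
Proof. by have := Q_lin 1 f h; rewrite !scale1r. Qed.
Let Q0 : Q 0 = 0.
Proof. by apply: (addrI (Q 0)); rewrite -QD !addr0. Qed.
Let QZ c f : Q (c *: f) = c *: Q f.
Proof. by have := Q_lin c f 0; rewrite Q0 !addr0. Qed.
Let QB f h : Q (f - h) = Q f - Q h.
Proof. by rewrite QD -scaleN1r QZ scaleN1r. Qed.

Let Qm_lin m : linear (iter m Q).
Proof. by elim: m => [|m IH] c f h //; rewrite !iterS IH Q_lin. Qed.

(** Only the growth of the powers of [Q] is bounded, with a constant [K] that may exceed 1; this is
    enough for the Neumann series outside the disc of radius [g]. *)
Lemma resolvent (la : C) : g < cmod la -> ~ spectrum nm Q la.
Proof.
move=> gla; apply.
have la0 : 0 < cmod la by apply: le_lt_trans gla.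
have lan0 : la != 0 by rewrite -cmod_gt0.
pose q := g / cmod la.
have q0 : 0 <= q by rewrite divr_ge0 // ltW.
have q1 : q < 1 by rewrite ltr_pdivrMr // mul1r.
have q10 : 0 < 1 - q by rewrite subr_gt0.
pose u w M := \sum_(m < M) (la ^+ m.+1)^-1 *: iter m Q w.
have cm M : cmod (la ^+ M)^-1 * g ^+ M = q ^+ M.
  by rewrite cmodV cmodX expr_div_n mulrC.
pose K1 := K / cmod la.
have K10 : 0 <= K1 by rewrite divr_ge0 // ltW.
have step w B M : bdd w B -> bdd (u w M.+1 - u w M) (K1 * B * q ^+ M).
  move=> wB; rewrite /u big_ord_recr /= addrAC subrr add0r.
  apply: bdd_le (bddZ ev_lin _ (Q_pow M wB)).
  rewrite exprS invfM cmodM cmodV -cm /K1 le_eqVlt; apply/orP; left; apply/eqP; ring.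
have limit w : exists f, forall B M, bdd w B -> bdd (u w M - f) (K1 / (1 - q) * B * q ^+ M).
  have [B0 wB0] := ev_bounded w; have B00 := bdd_ge0 x0 wB0.
  have KB0 : 0 <= K1 * B0 by rewrite mulr_ge0.
  have [f fP] := geometric_limit ev_lin ev_complete KB0 q0 q1 (fun M => step w B0 M wB0).
  exists f => B M wB; have B00' := bdd_ge0 x0 wB.
  have KB : 0 <= K1 * B by rewrite mulr_ge0.
  have [f' fP'] := geometric_limit ev_lin ev_complete KB q0 q1 (fun M => step w B M wB).
  have -> : f = f'.
    apply: eq_bdd => eps eps0.
    have S0 : 0 <= K1 * B0 / (1 - q) + K1 * B / (1 - q) by rewrite addr_ge0 // divr_ge0 // ltW.
    have [N NP] := geometric_small S0 q0 q1 eps0.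
    apply: bdd_le (NP N (leqnn N)) _ => x; rewrite (evB ev_lin) mulrDl.
    apply: le_trans (cmodBD _ (ev x (u w N)) _) _.
    rewrite (cmodB (ev x f)); apply: lerD; first by have := fP N x; rewrite (evB ev_lin).
    by have := fP' N x; rewrite (evB ev_lin).
  by apply: bdd_le (fP' M); rewrite [K1 / (1 - q) * B]mulrAC.
have /choice[S SP] := limit.
have uniq w f T : 0 <= T -> (forall M, bdd (u w M - f) (T * q ^+ M)) -> S w = f.
  move=> T0 fP; have [B wB] := ev_bounded w; have B0 := bdd_ge0 x0 wB.
  apply: eq_bdd => eps eps0.
  have S0 : 0 <= K1 / (1 - q) * B + T.
    by rewrite addr_ge0 // mulr_ge0 // divr_ge0 // ltW.
  have [N NP] := geometric_small S0 q0 q1 eps0.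
  apply: bdd_le (NP N (leqnn N)) _ => x; rewrite (evB ev_lin) mulrDl.
  apply: le_trans (cmodBD _ (ev x (u w N)) _) _.
  rewrite (cmodB (ev x (S w))); apply: lerD; first by have := SP w B N wB x; rewrite (evB ev_lin).
  by have := fP N x; rewrite (evB ev_lin).
have SC0 : 0 <= K1 / (1 - q) by rewrite divr_ge0 // ltW.
(* The telescoped Neumann sum. As [la ^ (- M) Q ^ M w] decays like [q ^ M], both inverse identities
   follow in the limit. *)
have Qu w M : Q (u w M) = la *: u w M - w + (la ^+ M)^-1 *: iter M Q w.
  elim: M => [|M IH].
    by rewrite /u big_ord0 Q0 scaler0 add0r expr0 invr1 scale1r addNr.
  rewrite /u big_ord_recr /= QD -/(u w M) IH QZ scalerDr scalerA.
  have -> : la * (la ^+ M.+1)^-1 = (la ^+ M)^-1 by rewrite exprS; field; rewrite ?expf_neq0 ?lan0.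
  by rewrite [la *: _ - w + _]addrAC.
exists S; split.
- apply: (bounded_op_of_bdd nm_ev nm_le SC0) => [c f h|w B wB].
    have [Bf fB] := ev_bounded f; have [Bh hB] := ev_bounded h.
    have F0 := bdd_ge0 x0 fB; have H0 := bdd_ge0 x0 hB.
    apply: (uniq _ _ (cmod c * (K1 / (1 - q) * Bf) + K1 / (1 - q) * Bh)).
      by apply: addr_ge0; [apply: mulr_ge0; [exact: cmod_ge0|]|]; exact: mulr_ge0.
    move=> M; have -> : u (c *: f + h) M - (c *: S f + S h) = c *: (u f M - S f) + (u h M - S h).
      rewrite scalerBr addrACA -opprD; congr (_ - _).
      rewrite /u scaler_sumr -big_split; apply: eq_bigr => m _ /=.
      by rewrite Qm_lin scalerDr !scalerA [_ * c]mulrC.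
    rewrite mulrDl -[cmod c * _ * _]mulrA; apply: (bddD ev_lin); last exact: SP.
    by apply: (bddZ ev_lin); exact: SP.
  have := SP w B 0%N wB; rewrite /u big_ord0 expr0 mulr1 => H x.
  by have := H x; rewrite (evB ev_lin) (ev0f ev_lin) sub0r cmodN.
- move=> w; have [B wB] := ev_bounded w; have B0 := bdd_ge0 x0 wB.
  apply: (uniq _ _ (K * B)); first by rewrite mulr_ge0.
  move=> M; have -> : u (la *: w - Q w) M - w = - (la ^+ M)^-1 *: iter M Q w.
    rewrite scaleNr.
    have E1 : u (la *: w - Q w) M = la *: u w M - Q (u w M).
      rewrite /u (big_morph Q QD Q0) scaler_sumr -sumrB; apply: eq_bigr => m _.
      have Qm0 : iter m Q 0 = 0 by elim: (nat_of_ord m) => // l IH; rewrite iterS IH Q0.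
      have -> : iter m Q (la *: w - Q w) = la *: iter m Q w - Q (iter m Q w).
        rewrite Qm_lin; congr (_ + _).
        have := Qm_lin m (-1) (Q w) 0; rewrite !addr0 Qm0 addr0 !scaleN1r => ->.
        by rewrite -iterSr iterS.
      by rewrite QZ scalerBr !scalerA [_ * la]mulrC.
    rewrite E1 Qu; set a := la *: u w M; set b := (la ^+ M)^-1 *: _.
    by rewrite opprD opprB addrA [a + _]addrC subrK addrAC subrr add0r.
  apply: bdd_le (bddZ ev_lin _ (Q_pow M wB)).
  by rewrite cmodN -cm le_eqVlt; apply/orP; left; apply/eqP; ring.
- move=> w; have [B wB] := ev_bounded w; have B0 := bdd_ge0 x0 wB.
  apply: eq_bdd => eps eps0.
  pose T := cmod la * (K1 / (1 - q) * B) + K * g * (K1 / (1 - q) * B) + K * B.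
  have T0 : 0 <= T.
    by rewrite /T !addr_ge0 // !mulr_ge0 ?cmod_ge0 ?invr_ge0 // ltW.
  have [N NP] := geometric_small T0 q0 q1 eps0.
  apply: bdd_le (NP N (leqnn N)) _.
  have -> : la *: S w - Q (S w) - w =
     - (la *: (u w N - S w) - Q (u w N - S w)) - (la ^+ N)^-1 *: iter N Q w.
    rewrite QB Qu; set a := la *: u w N; set b := (la ^+ N)^-1 *: _.
    rewrite scalerBr -/a; set c := la *: S w; set d := Q (S w).
    by apply: ev_inj => x; rewrite !(evN, evD ev_lin); ring.
  have uS := SP w B N wB.
  rewrite /T !mulrDl; apply: (bddB ev_lin).
    rewrite -scaleN1r.
    have H : bdd (la *: (u w N - S w) - Q (u w N - S w))
       (cmod la * (K1 / (1 - q) * B * q ^+ N) + K * (K1 / (1 - q) * B * q ^+ N) * g ^+ 1).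
      by apply: (bddB ev_lin); [exact: (bddZ ev_lin)|exact: (Q_pow 1 uS)].
    apply: bdd_le (bddZ ev_lin _ H); rewrite cmodN cmod1.
    by rewrite le_eqVlt; apply/orP; left; apply/eqP; ring.
  apply: bdd_le (bddZ ev_lin _ (Q_pow N wB)).
  by rewrite -cm le_eqVlt; apply/orP; left; apply/eqP; ring.
Qed.

Lemma spectral_radius_le : (spectral_radius nm Q <= g%:E)%E.
Proof.
apply: ge_ereal_sup => _ [la laS <-]; rewrite lee_fin leNgt; apply/negP => gla.
exact: resolvent gla laS.
Qed.

End Spectrum.

End Perturbation.

Section StrictOneVariable.
Variable R : realType.
Local Notation C := (Cx R).
Implicit Types (f g : C -> C) (t : C).

Lemma sdiff1_cst (c t : C) : sdiff1 (fun=> c) t.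
Proof. exact: sdiff_cst. Qed.

Lemma sdiff1_id t : sdiff1 id t.
Proof. exact: (@sdiff_coord _ 1 0). Qed.

Lemma sdiff1M f g t : sdiff1 f t -> sdiff1 g t -> sdiff1 (fun x => f x * g x) t.
Proof. exact: sdiffM. Qed.

Lemma sdiff1B f g t : sdiff1 f t -> sdiff1 g t -> sdiff1 (fun x => f x - g x) t.
Proof. exact: sdiffB. Qed.

Lemma sdiff1X f t m : sdiff1 f t -> sdiff1 (fun x => f x ^+ m) t.
Proof. exact: sdiffX. Qed.

Lemma sdiff1V f t : sdiff1 f t -> f t != 0 -> sdiff1 (fun x => (f x)^-1) t.
Proof. by move=> fd f0; apply: sdiffV fd _; rewrite mxE. Qed.

Lemma sdiff1_near f g t (d : R) : 0 < d ->
  (forall x, cmod (x - t) < d -> f x = g x) -> sdiff1 f t -> sdiff1 g t.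
Proof.
move=> d0 fg; apply: sdiff_near d0 _ => x /(_ 0); rewrite mxE; exact: fg.
Qed.

Lemma taylor_scalar_analytic (g : C -> C) (t0 : C) (r B : R) : 0 < r ->
  (forall t, cmod (t - t0) <= r -> sdiff1 g t) ->
  (forall t, cmod (t - t0) <= r -> cmod (g t) <= B) -> scalar_analytic_at g t0.
Proof.
move=> r0 gd gB; have [A [AB Ag]] := taylor1 r0 gd gB.
exists A, (r / 8); split; first by rewrite divr_gt0.
move=> h hr; apply/cvg_cmodP => eps eps0.
set q := 4 * cmod h / r.
have q0 : 0 <= q by rewrite divr_ge0 ?mulr_ge0 ?cmod_ge0 // ltW.
have q2 : q <= 1 / 2 by rewrite ler_pdivrMr //; lra.
have q1 : q < 1 by lra.
have B0 : 0 <= 2 * B.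
  rewrite mulr_ge0 //; apply: le_trans (AB 0%N); rewrite mulr1; exact: cmod_ge0.
have e20 : 0 < eps / 2 by rewrite divr_gt0.
have [N NP] := geometric_small B0 q0 q1 e20.
exists N => // m /= Nm; rewrite cmodB; apply: le_lt_trans (Ag h m q2) _.
by apply: le_lt_trans (NP m Nm) _; lra.
Qed.

End StrictOneVariable.

(** * The perturbed spectral decomposition *)

Section PerturbationFamily.
Variables (R : realType) (E : lmodType (Cx R)) (X : Type) (ev : X -> E -> Cx R).
Variables (x0 : X) (e : E).
Local Notation C := (Cx R).
Hypothesis ev_lin : forall x c f g, ev x (c *: f + g) = c * ev x f + ev x g.
Hypothesis ev_inj : forall f g, (forall x, ev x f = ev x g) -> f = g.
Hypothesis ev_e : forall x, ev x e = 1.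
Hypothesis ev_bounded : forall f, exists B, forall x, cmod (ev x f) <= B.
Hypothesis ev_complete : forall u : nat -> E,
  (forall eps : R, 0 < eps -> exists N, forall m l, (N <= m)%N -> (N <= l)%N ->
     bdd ev (u m - u l) eps) ->
  exists f, forall eps : R, 0 < eps -> exists N, forall m, (N <= m)%N -> bdd ev (u m - f) eps.
Local Notation bdd := (bdd ev).
Local Notation osc := (osc ev).
Variables (nm : E -> R) (kap : R).
Hypotheses (kap0 : 0 < kap) (nm_ev : forall f, bdd f (kap * nm f)) (nm_le : forall f B, bdd f B -> nm f <= B).
Variables (L : C -> E -> E) (gam : R).
Hypotheses (gam0 : 0 <= gam) (gam1 : gam < 1).
Hypothesis L_lin : forall t, linear (L t).
Hypothesis L0e : L 0 e = e.
Hypothesis L0_osc : forall w d, osc w d -> osc (L 0 w) (gam * d).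
Hypothesis L0_bdd : forall w B, bdd w B -> bdd (L 0 w) B.
Hypothesis L_pert : forall eta : R, 0 < eta -> exists2 d : R, 0 < d &
  forall t, cmod t < d -> forall w B, bdd w B -> bdd (L t w - L 0 w) (eta * B).
(** The argument may vary with [t], so that iterates of [L t] are seen to be holomorphic by
    induction. *)
Hypothesis L_hol : forall (w : C -> E) t, (forall x, sdiff1 (fun t => ev x (w t)) t) ->
  forall x, sdiff1 (fun t => ev x (L t (w t))) t.

Theorem gap_perturbation :
  exists (eps : R) (beta : C -> C) (N Q : C -> E -> E),
    [/\ 0 < eps,
      (forall t, cmod t < eps ->
        [/\ bounded_op nm (L t) /\ bounded_op nm (Q t),
            forall w, L t w = beta t *: N t w + Q t w,
            max_modulus_eigenvalue (L t) (beta t),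
            rank_one_projection nm (N t) /\
            (spectral_radius nm (Q t) < (cmod (beta t))%:E)%E &
            forall w, N t (Q t w) = 0 /\ Q t (N t w) = 0]),
      (forall t, cmod t < eps ->
        [/\ scalar_analytic_at beta t, op_analytic_at nm N t
          & op_analytic_at nm Q t]),
      beta 0 = 1 /\
      (forall w, exists2 c, N 0 w = c *: e &
         forall eta : R, 0 < eta -> exists m, bdd (iter m (L 0) w - c *: e) eta) &
      exists D, op_derivative nm Q 0 D /\ (opnorm nm D < +oo)%E].
Proof.
pose s := 1 - gam; have s0 : 0 < s by rewrite subr_gt0.
have s1 : s <= 1 by rewrite gerBl.
pose rho := s / 64; pose g1 := 1 - s / 2; pose q := 1 - s / 4.
have rho0 : 0 < rho by rewrite divr_gt0.
(* The largest perturbation that the estimates for a fixed operator allow; the radius [dl] in [t]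
   that it determines serves for the whole conclusion. *)
pose eta := s * rho / 8.
have eta0 : 0 < eta by rewrite divr_gt0 // mulr_gt0.
have eta1 : eta <= 1.
  have : s * rho <= 1 * 1 by apply: ler_pM; [exact: ltW|exact: ltW|exact: s1|rewrite /rho; lra].
  rewrite /eta; lra.
have g10 : 0 <= g1 by rewrite /g1; lra.
have g11 : g1 < 1 by rewrite /g1; lra.
have q0 : 0 <= q by rewrite /q; lra.
have q1 : q < 1 by rewrite /q; lra.
have [dl dl0 Lp] := L_pert eta0.
have L_bdd t : cmod t < dl -> forall w B, bdd w B -> bdd (L t w) ((1 + eta) * B).
  move=> td w B wB; have -> : L t w = L 0 w + (L t w - L 0 w) by rewrite addrC subrK.
  by rewrite mulrDl mul1r; apply: (bddD ev_lin); [exact: L0_bdd|exact: Lp].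
have L_osc t : cmod t < dl -> forall w B d, bdd w B -> osc w d -> osc (L t w) (gam * d + 2 * eta * B).
  move=> td w B d wB wd; have -> : L t w = L 0 w + (L t w - L 0 w) by rewrite addrC subrK.
  apply: (oscD ev_lin); first exact: L0_osc.
  by rewrite -mulrA; apply: bdd_osc; exact: Lp.
have L_e t : cmod t < dl -> bdd (L t e - e) eta.
  move=> td; rewrite -[X in _ - X]L0e -[eta]mulr1; apply: Lp => //.
  exact: bdd_e.
have /choice[v vP] : forall t, exists v : E, cmod t < dl ->
   [/\ slice ev x0 gam v, L t v = ev x0 (L t v) *: v &
      forall m, bdd (power_iter ev x0 e (L t) m - v) (2 * rho * (1 + rho) / (1 - g1) * g1 ^+ m)].
  move=> t; have [td|] := pselect (cmod t < dl); last by exists 0.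
  have [v vt] := eigenvector_exists x0 ev_lin ev_inj ev_e ev_complete (L_lin t)
    gam0 gam1 (ltW eta0) (lexx _) (L_osc t td) (L_bdd t td) (L_e t td).
  by exists v.
pose beta t := ev x0 (L t (v t)).
have /choice[phi phiP] : forall t, exists phi : E -> C, cmod t < dl ->
  [/\ forall w B m, bdd w B ->
        cmod (ev x0 (iter m (L t) w) / beta t ^+ m - phi w) <= 32 / s * B * q ^+ m,
      forall c f g, phi (c *: f + g) = c * phi f + phi g,
      phi (v t) = 1,
      forall w, phi (L t w) = beta t * phi w &
      forall w B, bdd w B -> cmod (phi w) <= 33 / s * B].
  move=> t; have [td|] := pselect (cmod t < dl); last by exists (fun=> 0).
  have [sv Lv _] := vP t td.
  have [phi H] := functional_exists ev_lin ev_e ev_bounded (L_lin t)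
    gam0 gam1 (ltW eta0) (lexx _) (L_osc t td) (L_bdd t td) (L_e t td) sv Lv.
  by exists phi.
pose N t w := phi t w *: v t.
pose Q t w := L t w - beta t *: N t w.
have v1 t : cmod t < dl -> ev x0 (v t) = 1 by move=> /vP[[]].
have v2 t : cmod t < dl -> bdd (v t) 2.
  by move=> td; have [sv _ _] := vP t td; exact: (slice_bdd ev_lin ev_e gam0 sv).
have Lv t : cmod t < dl -> L t (v t) = beta t *: v t by move=> /vP[].
have b_near t : cmod t < dl -> cmod (beta t - 1) <= 2 * rho.
  move=> td; have [sv _ _] := vP t td.
  exact: (slice_eig ev_lin ev_e (L_lin t) gam0 gam1 (ltW eta0) (lexx _) (L_bdd t td) (L_e t td) sv).
have b_low t : cmod t < dl -> g1 < cmod (beta t).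
  move=> td; have := b_near t td; have := cmodBD 1 (beta t) 0.
  rewrite !subr0 cmod1 (cmodB 1); rewrite /rho /g1; lra.
have b_up t : cmod t < dl -> cmod (beta t) <= 2.
  move=> td; have := b_near t td; have := cmodBD (beta t) 1 0.
  rewrite !subr0 cmod1 /rho; lra.
have b0 t : cmod t < dl -> beta t != 0.
  by move=> td; rewrite -cmod_gt0; exact: le_lt_trans (b_low t td).
have phi_lin t : cmod t < dl -> forall c f g, phi t (c *: f + g) = c * phi t f + phi t g.
  by move=> /phiP[].
have phi_v t : cmod t < dl -> phi t (v t) = 1 by move=> /phiP[].
have phi_L t : cmod t < dl -> forall w, phi t (L t w) = beta t * phi t w by move=> /phiP[].
have phi_b t : cmod t < dl -> forall w B, bdd w B -> cmod (phi t w) <= 33 / s * B by move=> /phiP[].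
have phiZ t : cmod t < dl -> forall c f, phi t (c *: f) = c * phi t f.
  move=> td c f; have p0 : phi t 0 = 0.
    have := phi_lin t td 1 0 0; rewrite scale1r addr0 mul1r => H.
    by apply: (addrI (phi t 0)); rewrite addr0 -H.
  by rewrite -[c *: f]addr0 phi_lin // p0 addr0.
have phiD t : cmod t < dl -> forall f g, phi t (f + g) = phi t f + phi t g.
  by move=> td f g; rewrite -[f in LHS]scale1r phi_lin // mul1r.
have phiB t : cmod t < dl -> forall f g, phi t (f - g) = phi t f - phi t g.
  by move=> td f g; rewrite phiD // -scaleN1r phiZ // mulN1r.
have LZ t c f : L t (c *: f) = c *: L t f.
  have p0 : L t 0 = 0.
    have := L_lin t 1 0 0; rewrite scale1r addr0 scale1r => H.
    by apply: (addrI (L t 0)); rewrite addr0 -H.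
  by rewrite -[c *: f]addr0 L_lin p0 addr0.
have LB t f g : L t (f - g) = L t f - L t g.
  by rewrite -[in LHS](scaleN1r g) addrC L_lin scaleN1r addrC.
have Q_lin t : cmod t < dl -> linear (Q t).
  move=> td c f g; rewrite /Q /N L_lin phi_lin // scalerDl scalerDr opprD addrACA [in RHS]scalerBr.
  by congr (_ - _ + _); rewrite !scalerA; congr (_ *: _); ring.
have N_lin t : cmod t < dl -> linear (N t).
  by move=> td c f g; rewrite /N phi_lin // scalerDl scalerA.
pose KN := 66 / s; have KN0 : 0 <= KN by rewrite divr_ge0 // ltW.
have N_bdd t : cmod t < dl -> forall w B, bdd w B -> bdd (N t w) (KN * B).
  move=> td w B wB; apply: bdd_le (bddZ ev_lin _ (v2 t td)).
  have := phi_b t td w B wB.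
  have -> : KN * B = 33 / s * B * 2 by rewrite /KN; ring.
  by move=> h; rewrite ler_pM2r.
pose KQ := 2 + 2 * KN; have KQ0 : 0 <= KQ by rewrite addr_ge0 // mulr_ge0.
have Q_bdd t : cmod t < dl -> forall w B, bdd w B -> bdd (Q t w) (KQ * B).
  move=> td w B wB; have B0 := bdd_ge0 x0 wB; rewrite /KQ mulrDl -mulrA; apply: (bddB ev_lin).
    by apply: bdd_le (L_bdd t td w B wB); apply: ler_wpM2r => //; lra.
  apply: bdd_le (bddZ ev_lin _ (N_bdd t td w B wB)).
  by apply: ler_wpM2r; [rewrite mulr_ge0|exact: b_up].
have phiQ t : cmod t < dl -> forall w, phi t (Q t w) = 0.
  move=> td w; rewrite /Q /N phiB // phi_L // scalerA phiZ // phi_v //; ring.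
have Qy t : cmod t < dl -> forall y, phi t y = 0 -> Q t y = L t y.
  by move=> td y y0; rewrite /Q /N y0 scale0r scaler0 subr0.
(* The 1 serves the power 0, which is the identity. For positive powers [Q ^ m w = L ^ m (w - N w)],
   where [w - N w] lies in the kernel of [phi] and is bounded by [(1 + KN) * B]; there
   [kernel_decay] applies. *)
pose CQ := Num.max 1 (201 / s * (1 + KN)).
have CQ1 : 1 <= CQ by rewrite le_max lexx.
have CQ0 : 0 <= CQ by apply: le_trans CQ1.
have Q_pow t : cmod t < dl -> forall m w B, bdd w B -> bdd (iter m (Q t) w) (CQ * B * g1 ^+ m).
  move=> td [|m] w B wB; have B0 := bdd_ge0 x0 wB.
    by rewrite mulr1; apply: bdd_le wB; rewrite ler_peMl.
  pose y := w - N t w.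
  have y0 : phi t y = 0 by rewrite /y /N phiB // phiZ // phi_v // mulr1 subrr.
  have iQ j : iter j.+1 (Q t) w = iter j.+1 (L t) y.
    elim: j => [|j IH].
      by rewrite /= /y LB /N LZ Lv // /Q /N !scalerA mulrC.
    have z0 : phi t (iter j.+1 (L t) y) = 0 by rewrite -IH iterS phiQ.
    by rewrite iterS IH Qy.
  rewrite iQ; have yB : bdd y ((1 + KN) * B).
    by rewrite mulrDl mul1r; apply: (bddB ev_lin) => //; exact: N_bdd.
  have [sv Lvt _] := vP t td.
  have := kernel_decay ev_lin ev_e (L_lin t) gam0 gam1 (lexx _)
    (L_osc t td) (L_bdd t td) sv Lvt m.+1 (phi_lin t td) (phi_v t td) (phi_L t td) (phi_b t td) yB y0.
  apply: bdd_le; apply: ler_wpM2r; first by rewrite exprn_ge0.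
  by rewrite mulrA; apply: ler_wpM2r => //; rewrite le_max lexx orbT.
(* The normalised power iterates are holomorphic by induction through [L_hol], their denominators
   being nonzero on the slice. They converge at a rate independent of [t], so the limit is
   holomorphic. The same scheme serves [phi]. *)
have v_hol t : cmod t < dl -> forall x, sdiff1 (fun t => ev x (v t)) t.
  move=> td x; apply: (@sdiff1_uniform_limit _ 0 dl); last by rewrite /cdisc /= subr0.
  move=> eps eps0.
  have K0 : 0 <= 2 * rho * (1 + rho) / (1 - g1).
    by apply: divr_ge0; [apply: mulr_ge0; lra|rewrite subr_ge0 ltW].
  have [m mP] := geometric_small K0 g10 g11 eps0.
  exists (fun t => ev x (power_iter ev x0 e (L t) m)); split=> u; rewrite /cdisc /= subr0 => ud.
    elim: (m) x => [|l IH] x; first exact: (sdiff1_cst (ev x e)).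
    have hol := L_hol (w := fun t => power_iter ev x0 e (L t) l) IH.
    have sl := power_iter_slice x0 ev_lin ev_e (L_lin u) gam0 gam1 (ltW eta0) (lexx _)
       (L_osc u ud) (L_bdd u ud) (L_e u ud) l.
    have [a0 _] := slice_inv ev_lin ev_e (L_lin u) gam0 gam1 (ltW eta0) (lexx _) (L_bdd u ud) (L_e u ud) sl.
    apply: (sdiff1_near (ltr01)); last exact: sdiff1M (sdiff1V (hol x0) a0) (hol x).
    by move=> z _; rewrite /power_iter iterS /normalize (evZ ev_lin).
  have [_ _ /(_ m x)] := vP u ud; rewrite (evB ev_lin) cmodB => /le_trans; apply.
  exact: mP.
have beta_hol t : cmod t < dl -> sdiff1 beta t by move=> td; exact: L_hol (v_hol t td) x0.
have phi_hol w t : cmod t < dl -> sdiff1 (fun t => phi t w) t.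
  move=> td; apply: (@sdiff1_uniform_limit _ 0 dl); last by rewrite /cdisc /= subr0.
  move=> eps eps0; have [B wB] := ev_bounded w; have B0 := bdd_ge0 x0 wB.
  have K0 : 0 <= 32 / s * B by rewrite mulr_ge0 // divr_ge0 // ltW.
  have [m mP] := geometric_small K0 q0 q1 eps0.
  exists (fun t => ev x0 (iter m (L t) w) / beta t ^+ m); split=> u; rewrite /cdisc /= subr0 => ud.
    apply: sdiff1M; last first.
      by apply: sdiff1V; [exact: sdiff1X (beta_hol u ud)|rewrite expf_neq0 // b0].
    move: (x0); elim: (m) => [|l IH] x; first exact: (sdiff1_cst (ev x w)).
    exact: (L_hol (w := fun t => iter l (L t) w) IH).
  rewrite cmodB; have [/(_ w B m wB) H _ _ _ _] := phiP u ud.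
  by apply: le_trans H _; exact: mP.
have N_hol t : cmod t < dl -> forall w x, sdiff1 (fun t => ev x (N t w)) t.
  move=> td w x; apply: (sdiff1_near ltr01); last exact: sdiff1M (phi_hol w t td) (v_hol t td x).
  by move=> z _; rewrite /N (evZ ev_lin).
have Q_hol t : cmod t < dl -> forall w x, sdiff1 (fun t => ev x (Q t w)) t.
  move=> td w x; have Lh := L_hol (w := fun=> w) (fun y => sdiff1_cst (ev y w) t) x.
  apply: (sdiff1_near ltr01); last exact: sdiff1B Lh (sdiff1M (beta_hol t td) (N_hol t td w x)).
  by move=> z _; rewrite /Q (evB ev_lin) [X in _ = _ - X](evZ ev_lin).
have disc t : cmod t < dl -> exists2 r : R, 0 < r & forall u, cmod (u - t) <= r -> cmod u < dl.
  move=> td; exists ((dl - cmod t) / 2); first by rewrite divr_gt0 // subr_gt0.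
  by move=> u ut; have := cmodBD u t 0; rewrite !subr0; lra.
have d00 : cmod (0 : C) < dl by rewrite cmod0.
have v0 : v 0 = e.
  have [_ _ H] := vP 0 d00.
  have p0 m : power_iter ev x0 e (L 0) m = e.
    by elim: m => // m IH; rewrite /power_iter iterS -/(power_iter _ _ _ _ _) IH /normalize L0e ev_e invr1 scale1r.
  apply/esym; apply: (eq_bdd ev_lin ev_inj) => eps eps0.
  have K0 : 0 <= 2 * rho * (1 + rho) / (1 - g1).
    by apply: divr_ge0; [apply: mulr_ge0; lra|rewrite subr_ge0 ltW].
  have [m mP] := geometric_small K0 g10 g11 eps0.
  by have := H m; rewrite p0; apply: bdd_le; exact: mP.
have beta0 : beta 0 = 1 by rewrite /beta v0 L0e ev_e.
exists dl, beta, N, Q; split=> //.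
- move=> t td; split.
  + split; last exact: (bounded_op_of_bdd nm_ev nm_le KQ0 (Q_lin t td) (Q_bdd t td)).
    have e1 : 0 <= 1 + eta by rewrite addr_ge0 // ltW.
    exact: (bounded_op_of_bdd nm_ev nm_le e1 (L_lin t) (L_bdd t td)).
  + by move=> w; rewrite /Q addrC subrK.
  + have vn0 : v t != 0.
      by apply/eqP => vE; have := v1 t td; rewrite vE (ev0f ev_lin) => /eqP; rewrite eq_sym oner_eq0.
    split; first by exists (v t); split=> //; exact: Lv.
    (* [phi] vanishes on an eigenvector of another eigenvalue [mu], which is thus an eigenvector of
       [Q t] as well, and the resolvent forces [|mu| <= g1 < |beta|]. *)
    move=> mu [w [w0 Lw]] mub.
    have pw : phi t w = 0.
      have := phi_L t td w; rewrite Lw phiZ // => /eqP; rewrite -subr_eq0 -mulrBl mulf_eq0.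
      by rewrite subr_eq0 (negPf mub) => /eqP.
    apply: le_lt_trans (b_low t td); rewrite leNgt; apply/negP => gmu.
    apply: (resolvent x0 ev_lin ev_inj ev_bounded ev_complete nm_ev nm_le (Q_lin t td) CQ0 g10 (Q_pow t td) gmu).
    move=> [S [_ SL _]]; move: w0; have := SL w.
    rewrite Qy // Lw subrr => S0; have := SL 0.
    have Q0 : Q t 0 = 0.
      have p0 : phi t 0 = 0 by have := phiZ t td 0 0; rewrite scale0r mul0r.
      by rewrite Qy //; have := LZ t 0 0; rewrite !scale0r.
    by rewrite scaler0 Q0 subrr -S0 => ->; rewrite eqxx.
  + split.
      split; first exact: (bounded_op_of_bdd nm_ev nm_le KN0 (N_lin t td) (N_bdd t td)).
        by move=> w; rewrite /N phiZ // phi_v // mulr1.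
      exists (v t); split.
        by apply/eqP => vE; have := v1 t td; rewrite vE (ev0f ev_lin) => /eqP; rewrite eq_sym oner_eq0.
      apply/seteqP; split=> [_ [w _ <-]|_ [c _ <-]]; first by exists (phi t w).
      by exists (c *: v t) => //; rewrite /N phiZ // phi_v // mulr1.
    apply: (@le_lt_trans _ _ g1%:E); last by rewrite lte_fin b_low.
    exact: (spectral_radius_le x0 ev_lin ev_inj ev_bounded ev_complete nm_ev nm_le (Q_lin t td) CQ0 g10 (Q_pow t td)).
  + move=> w; split; first by rewrite /N phiQ // scale0r.
    by rewrite /Q /N !phiZ // phi_v // mulr1 LZ Lv // !scalerA mulrC subrr.
- move=> t td; have [r r0 rd] := disc t td; split.
  + apply: (taylor_scalar_analytic r0 (B := 2)) => u /rd ud; [exact: beta_hol|exact: b_up].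
  + apply: (op_taylor_analytic x0 ev_lin ev_inj ev_bounded ev_complete r0 KN0 _ _ _ kap0 nm_ev nm_le) => u /rd ud.
    * exact: N_lin.
    * exact: N_bdd.
    * exact: N_hol.
  + apply: (op_taylor_analytic x0 ev_lin ev_inj ev_bounded ev_complete r0 KQ0 _ _ _ kap0 nm_ev nm_le) => u /rd ud.
    * exact: Q_lin.
    * exact: Q_bdd.
    * exact: Q_hol.
- split=> // w; exists (phi 0 w); first by rewrite /N v0.
  move=> h h0; have [B wB] := ev_bounded w; have B0 := bdd_ge0 x0 wB.
  have K0 : 0 <= 3 * B + 32 / s * B.
    apply: addr_ge0; apply: mulr_ge0 => //.
    by rewrite divr_ge0 // ltW.
  have [m mP] := geometric_small K0 q0 q1 h0; exists m.
  apply: bdd_le (mP m (leqnn m)) _; rewrite mulrDl.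
  have [sv Lvt _] := vP 0 d00.
  have dm := iterL_defect_osc ev_lin (L_lin 0) gam0 gam1 (lexx _)
    (L_osc 0 d00) (L_bdd 0 d00) sv Lvt m wB.
  (* At [t = 0] the eigenvector is [e] and the eigenvalue is 1, so the distance to the limit
     consists of the defect and the error of the coefficient, both geometrically small. *)
  have -> : iter m (L 0) w - phi 0 w *: e =
     defect ev x0 (v 0) (iter m (L 0) w) + (ev x0 (iter m (L 0) w) - phi 0 w) *: e.
    by rewrite /defect v0 scalerBl addrA subrK.
  apply: (bddD ev_lin).
    apply: bdd_le (osc_bdd (defect_ev0 ev_lin sv _) dm).
    rewrite -/s -/g1; apply: ler_wpM2l; first by rewrite mulr_ge0.
    by apply: lerXn2r; rewrite ?nnegrE // /g1 /q; lra.
  have [/(_ w B m wB) H _ _ _ _] := phiP 0 d00.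
  rewrite beta0 expr1n divr1 in H.
  by apply: bdd_le (bddZ ev_lin _ (bdd_e ev_e)); rewrite mulr1.
- have [r r0 rd] := disc 0 d00.
  apply: (op_taylor_derivative x0 ev_lin ev_inj ev_bounded ev_complete r0 KQ0 _ _ _ kap0 nm_ev nm_le) => u /rd ud.
  + exact: Q_lin.
  + exact: Q_bdd.
  + exact: Q_hol.
Qed.

End PerturbationFamily.

(** * The transfer operators *)

Section TransferOperator.
Variables (R : realType) (n k : nat) (U : set 'cV[Cx R]_n).
Variables (M : 'I_k -> 'M[R]_(1 + n)) (p : 'I_k -> 'I_k -> R).
Local Notation C := (Cx R).
Hypotheses (hk : (0 < k)%N) (hMpos : forall j r s, 0 < M j r s).
Hypotheses (hppos : forall i j, 0 < p i j) (hpsum : forall i, \sum_(j < k) p i j = 1).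
Hypothesis hUpos : forall z, U z -> forall i, 0 < reC (z i 0).
Hypotheses (hUbnd : bounded_set U) (hUne : U !=set0) (hUconn : connected U) (hUopen : open U).
Hypothesis hMU : forall j, closure [set proj_act (mxC (M j)) z | z in U] `<=` U.
Hypothesis hell : forall j, in_Ainf U (ell (M j)).
Local Notation Mhat j := (proj_act (mxC (M j))).

Lemma ext_lim_cst (c : C) : ext_lim U (fun=> c).
Proof. by move=> z _; exists c; exact: cvg_cst. Qed.

Lemma ext_limD (f g : 'cV[C]_n -> C) : ext_lim U f -> ext_lim U g -> ext_lim U (fun x => f x + g x).
Proof.
move=> fl gl z Uz; have [a fa] := fl z Uz; have [b gb] := gl z Uz.
by exists (a + b); exact: (cvgD fa gb).
Qed.

Lemma ext_limM (f g : 'cV[C]_n -> C) : ext_lim U f -> ext_lim U g -> ext_lim U (fun x => f x * g x).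
Proof.
move=> fl gl z Uz; have [a fa] := fl z Uz; have [b gb] := gl z Uz.
by exists (a * b); exact: (cvgM fa gb).
Qed.

Lemma ext_lim_sum (I : Type) (s : seq I) (P : pred I) (F : I -> 'cV[C]_n -> C) :
  (forall i, ext_lim U (F i)) -> ext_lim U (fun x => \sum_(i <- s | P i) F i x).
Proof.
move=> Fl; elim: s => [|i s IH].
  by under [fun x => _]funext do rewrite big_nil; exact: ext_lim_cst.
under [fun x => _]funext do rewrite big_cons; case: (P i) => //.
exact: ext_limD.
Qed.

Lemma ext_lim_comp (phi : C -> C) (f : 'cV[C]_n -> C) :
  (forall c, sdiff1 phi c) -> ext_lim U f -> ext_lim U (fun x => phi (f x)).
Proof.
move=> phid fl z Uz; have [c /within_cvgP fc] := fl z Uz; exists (phi c).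
apply/within_cvgP => e e0; have [K K0 [d d0 H]] := sdiff_lip (phid c).
have h0 : 0 < Num.min d (e / K) by rewrite lt_min d0 divr_gt0.
have [d' d'0 H'] := fc _ h0; exists d' => // x Ux zx.
have := H' x Ux zx; rewrite lt_min => /andP[h1 h2].
have := H (const_mx c) (const_mx (f x)); rewrite !mxE => /(_ _ _ (cmod (f x - c))) HH.
apply: le_lt_trans (HH _ _ _) _.
- by move=> i; rewrite !mxE subrr cmod0.
- by move=> i; rewrite !mxE.
- by split=> [|i]; rewrite ?cmod_ge0 // !mxE.
- by rewrite mulrC -ltr_pdivlMr.
Qed.

Lemma sdiff_ext_lim (f : 'cV[C]_n -> C) : (forall z, closure U z -> sdiff f z) -> ext_lim U f.
Proof.
move=> fd z Uz; exists (f z); apply/within_cvgP => e e0.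
have := iffLR (@cvg_cmodP R _ (nbhs z) (nbhs_filter z) f (f z)) (sdiff_continuous (fd z Uz)) e e0.
by move=> /nbhs_cV[d d0 H]; exists d => // x _; exact: H.
Qed.

Lemma closure_Re_ge0 z : closure U z -> forall i, 0 <= reC (z i 0).
Proof.
move=> Uz i; rewrite leNgt; apply/negP => zi.
have : nbhs z (polydisc z (- reC (z i 0))) by apply/nbhs_cV; exists (- reC (z i 0)); rewrite ?oppr_gt0.
move=> /Uz[y [Uy zy]]; have := hUpos Uy i; have := zy i.
by have := reC_le_cmod (y i 0 - z i 0); rewrite reCB; lra.
Qed.

Lemma lin_actE (K : fieldType) (A : 'M[K]_(1 + n)) (z : 'cV[K]_n) r :
  lin_act A z r 0 = A r (lshift n 0) + \sum_(s < n) A r (rshift 1 s) * z s 0.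
Proof.
rewrite /lin_act mxE big_split_ord /= big_ord1; congr (_ + _).
  by rewrite col_mxEu mxE eqxx mulr1.
by apply: eq_bigr => s _; rewrite col_mxEd.
Qed.

Lemma proj_actE (K : fieldType) (A : 'M[K]_(1 + n)) (z : 'cV[K]_n) i :
  proj_act A z i 0 = (lin_act A z 0 0)^-1 * lin_act A z (rshift 1 i) 0.
Proof. by rewrite /proj_act !mxE. Qed.

(** The real part of the first entry is at least the positive entry of the first column, even if the
    real parts of [z] are only nonnegative. So boundary points of [U] are covered. *)
Lemma lin_act_neq0 j (z : 'cV[C]_n) : (forall i, 0 <= reC (z i 0)) -> lin_act (mxC (M j)) z 0 0 != 0.
Proof.
move=> zi; apply/eqP => /(congr1 (@reC R)); rewrite lin_actE reCD reC_sum mxE reC_toC.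
have : 0 < M j 0 (lshift n 0) + \sum_(i < n) reC (mxC (M j) 0 (rshift 1 i) * z i 0).
  apply: ltr_wpDr; last exact: hMpos.
  by apply: sumr_ge0 => i _; rewrite mxE reC_toCM mulr_ge0 // ltW.
by move=> h h'; move: h; rewrite h' ltxx.
Qed.

Lemma sdiff_lin_act j r z : sdiff (fun z => lin_act (mxC (M j)) z r 0) z.
Proof.
pose f (z : 'cV[C]_n) := mxC (M j) r (lshift n 0) + \sum_(s < n) mxC (M j) r (rshift 1 s) * z s 0.
apply: (@sdiff_near _ _ f _ _ _ ltr01) => [x _|]; first by rewrite lin_actE.
by apply: sdiffD; [exact: sdiff_cst|apply: sdiff_sum => s _; exact: sdiffZ (sdiff_coord s z)].
Qed.

Lemma sdiff_proj_act j i (z : 'cV[C]_n) : (forall i, 0 <= reC (z i 0)) -> sdiff (fun z => Mhat j z i 0) z.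
Proof.
move=> zi; apply: (sdiff_near ltr01); last first.
  apply: sdiffM (sdiff_lin_act j (rshift 1 i) z).
  exact: sdiffV (sdiff_lin_act j 0 z) (lin_act_neq0 j zi).
by move=> x _; rewrite proj_actE.
Qed.

(** By continuity a point of the closure is sent into the closure of the image of [U], which lies in
    [U]. Composition with the projective maps thus turns elements of the space into functions that
    are strictly differentiable up to the boundary. *)
Lemma proj_act_closure j z : closure U z -> U (Mhat j z).
Proof.
move=> Uz; apply: (hMU (j := j)) => B /nbhs_cV[d d0 dB].
have zi := closure_Re_ge0 Uz.
have /choice[h hP] : forall i : 'I_n, exists h : R, 0 < h /\
    forall x, polydisc z h x -> cmod (Mhat j x i 0 - Mhat j z i 0) < d.
  move=> i; have := sdiff_continuous (sdiff_proj_act j i zi).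
  move=> /(iffLR (@cvg_cmodP R _ (nbhs z) (nbhs_filter z) _ _))/(_ d d0)/nbhs_cV[h h0 H].
  by exists h.
have [m m0 mh] := finite_lbound (fun i => (hP i).1).
have : nbhs z (polydisc z m) by apply/nbhs_cV; exists m.
move=> /Uz[y [Uy zy]]; exists (Mhat j y); split; first by exists y.
by apply: dB => i; apply: (hP i).2; exact: polydisc_le zy.
Qed.

Lemma proj_act_in j z : U z -> U (Mhat j z).
Proof. by move=> Uz; apply: proj_act_closure; exact: subset_closure. Qed.

Lemma sdiff_pullback j (w : Ainf U) z : closure U z -> sdiff (fun z => w (Mhat j z)) z.
Proof.
move=> Uz; apply: (@sdiff_comp _ n n w (fun z => Mhat j z)).
  by apply: (Ainf_sdiff hUopen); exact: proj_act_closure.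
by move=> i; apply: sdiff_proj_act; exact: closure_Re_ge0.
Qed.

Lemma ell_props j : (forall z, U z -> sdiff (ell (M j)) z) /\ ext_lim U (ell (M j)).
Proof. by have /(in_AinfP hUopen) := hell j. Qed.

Lemma sdiff1Z (c t : C) : sdiff1 (fun x => c * x) t.
Proof. exact: sdiff1M (sdiff1_cst c t) (sdiff1_id t). Qed.

Lemma transfer_exists : exists L : C -> {ffun 'I_k -> Ainf U} -> {ffun 'I_k -> Ainf U},
  forall t, is_transfer_op M p t (L t).
Proof.
have H (t : C) (w : {ffun 'I_k -> Ainf U}) i : exists g : Ainf U, forall z, U z -> g z =
    \sum_(j < k) toC (p i j) * cexp (t * ell (M j) z) * w j (Mhat j z).
  apply: Ainf_build => //.
    move=> z Uz; apply: sdiff_sum => j _; apply: sdiffM.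
      apply: sdiffZ; apply: (@sdiff_comp1 _ _ (fun c => cexp (t * c))).
        by apply: (sdiff1_comp (f := @cexp R)); [exact: sdiff_cexp|exact: sdiff1Z].
      exact: (ell_props j).1.
    by apply: sdiff_pullback; exact: subset_closure.
  apply: ext_lim_sum => j; apply: ext_limM; last first.
    by apply: sdiff_ext_lim => z; exact: sdiff_pullback.
  apply: ext_limM; first exact: ext_lim_cst.
  apply: (ext_lim_comp (phi := fun c => cexp (t * c))); last exact: (ell_props j).2.
  by move=> c; apply: (sdiff1_comp (f := @cexp R)); [exact: sdiff_cexp|exact: sdiff1Z].
have /choice[g gP] : forall a : C * {ffun 'I_k -> Ainf U} * 'I_k, exists g : Ainf U,
    forall z, U z -> g z = \sum_(j < k) toC (p a.2 j) * cexp (a.1.1 * ell (M j) z) * a.1.2 j (Mhat j z).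
  by move=> [[t w] i]; exact: H.
exists (fun t w => [ffun i => g (t, w, i)]) => t w i z Uz.
by rewrite ffunE gP.
Qed.

(** Evaluations run over all components at once, so the oscillation also compares different
    components; its contraction drives the tuple to one common constant. *)
Definition point := ('I_k * {z : 'cV[C]_n | U z})%type.
Definition evp (x : point) (w : {ffun 'I_k -> Ainf U}) : C := w x.1 (sval x.2).
Local Notation E := {ffun 'I_k -> Ainf U}.

Lemma evp_lin x c (f g : E) : evp x (c *: f + g) = c * evp x f + evp x g.
Proof. by rewrite /evp !ffunE. Qed.

Lemma evp_inj (f g : E) : (forall x, evp x f = evp x g) -> f = g.
Proof.
move=> fg; apply/ffunP => i; apply: Ainf_ext => z Uz.
exact: (fg (i, exist _ z Uz)).
Qed.

Lemma evp_bounded (f : E) : exists B, forall x, cmod (evp x f) <= B.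
Proof.
have /choice[B BP] : forall i, exists B : R, 0 < B /\ forall z, U z -> cmod (f i z) <= B.
  by move=> i; have [B B0 fB] := Ainf_bounded hUopen (f i) hUbnd; exists B.
exists (\sum_i B i) => -[i [z Uz]]; rewrite /evp /= (bigD1 i) //=.
apply: le_trans ((BP i).2 z Uz) _; rewrite lerDl.
by apply: sumr_ge0 => j _; rewrite ltW // (BP j).1.
Qed.

Lemma evp_complete (u : nat -> E) :
  (forall eps : R, 0 < eps -> exists N, forall m l, (N <= m)%N -> (N <= l)%N ->
     bdd evp (u m - u l) eps) ->
  exists f, forall eps : R, 0 < eps -> exists N, forall m, (N <= m)%N -> bdd evp (u m - f) eps.
Proof.
move=> cu.
have subE (f g : E) i z : (f - g) i z = f i z - g i z by rewrite !ffunE.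
have /choice[f fP] : forall i, exists f : Ainf U, forall e : R, 0 < e ->
    exists N, forall m, (N <= m)%N -> forall z, U z -> cmod (u m i z - f z) <= e.
  move=> i; apply: (Ainf_complete hUopen (u := fun m => u m i)) => e /cu[N NP].
  exists N => m l Nm Nl z Uz; rewrite -subE; exact: (NP m l Nm Nl (i, exist _ z Uz)).
exists [ffun i => f i] => e e0.
have /choice[N NP] : forall i, exists N, forall m, (N <= m)%N -> forall z, U z -> cmod (u m i z - f i z) <= e.
  by move=> i; exact: fP.
exists (\sum_i N i)%N => m Nm [i [z Uz]]; rewrite /evp /= !ffunE; apply: NP => //.
by apply: leq_trans Nm; rewrite (bigD1 i) //= leq_addr.
Qed.

Lemma one_exists : exists e : E, forall x, evp x e = 1.
Proof.
have [g gP] : exists g : Ainf U, forall z, U z -> g z = 1.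
  by apply: Ainf_build => //; [move=> z _; exact: sdiff_cst|exact: ext_lim_cst].
by exists [ffun=> g] => -[i [z Uz]]; rewrite /evp /= ffunE gP.
Qed.

Section Contraction.
Variable L : C -> E -> E.
Hypothesis hL : forall t, is_transfer_op M p t (L t).

Lemma transfer_lin t : linear (L t).
Proof.
move=> c f g; apply: evp_inj => -[i [z Uz]]; rewrite evp_lin /evp /= !hL //.
rewrite mulr_sumr -big_split; apply: eq_bigr => j _ /=.
by rewrite !ffunE AinfDE AinfZE; ring.
Qed.

Lemma transfer0E w i z : U z -> L 0 w i z = \sum_(j < k) toC (p i j) * w j (Mhat j z).
Proof.
by move=> Uz; rewrite hL //; apply: eq_bigr => j _; rewrite mul0r cexp0 mulr1.
Qed.

Lemma transfer0_one e : (forall x, evp x e = 1) -> L 0 e = e.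
Proof.
move=> e1; apply: evp_inj => -[i [z Uz]]; rewrite e1 /evp /= transfer0E //.
have E1 j : e j (Mhat j z) = 1 by exact: (e1 (j, exist _ _ (proj_act_in j Uz))).
under eq_bigr do rewrite E1 mulr1.
by rewrite -toC_sum hpsum.
Qed.

Lemma transfer0_bdd w B : bdd evp w B -> bdd evp (L 0 w) B.
Proof.
move=> wB [i [z Uz]]; rewrite /evp /= transfer0E //; apply: le_trans (cmod_sum _ _ _) _.
apply: (@le_trans _ _ (\sum_(j < k) p i j * B)); last by rewrite -mulr_suml hpsum mul1r.
apply: ler_sum => j _; rewrite cmodM cmod_toC gtr0_norm // ler_pM2l //.
exact: (wB (j, exist _ _ (proj_act_in j Uz))).
Qed.

Lemma transfer_pert (eta : R) : 0 < eta -> exists2 d : R, 0 < d &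
  forall t, cmod t < d -> forall w B, bdd evp w B -> bdd evp (L t w - L 0 w) (eta * B).
Proof.
move=> eta0; have [d0 d00 H] := cexp_approx (@ltr01 R).
have /choice[B BP] : forall j, exists B : R, 0 < B /\ forall z, U z -> cmod (ell (M j) z) <= B.
  move=> j; have [B B0 H'] := ext_lim_bounded hUbnd (ell_props j).2; by exists B.
pose S := 1 + \sum_j B j.
have S0 : 0 < S by apply: ltr_wpDr => //; apply: sumr_ge0 => j _; rewrite ltW // (BP j).1.
have BS j z : U z -> cmod (ell (M j) z) <= S.
  move=> Uz; apply: le_trans ((BP j).2 z Uz) _; rewrite /S (bigD1 j) //= addrCA lerDl.
  by rewrite addr_ge0 //; apply: sumr_ge0 => i _; rewrite ltW // (BP i).1.
(* [S] bounds all the functions [ell (M j)] on [U], and [|cexp h - 1| <= 2 |h|] for [|h| < d0]. *)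
exists (Num.min (d0 / S) (eta / (2 * S))); first by rewrite lt_min !divr_gt0 // mulr_gt0.
move=> t; rewrite lt_min !ltr_pdivlMr ?mulr_gt0 // => /andP[t1 t2] w D wD [i [z Uz]].
rewrite /evp /= !ffunE AinfDE AinfNE hL // transfer0E // -sumrB.
apply: le_trans (cmod_sum _ _ _) _.
apply: (@le_trans _ _ (\sum_(j < k) p i j * (eta * D))); last by rewrite -mulr_suml hpsum mul1r.
apply: ler_sum => j _; rewrite -mulrBl -[X in _ - X]mulr1 -mulrBr -mulrA cmodM cmod_toC.
rewrite gtr0_norm // ler_pM2l // cmodM; apply: ler_pM; rewrite ?cmod_ge0 //; last first.
  exact: (wD (j, exist _ _ (proj_act_in j Uz))).
set h := t * ell (M j) z.
have hS : cmod h <= cmod t * S by rewrite cmodM ler_wpM2l ?cmod_ge0 ?BS.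
have HH := H h (le_lt_trans hS t1).
have -> : cexp h - 1 = (cexp h - 1 - h) + h by ring.
by apply: le_trans (cmodD _ _) _; lra.
Qed.

Lemma transfer_hol (w : C -> E) t : (forall x, sdiff1 (fun t => evp x (w t)) t) ->
  forall x, sdiff1 (fun t => evp x (L t (w t))) t.
Proof.
move=> wd [i [z Uz]].
apply: (@sdiff1_near R (fun t => \sum_(j < k) toC (p i j) * cexp (t * ell (M j) z) * w t j (Mhat j z)) _ _ _ ltr01); last first.
  apply: (@sdiff_sum _ _ _ (index_enum 'I_k) xpredT
    (fun (j : 'I_k) (y : 'cV[C]_1) => toC (p i j) * cexp (y 0 0 * ell (M j) z) * w (y 0 0) j (Mhat j z))) => j _.
  apply: sdiffM; last exact: (wd (j, exist _ _ (proj_act_in j Uz))).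
  apply: sdiffZ; have h1 := sdiff1M (sdiff1_id t) (sdiff1_cst (ell (M j) z) t).
  exact: (sdiff1_comp (sdiff_cexp _) h1).
by move=> y _; rewrite /evp /= hL.
Qed.

(** Rotating by [th] turns the modulus of a difference of complex values into a difference of real
    parts, to which Harnack's inequality applies. *)
Lemma unimodular_Re (c : C) : exists th : C, cmod th = 1 /\ cmod c = reC (th * c).
Proof.
have [->|c0] := eqVneq c 0; first by exists 1; rewrite cmod1 mulr0 cmod0.
have cc0 : cmod c != 0 by rewrite cmod_eq0.
exists (toC (cmod c) / c); split; last by rewrite divfK.
by rewrite cmodM cmodV cmod_toC ger0_norm ?cmod_ge0 // mulfV.
Qed.

(* Doeblin's argument: Harnack's inequality on the compact sets closure (Mhat j U) provides the
   common lower bound. *)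
Lemma transfer0_osc : exists gam : R, [/\ 0 <= gam, gam < 1 &
  forall w d, osc evp w d -> osc evp (L 0 w) (gam * d)].
Proof.
have [z0 Uz0] := hUne; pose i0 := Ordinal hk.
have [r r0 Ur] := bounded_set_cmod hUbnd.
have /choice[kp kpP] : forall j, exists kp : R, 0 < kp /\
    forall x, closure [set Mhat j z | z in U] x -> forall g, pos_hol U g -> kp * reC (g z0) <= reC (g x).
  move=> j; have cK : compact (closure [set Mhat j z | z in U]).
    apply: (@compact_bounded_closed _ _ _ r); first exact: closed_closure.
    by move=> x /hMU Ux; exact: Ur.
  by have [kp kp0 H] := harnack_compact hUopen hUconn cK (hMU (j := j)) Uz0; exists kp.
have [m m0 mk] := finite_lbound (fun j => (kpP j).1).
have [dl dl0 dlp] := finite_lbound (fun a : 'I_k * 'I_k => hppos a.1 a.2).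
(* Each of the [k] terms has at least the share [dl * m]: the least transition probability times the
   least Harnack constant. The maximum with 0 below makes the rate nonnegative whatever the size of
   [c]. *)
pose c := dl * m * k%:R; have c0 : 0 < c by rewrite !mulr_gt0 // ltr0n.
exists (Num.max 0 (1 - c)); split.
- by rewrite le_max lexx.
- by rewrite gt_max ltr01 /= gtrBl.
move=> w d wd [i [z Uz]] [i' [z' Uz']]; have d0 := osc_ge0 (i0, exist _ _ Uz0) wd.
rewrite -[evp _ _]/(L 0 w i z) -[evp (i', _) _]/(L 0 w i' z').
have [th [th1 ->]] := unimodular_Re (L 0 w i z - L 0 w i' z').
pose F j x := reC (th * w j x).
pose A := [set F x.1 (sval x.2) | x in [set: point]].
have FF j x j' x' : U x -> U x' -> F j x - F j' x' <= d.
  move=> Ux Ux'; rewrite -reCB -mulrBr; apply: le_trans (reC_le_cmod _) _.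
  by rewrite cmodM th1 mul1r; exact: (wd (j, exist _ _ Ux) (j', exist _ _ Ux')).
have A0 : A !=set0 by exists (F i0 z0); exists (i0, exist _ _ Uz0).
have Aub : has_sup A.
  split=> //; exists (F i0 z0 + d) => _ [[j [x Ux]] _ <-] /=.
  by have := FF j x i0 z0 Ux Uz0; lra.
(* All values of [F] lie in the interval from [a] to [b], of length [d]. Harnack's inequality
   applies to [F - a] and to [b - F], and the lower bounds [suma] and [sumb] add up to the gain
   [c * d]. *)
pose b := sup A; pose a := b - d.
have Fb j x : U x -> F j x <= b.
  by move=> Ux; apply: sup_upper_bound => //; exists (j, exist _ _ Ux).
have Fa j x : U x -> a <= F j x.
  move=> Ux; rewrite /a lerBlDr; apply: sup_le_ub => // _ [[j' [x' Ux']] _ <-] /=.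
  by have := FF j' x' j x Ux' Ux; lra.
have reL l y : U y -> reC (th * L 0 w l y) = \sum_(j < k) p l j * F j (Mhat j y).
  move=> Uy; rewrite transfer0E // mulr_sumr reC_sum; apply: eq_bigr => j _.
  by rewrite mulrCA reC_toCM.
have sd j x : U x -> sdiff (fun x => th * w j x) x.
  by move=> Ux; apply: sdiffZ; exact: (Ainf_sdiff hUopen).
have ha j : pos_hol U (fun x => th * w j x - toC a).
  move=> x Ux; split; first by apply: sdiffB (sd j x Ux) (sdiff_cst _ _).
  by rewrite reCB reC_toC subr_ge0; exact: Fa.
have hb j : pos_hol U (fun x => toC b - th * w j x).
  move=> x Ux; split; first by apply: sdiffB (sdiff_cst _ _) (sd j x Ux).
  by rewrite reCB reC_toC subr_ge0; exact: Fb.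
have in_cl j y : U y -> closure [set Mhat j z | z in U] (Mhat j y).
  by move=> Uy; apply: subset_closure; exists y.
have lowa l y j : U y -> dl * m * (F j z0 - a) <= p l j * (F j (Mhat j y) - a).
  move=> Uy; have := (kpP j).2 _ (in_cl j y Uy) _ (ha j); rewrite !reCB !reC_toC -/(F j z0) -/(F j _).
  move=> H; rewrite -mulrA; apply: ler_pM; rewrite ?(ltW dl0) //.
  - by rewrite mulr_ge0 ?(ltW m0) // subr_ge0 Fa.
  - exact: (dlp (l, j)).
  - by apply: le_trans H; apply: ler_wpM2r; rewrite ?mk // subr_ge0 Fa.
have lowb l y j : U y -> dl * m * (b - F j z0) <= p l j * (b - F j (Mhat j y)).
  move=> Uy; have := (kpP j).2 _ (in_cl j y Uy) _ (hb j); rewrite !reCB !reC_toC -/(F j z0) -/(F j _).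
  move=> H; rewrite -mulrA; apply: ler_pM; rewrite ?(ltW dl0) //.
  - by rewrite mulr_ge0 ?(ltW m0) // subr_ge0 Fb.
  - exact: (dlp (l, j)).
  - by apply: le_trans H; apply: ler_wpM2r; rewrite ?mk // subr_ge0 Fb.
have suma : \sum_(j < k) dl * m * (F j z0 - a) <= reC (th * L 0 w i' z') - a.
  rewrite reL // -[X in _ - X]mul1r -(hpsum i') mulr_suml -sumrB; apply: ler_sum => j _.
  by rewrite -mulrBr lowa.
have sumb : \sum_(j < k) dl * m * (b - F j z0) <= b - reC (th * L 0 w i z).
  rewrite reL // -[X in X - _]mul1r -(hpsum i) mulr_suml -sumrB; apply: ler_sum => j _.
  by rewrite -mulrBr lowb.
have tot : \sum_(j < k) dl * m * (F j z0 - a) + \sum_(j < k) dl * m * (b - F j z0) = c * d.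
  rewrite -big_split /= (eq_bigr (fun=> dl * m * d)); last by move=> j _; rewrite /a; ring.
  by rewrite sumr_const card_ord -[_ *+ k]mulr_natr /c; ring.
rewrite mulrBr reCB; apply: (@le_trans _ _ ((1 - c) * d)); last first.
  by apply: ler_wpM2r => //; rewrite le_max lexx orbT.
by rewrite /a in suma tot; lra.
Qed.

End Contraction.
End TransferOperator.

(** * Integration of continuous real functions *)

Section RealClosure.
Variables (R : realType) (n : nat).
Local Notation C := (Cx R).

Lemma nbhs_rV (a : 'cV[R]_n) (P : set 'cV[R]_n) :
  nbhs a P <-> exists2 d : R, 0 < d &
    forall x : 'cV[R]_n, (forall i, `|x i 0 - a i 0| < d) -> P x.
Proof.
split=> [/nbhs_ballP[d /= d0 eP]|[d d0 dP]].
  exists d => // x xa; apply: eP; split => // i j.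
  by rewrite /ball /= ord1 distrC.
apply/nbhs_ballP; exists d => //.
move=> x [_ ax]; apply: dP => i; have := ax i 0.
by rewrite /ball /= distrC.
Qed.

Variables (V : set 'cV[R]_n) (r : R).
Hypothesis Vr : forall x, V x -> forall i, `|x i 0| <= r.

Lemma compact_cube : compact [set x : 'cV[R]_n | forall i, `|x i 0| <= r].
Proof.
have := @rV_compact R n (fun i => `[-r, r]%classic) (fun i => @segment_compact R (-r) r).
move=> /(@continuous_compact _ _ (@trmx R 1 n) _ (continuous_subspaceT (@trmx_continuous R 1 n))).
congr compact; apply/seteqP; split=> [_ [v vr <-] i|z zr] /=.
  by rewrite mxE; have := vr i; rewrite /= in_itv /= ler_norml.
by exists z^T => [i|]; rewrite ?trmxK //= in_itv /= mxE -ler_norml; exact: zr.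
Qed.

Lemma closure_cube x : closure V x -> forall i, `|x i 0| <= r.
Proof.
have cl : closed [set x : 'cV[R]_n | forall i, `|x i 0| <= r].
  exact: compact_closed (@norm_hausdorff _ _) compact_cube.
by move=> /(closure_subset Vr); rewrite -(iffLR (closure_id _) cl).
Qed.

Lemma compact_closure : compact (closure V).
Proof. exact: subclosed_compact (@closed_closure _ V) compact_cube closure_cube. Qed.

Lemma within_continuous_cV (f : 'cV[R]_n -> R) :
  {within closure V, continuous f} <->
  forall x, closure V x -> forall e : R, 0 < e -> exists2 d : R, 0 < d &
    forall y, closure V y -> (forall i, `|y i 0 - x i 0| < d) -> `|f y - f x| < e.
Proof.
split=> [/subspace_continuousP fc x Vx e e0|fc].
  have /cvgrPdist_lt/(_ e e0) := fc x Vx.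
  move=> /(iffLR (@nbhs_rV x _))[d d0 H]; exists d => // y Vy xy.
  by rewrite distrC; exact: H y xy Vy.
apply/subspace_continuousP => x Vx; apply/cvgrPdist_lt => e e0.
have [d d0 H] := fc x Vx e e0.
by apply: (iffRL (@nbhs_rV x _)); exists d => // y xy Vy; rewrite distrC; exact: H.
Qed.

Lemma Cbar_continuous (f : Cbar V) : {within closure V, continuous f}.
Proof. by case: f => f /= /asboolP[]. Qed.

Lemma Cbar_out (f : Cbar V) x : ~ closure V x -> f x = 0.
Proof. by case: f => f /= /asboolP[_]; apply. Qed.

Lemma Cbar_ext (f g : Cbar V) : (forall x, closure V x -> f x = g x) -> f = g.
Proof.
move=> fg; apply: val_inj => /=; apply/funext => x.
by have [/fg//|nV] := pselect (closure V x); rewrite !Cbar_out.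
Qed.

Lemma Cbar_build (f : 'cV[R]_n -> R) : {within closure V, continuous f} ->
  exists g : Cbar V, forall x, closure V x -> g x = f x.
Proof.
move=> fc; pose g x := if `[< closure V x >] then f x else 0.
have gf x : closure V x -> g x = f x by move=> Vx; rewrite /g asboolT.
have gA : g \in Cbar_pred V.
  apply/asboolP; split; last by move=> x nV; rewrite /g asboolF.
  apply/within_continuous_cV => x Vx e e0.
  have [d d0 H] := iffLR (@within_continuous_cV f) fc x Vx e e0.
  by exists d => // y Vy xy; rewrite !gf //; exact: H.
by exists (MkCbar gA).
Qed.

Lemma CbarDE (f g : Cbar V) x : (f + g) x = f x + g x. Proof. by []. Qed.

Lemma CbarZE (c : R) (f : Cbar V) x : (c *: f) x = c * f x. Proof. by []. Qed.

Lemma CbarNE (f : Cbar V) x : (- f) x = - f x.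
Proof. by rewrite -scaleN1r CbarZE mulN1r. Qed.

Lemma Cbar_bounded (f : Cbar V) : exists2 B : R, 0 < B & forall x, closure V x -> `|f x| <= B.
Proof.
have := continuous_compact (@Cbar_continuous f) compact_closure.
move=> /compact_bounded[B [_ HB]]; exists (`|B| + 1); first by rewrite ltr_wpDl.
move=> x Vx; apply: (HB (`|B| + 1)); last by exists x.
by rewrite (le_lt_trans (ler_norm _)) // ltrDl.
Qed.

Lemma Cbar_unif (f : Cbar V) (e : R) : 0 < e -> exists2 d : R, 0 < d &
  forall x y, closure V x -> closure V y -> (forall i, `|y i 0 - x i 0| < d) -> `|f y - f x| < e.
Proof.
move=> e0.
pose P (d : R) (x : 'cV[R]_n) := closure V x ->
  forall y, closure V y -> (forall i, `|y i 0 - x i 0| < d) -> `|f y - f x| < e.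
suff : \forall d \near 0^'+, closure V `<=` P d.
  move=> [d /= d0 H]; exists (d / 2); first by rewrite divr_gt0.
  move=> x y Vx Vy xy; apply: (H (d / 2)) => //=; rewrite ?divr_gt0 //.
  rewrite sub0r normrN gtr0_norm ?divr_gt0 //.
  by rewrite ltr_pdivrMr // mulr_natr mulr2n ltrDl.
apply: (iffLR (compact_near_coveringP _) compact_closure) => z Vz.
have e20 : 0 < e / 2 by rewrite divr_gt0.
have [d d0 H] := iffLR (@within_continuous_cV f) (@Cbar_continuous f) z Vz _ e20.
have d20 : 0 < d / 2 by rewrite divr_gt0.
exists ([set x : 'cV[R]_n | forall i, `|x i 0 - z i 0| < d / 2], [set t : R | 0 < t < d / 2]).
  split; first by apply: (iffRL (@nbhs_rV z _)); exists (d / 2).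
  exists (d / 2) => //= t; rewrite /ball_ /= sub0r normrN => td t0.
  by rewrite t0 -[ltLHS]gtr0_norm.
move=> [x t] [/= zx /andP[t0 td]] Vx y Vy xy.
have h1 : `|f x - f z| < e / 2.
  by apply: H => // i; apply: lt_trans (zx i) _; move: d0 => h; lra.
have h2 : `|f y - f z| < e / 2.
  apply: H => // i; have := ler_distD (x i 0) (y i 0) (z i 0).
  by have := zx i; have := xy i; move: td => h; lra.
by have := ler_distD (f z) (f y) (f x); rewrite [`|f z - _|]distrC; lra.
Qed.

Lemma Cbar_norm_ge (f : Cbar V) x : closure V x -> `|f x| <= Cbar_norm f.
Proof.
move=> Vx; have [B B0 fB] := Cbar_bounded f.
apply: sup_upper_bound; last by exists x.
by split; [exists `|f x|; exists x|exists B => _ [y Vy <-]; exact: fB].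
Qed.

Lemma Cbar_norm_le (f : Cbar V) (B : R) : V !=set0 ->
  (forall x, closure V x -> `|f x| <= B) -> Cbar_norm f <= B.
Proof.
move=> [x0 /subset_closure Vx0] fB; apply: sup_le_ub; first by exists `|f x0|; exists x0.
by move=> _ [z Vz <-]; exact: fB.
Qed.

Lemma Cbar_le_closure (f : Cbar V) (a B : R) :
  (forall x, V x -> `|f x - a| <= B) -> forall x, closure V x -> `|f x - a| <= B.
Proof.
move=> fB x Vx; apply/ler_addgt0Pr => e e0.
have [d d0 H] := iffLR (@within_continuous_cV f) (@Cbar_continuous f) x Vx e e0.
have [y [Vy xy]] := Vx _ (iffRL (@nbhs_rV x _) (ex_intro2 _ _ d d0 (fun y h => h))).
have := H y (subset_closure Vy) xy; have := fB y Vy.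
by have := ler_distD (f y) (f x) a; rewrite [`|f x - f y|]distrC; lra.
Qed.

Section Integration.
Variable mu : probability (borel_cV R n) R.
Hypothesis mu1 : mu (closure V) = 1%E.

Lemma borel_closure : @measurable _ (borel_cV R n) (closure V).
Proof.
rewrite -[closure V]setCK; apply: measurableC; apply: sub_sigma_algebra.
exact/closed_openC/closed_closure.
Qed.

Lemma Cbar_measurable (f : Cbar V) : @measurable_fun _ _ (borel_cV R n) _ (closure V) f.
Proof.
have mK := borel_closure; have /continuousP cf := @Cbar_continuous f.
apply: (measurability _ (measurable_realfun.RGenOpens.measurableE R)).
move=> _ [_ [a [b ->] <-]].
have /open_subspaceP[W oW WE] := cf _ (interval_open (a:=BRight a) (b:=BLeft b) isT isT).
rewrite setIC -WE; apply: measurableI => //; exact: sub_sigma_algebra.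
Qed.

Lemma Cbar_integrable (f : Cbar V) : mu.-integrable (closure V) (EFin \o f).
Proof.
apply: measurable_bounded_integrable; [exact: borel_closure|by have /= -> := mu1; exact: ltry|exact: Cbar_measurable|].
have [B B0 fB] := Cbar_bounded f; exists B; split; first exact: num_real.
by move=> B' BB' x /= Vx; apply: le_trans (fB x Vx) (ltW BB').
Qed.

Lemma integral_near_cst (f : Cbar V) (a B : R) :
  (forall x, closure V x -> `|f x - a| <= B) -> `|\int[mu]_(x in closure V) f x - a| <= B.
Proof.
move=> fB; have mK := borel_closure.
have cst (c : R) : \int[mu]_(x in closure V) c = c.
  by rewrite Rintegral_cst //; have /= -> := mu1; rewrite mulr1.
have icst (c : R) : mu.-integrable (closure V) (EFin \o (fun=> c)).
  exact: finite_measure_integrable_cst.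
have fi := Cbar_integrable f.
rewrite ler_distl; apply/andP; split.
  rewrite -[leLHS]cst; apply: le_Rintegral => // x Vx.
  by have := fB x Vx; rewrite ler_distl => /andP[].
rewrite -[leRHS]cst; apply: le_Rintegral => // x Vx.
by have := fB x Vx; rewrite ler_distl => /andP[].
Qed.

Lemma integral_lin (c : R) (f g : Cbar V) : \int[mu]_(x in closure V) (c *: f + g) x =
  c * (\int[mu]_(x in closure V) f x) + \int[mu]_(x in closure V) g x.
Proof.
rewrite -RintegralZl //; [|exact: borel_closure|exact: Cbar_integrable].
apply: RintegralD; [exact: borel_closure|exact: (Cbar_integrable (c *: f))|exact: Cbar_integrable].
Qed.

End Integration.
End RealClosure.

(** * Density of polynomials *)

Section CoinFlips.
Variables (K : comPzRingType) (J : finType).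

(** The probability of the outcome [om] of independent coins with bias [u]. Over a commutative ring
    it is a polynomial in [u], so the same expression makes sense at real and at complex points. *)
Definition coin_weight (u : J -> K) (om : {ffun J -> bool}) : K :=
  \prod_j (if om j then u j else 1 - u j).

Lemma coin_expect (u : J -> K) (h : J -> bool -> K) :
  \sum_om coin_weight u om * \prod_j h j (om j) =
  \prod_j (u j * h j true + (1 - u j) * h j false).
Proof.
transitivity (\prod_j \sum_b (if b then u j else 1 - u j) * h j b); last first.
  by apply: eq_bigr => j _; rewrite big_bool.
by rewrite bigA_distr_bigA; apply: eq_bigr => om _; rewrite -big_split.
Qed.

Lemma coin_total (u : J -> K) : \sum_om coin_weight u om = 1.
Proof.
have := coin_expect u (fun _ _ => 1); rewrite [RHS]big1 => [<-|j _]; last by ring.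
by apply: eq_bigr => om _; rewrite big1 ?mulr1.
Qed.

Lemma coin_uncorrelated (u : J -> K) (a b : J) : a != b ->
  \sum_om coin_weight u om * (((om a)%:R - u a) * ((om b)%:R - u b)) = 0.
Proof.
move=> ab; pose h j (c : bool) : K := if (j == a) || (j == b) then c%:R - u j else 1.
have ba : b != a by rewrite eq_sym.
have hE (om : {ffun J -> bool}) : ((om a)%:R - u a) * ((om b)%:R - u b) = \prod_j h j (om j).
  rewrite (bigD1 a) //= (bigD1 b) //= big1 => [|j /andP[/negPf ja /negPf jb]].
    by rewrite /h !eqxx orbT mulr1.
  by rewrite /h ja jb.
under eq_bigr do rewrite hE.
by rewrite coin_expect (bigD1 a) //= /h eqxx /=; set A := \prod_(_ | _) _; ring.
Qed.

End CoinFlips.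

Section CoinVariance.
Variables (R : realType) (n N : nat) (v : 'I_n -> R).
Hypothesis v01 : forall i, 0 <= v i <= 1.
Local Notation J := ('I_n * 'I_N)%type.
Local Notation weight := (coin_weight (fun a : J => v a.1)).

Definition heads (om : {ffun J -> bool}) i : R := \sum_s (om (i, s))%:R.

Lemma coin_weight_ge0 om : 0 <= weight om.
Proof. by apply: prodr_ge0 => a _; case: ifP; have /andP[h1 h2] := v01 a.1; rewrite ?subr_ge0. Qed.

(** The cross terms vanish because distinct coins are uncorrelated, and each of the [N] remaining
    squares is at most 1. *)
Lemma coin_variance i : \sum_om weight om * (heads om i - N%:R * v i) ^+ 2 <= N%:R.
Proof.
have dev om : heads om i - N%:R * v i = \sum_s ((om (i, s))%:R - v i).
  by rewrite sumrB sumr_const card_ord mulr_natl.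
have -> : \sum_om weight om * (heads om i - N%:R * v i) ^+ 2 =
    \sum_s \sum_s' \sum_om weight om * (((om (i, s))%:R - v i) * ((om (i, s'))%:R - v i)).
  under eq_bigr => om _ do rewrite dev expr2 mulr_suml mulr_sumr.
  rewrite exchange_big /=; apply: eq_bigr => s _.
  rewrite exchange_big /=; apply: eq_bigr => om _.
  by rewrite !mulr_sumr.
apply: (@le_trans _ _ (\sum_(s < N) 1)); last by rewrite sumr_const card_ord.
apply: ler_sum => s _; rewrite (bigD1 s) //= [X in _ + X]big1 => [|s' s's]; last first.
  apply: (@coin_uncorrelated _ _ (fun a : J => v a.1) (i, s) (i, s')).
  by rewrite xpair_eqE eqxx eq_sym.
rewrite addr0; apply: (@le_trans _ _ (\sum_om weight om)); last by rewrite coin_total.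
apply: ler_sum => om _.
rewrite ler_piMr ?coin_weight_ge0 //; have /andP[h1 h2] := v01 i.
rewrite -expr2 -[leRHS](expr1n _ 2) -[leLHS]real_normK ?num_real // ler_sqr ?nnegrE // ler_norml.
have b0 : 0 <= (om (i, s))%:R :> R by exact: ler0n.
have b1 : (om (i, s))%:R <= 1 :> R by case: (om _).
by apply/andP; split; lra.
Qed.

End CoinVariance.

Section Density.
Variables (R : realType) (n : nat) (V : set 'cV[R]_n) (r : R).
Hypothesis r0 : 0 < r.
Hypothesis Vr : forall x, V x -> forall i, `|x i 0| <= r.
Hypothesis Vpos : forall x, V x -> forall i, 0 < x i 0.

Lemma closure_ge0 x : closure V x -> forall i, 0 <= x i 0.
Proof.
move=> Vx i; rewrite leNgt; apply/negP => xi.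
have : nbhs x [set y : 'cV[R]_n | forall j, `|y j 0 - x j 0| < - x i 0].
  by apply: (iffRL (@nbhs_rV R n x _)); exists (- x i 0); rewrite ?oppr_gt0.
move=> /Vx[y [Vy xy]]; have := Vpos Vy i; have := xy i.
by have := ler_norm (y i 0 - x i 0); lra.
Qed.

(* The multidimensional Bernstein polynomials, with the value of f at a grid point replaced by its
   value at a nearby point of the closure of V. *)
Lemma polynomial_density (f : Cbar V) (e : R) : 0 < e ->
  exists (N : nat) (F : {ffun 'I_n * 'I_N -> bool} -> R),
    forall x, closure V x ->
      `|f x - \sum_om F om * coin_weight (fun a : 'I_n * 'I_N => r^-1 * x a.1 0) om| <= e.
Proof.
move=> e0; have e20 : 0 < e / 2 by rewrite divr_gt0.
have [d d0 fd] := Cbar_unif Vr f e20.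
have [B B0 fB] := Cbar_bounded Vr f.
(* Two points within [c] of the same grid point are within [d] of each other. *)
pose c := d / 2; have c0 : 0 < c by rewrite divr_gt0.
pose D := 2 * B * (r / c) ^+ 2 * n%:R.
have D0 : 0 <= D by rewrite mulr_ge0 // mulr_ge0 ?sqr_ge0 // mulr_ge0 // ltW.
pose N := (Num.trunc (D / (e / 2))).+1.
have N0 : 0 < N%:R :> R by rewrite ltr0n.
have DN : D / N%:R <= e / 2.
  rewrite ler_pdivrMr // mulrC -ler_pdivrMr //; apply: ltW.
  exact: truncnS_gt.
pose J := ('I_n * 'I_N)%type.
pose g (om : {ffun J -> bool}) i := r * (heads R om i / N%:R).
have /choice[F FP] : forall om : {ffun J -> bool}, exists c' : R, `|c'| <= B /\
    forall x, closure V x -> (forall i, `|x i 0 - g om i| < c) -> `|f x - c'| <= e / 2.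
  move=> om; have [[y [Vy yg]]|nex] :=
      pselect (exists y, closure V y /\ forall i, `|y i 0 - g om i| < c).
    exists (f y); split=> [|x Vx xg]; first exact: fB.
    apply: ltW; apply: fd => // i; have := ler_distD (g om i) (x i 0) (y i 0).
    by have := xg i; have := yg i; rewrite [`|g om i - _|]distrC /c; lra.
  exists 0; split=> [|x Vx xg]; first by rewrite normr0 ltW.
  by exfalso; apply: nex; exists x.
exists N, F => x Vx.
pose v i := r^-1 * x i 0.
have v01 i : 0 <= v i <= 1.
  rewrite /v mulr_ge0 ?invr_ge0 ?(ltW r0) ?closure_ge0 //= ler_pdivrMl // mulr1.
  exact: le_trans (ler_norm _) (closure_cube Vr Vx i).
have W0 := coin_weight_ge0 (N := N) v01.
rewrite -[f x]mulr1 -(coin_total (fun a : J => v a.1)) mulr_sumr -sumrB.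
apply: le_trans (ler_norm_sum _ _ _) _.
pose S (om : {ffun J -> bool}) := \sum_i (heads R om i - N%:R * v i) ^+ 2.
have S0 om : 0 <= S om by apply: sumr_ge0 => i _; exact: sqr_ge0.
pose q := 2 * B * (r / c) ^+ 2 / N%:R ^+ 2.
have q0 : 0 <= q by rewrite divr_ge0 ?exprn_ge0 ?(ltW N0) // mulr_ge0 ?sqr_ge0 // mulr_ge0 // ltW.
(* Chebyshev's argument, pointwise: away from the grid point some coordinate deviates by at least
   [c], and the trivial bound [2 * B] is multiplied by the square of deviation over [c]. Averaging
   over [om] then brings in the variance. *)
have key om : `|f x - F om| <= e / 2 + q * S om.
  have [near_om|] := pselect (forall i, `|x i 0 - g om i| < c).
    by apply: le_trans ((FP om).2 x Vx near_om) _; rewrite lerDl mulr_ge0.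
  move=> /existsNP[i /negP]; rewrite -leNgt => ci.
  have h1 : `|f x - F om| <= 2 * B.
    by have := ler_normB (f x) (F om); have := fB x Vx; have := (FP om).1; lra.
  apply: le_trans h1 _; apply: (@le_trans _ _ (q * S om)); last by rewrite lerDr ltW.
  have xg : x i 0 - g om i = - (r / N%:R) * (heads R om i - N%:R * v i).
    by rewrite /g /v; field; rewrite !gt_eqF.
  have : c ^+ 2 <= (r / N%:R) ^+ 2 * (heads R om i - N%:R * v i) ^+ 2.
    have : c ^+ 2 <= `|x i 0 - g om i| ^+ 2 by rewrite ler_sqr ?nnegrE ?(ltW c0).
    by rewrite real_normK ?num_real // xg [(- _ * _) ^+ 2]exprMn sqrrN.
  have : (heads R om i - N%:R * v i) ^+ 2 <= S om.
    by rewrite /S (bigD1 i) //= lerDl; apply: sumr_ge0 => j _; exact: sqr_ge0.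
  set s := _ ^+ 2; set s' := S om => h2 h3.
  have h4 : c ^+ 2 <= (r / N%:R) ^+ 2 * s'.
    by apply: le_trans h3 _; apply: ler_wpM2l => //; exact: sqr_ge0.
  have -> : q * s' = 2 * B * ((r / N%:R) ^+ 2 * s' / c ^+ 2).
    by rewrite /q; field; rewrite !gt_eqF.
  by rewrite ler_peMr ?mulr_ge0 ?(ltW B0) // ler_pdivlMr ?mul1r // exprn_gt0.
apply: (@le_trans _ _ (\sum_om coin_weight (fun a : J => v a.1) om * (e / 2 + q * S om))).
  apply: ler_sum => om _; rewrite -mulrBl normrM mulrC.
  by rewrite ger0_norm ?W0 //; apply: ler_wpM2l; [exact: W0|exact: key].
under eq_bigr do rewrite mulrDr.
rewrite big_split /= -mulr_suml coin_total mul1r.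
have var : \sum_om coin_weight (fun a : J => v a.1) om * (q * S om) <= q * (n%:R * N%:R).
  under eq_bigr do rewrite mulrCA.
  rewrite -mulr_sumr; apply: ler_wpM2l => //.
  under eq_bigr do rewrite mulr_sumr.
  rewrite exchange_big /=; apply: (@le_trans _ _ (\sum_(i < n) N%:R)).
    by apply: ler_sum => i _; exact: coin_variance.
  by rewrite sumr_const card_ord mulr_natl.
have qE : q * (n%:R * N%:R) = D / N%:R.
  by rewrite /q /D; field; rewrite !gt_eqF.
by rewrite [leRHS](splitr e); apply: lerD => //; apply: le_trans var _; rewrite qE.
Qed.

End Density.

(** * Restriction to real points *)

Section RealTrace.
Variables (R : realType) (n : nat) (V : set 'cV[R]_n).
Local Notation C := (Cx R).

Lemma toC_coin_weight (J : finType) (u : J -> R) om :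
  toC (coin_weight u om) = coin_weight (fun j => toC (u j)) om.
Proof.
rewrite /coin_weight (big_morph _ (@toCM R) (@toC1 R)).
by apply: eq_bigr => j _; case: (om j); rewrite ?toCB.
Qed.

Lemma sdiff_trace (h : 'cV[C]_n -> C) (g : 'cV[R]_n -> R) x : sdiff h (mxC x) ->
  (forall y, h (mxC y) = toC (g y)) -> forall e : R, 0 < e -> exists2 d : R, 0 < d &
    forall y : 'cV[R]_n, (forall i, `|y i 0 - x i 0| < d) -> `|g y - g x| < e.
Proof.
move=> hd hg e e0.
have := iffLR (@cvg_cmodP R _ (nbhs (mxC x)) (nbhs_filter (mxC x)) h (h (mxC x))) (sdiff_continuous hd) e e0.
move=> /nbhs_cV[d d0 H]; exists d => // y xy.
have := H (mxC y); rewrite !hg -toCB cmod_toC; apply=> i.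
by rewrite !mxE -toCB cmod_toC.
Qed.

Lemma proj_act_mxC (A : 'M[R]_(1 + n)) x : proj_act (mxC A) (mxC x) = mxC (proj_act A x).
Proof.
have linC r : lin_act (mxC A) (mxC x) r 0 = toC (lin_act A x r 0).
  rewrite !lin_actE toCD toC_sum mxE; congr (_ + _).
  by apply: eq_bigr => s _; rewrite !mxE toCM.
apply/colP => i; rewrite [RHS]mxE !proj_actE !linC toCM; congr (_ * _).
by rewrite /toC fmorphV.
Qed.

Variable r : R.
Hypotheses (r0 : 0 < r) (Vr : forall x, V x -> forall i, `|x i 0| <= r).
Hypothesis Vpos : forall x, V x -> forall i, 0 < x i 0.

(** The approximating polynomial, read at complex points, is strictly differentiable everywhere.
    Hence it has limits at the boundary of [U] and belongs to the analytic space. *)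
Lemma Ainf_density (U : set 'cV[C]_n) (f : Cbar V) (e : R) : open U ->
  (forall x, V x -> U (mxC x)) -> 0 < e ->
  exists (w : Ainf U) (g : Cbar V), (forall x, V x -> w (mxC x) = toC (g x)) /\
    forall x, closure V x -> `|f x - g x| <= e.
Proof.
move=> oU VU e0; have [N [F FP]] := polynomial_density r0 Vr Vpos f e0.
pose P (x : 'cV[R]_n) := \sum_om F om * coin_weight (fun a : 'I_n * 'I_N => r^-1 * x a.1 0) om.
pose Pz (z : 'cV[C]_n) := \sum_om toC (F om) * coin_weight (fun a : 'I_n * 'I_N => toC r^-1 * z a.1 0) om.
have PPz y : Pz (mxC y) = toC (P y).
  rewrite toC_sum; apply: eq_bigr => om _; rewrite toCM toC_coin_weight.
  by congr (_ * coin_weight _ _); apply/funext => a; rewrite mxE toCM.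
have Pd z : sdiff Pz z.
  apply: sdiff_sum => om _; apply: sdiffZ; apply: sdiff_prod => a _.
  case: (om a); first exact: sdiffZ (sdiff_coord _ _).
  exact: sdiffB (sdiff_cst _ _) (sdiffZ _ (sdiff_coord _ _)).
have [w wP] := Ainf_build oU (fun z _ => Pd z) (sdiff_ext_lim (fun z _ => Pd z)).
have [g gP] : exists g : Cbar V, forall x, closure V x -> g x = P x.
  apply: Cbar_build; apply: (iffRL (@within_continuous_cV R n V P)) => x Vx d d0.
  by have [h h0 H] := sdiff_trace (Pd (mxC x)) PPz d0; exists h => // y _; exact: H.
exists w, g; split=> x Vx; first by rewrite wP ?PPz ?gP //; [exact: subset_closure|exact: VU].
by rewrite gP //; exact: FP.
Qed.

Variables (k : nat) (M : 'I_k -> 'M[R]_(1 + n)) (p : 'I_k -> 'I_k -> R).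
Hypothesis hMpos : forall j r s, 0 < M j r s.
Hypothesis hMV : forall j, closure [set proj_act (M j) x | x in V] `<=` V.

Lemma proj_act_near j x (e : R) : closure V x -> 0 < e -> exists2 d : R, 0 < d &
  forall y : 'cV[R]_n, (forall i, `|y i 0 - x i 0| < d) ->
    forall i, `|proj_act (M j) y i 0 - proj_act (M j) x i 0| < e.
Proof.
move=> Vx e0; have x0 i : 0 <= reC ((mxC x) i 0) by rewrite mxE reC_toC; exact: (closure_ge0 Vpos).
have /choice[h hP] : forall i : 'I_n, exists h : R, 0 < h /\
    forall y : 'cV[R]_n, (forall i, `|y i 0 - x i 0| < h) -> `|proj_act (M j) y i 0 - proj_act (M j) x i 0| < e.
  move=> i; have [y|h h0 H] := sdiff_trace (g := fun y => proj_act (M j) y i 0)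
    (sdiff_proj_act hMpos j i x0) _ e0; first by rewrite proj_act_mxC mxE.
  by exists h.
have [m m0 mh] := finite_lbound (fun i => (hP i).1).
by exists m => // y xy i; apply: (hP i).2 => l; exact: lt_le_trans (xy l) (mh i).
Qed.

Lemma proj_act_closure_real j x : closure V x -> V (proj_act (M j) x).
Proof.
move=> Vx; apply: (hMV (j := j)) => B /(iffLR (@nbhs_rV R n _ B))[d d0 dB].
have [h h0 H] := proj_act_near j Vx d0.
have [y [Vy xy]] := Vx _ (iffRL (@nbhs_rV R n x _) (ex_intro2 _ _ h h0 (fun y H => H))).
by exists (proj_act (M j) y); split; [exists y|apply: dB; exact: H].
Qed.

(** The projective maps are continuous on the closure of [V] with values in [V], so [real_transfer0]
    stays within the continuous functions and can be iterated. *)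
Lemma real_transfer0_exists (f : {ffun 'I_k -> Cbar V}) : exists g : {ffun 'I_k -> Cbar V},
  forall i x, closure V x -> g i x = real_transfer0 M p f i x.
Proof.
have fM j : exists g : Cbar V, forall x, closure V x -> g x = f j (proj_act (M j) x).
  apply: Cbar_build.
  apply: (iffRL (@within_continuous_cV R n V (fun x => f j (proj_act (M j) x)))) => x Vx e e0.
  have Vpx : closure V (proj_act (M j) x) by apply/subset_closure/proj_act_closure_real.
  have [d d0 H] := iffLR (@within_continuous_cV R n V (f j)) (@Cbar_continuous R n V (f j)) _ Vpx e e0.
  have [h h0 H'] := proj_act_near j Vx d0; exists h => // y Vy xy.
  by apply: H; [apply/subset_closure/proj_act_closure_real|exact: H'].
have /choice[g gP] := fM.
exists [ffun i => \sum_j p i j *: g j] => i x Vx; rewrite ffunE.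
transitivity (\sum_j (p i j *: g j) x).
  by elim/big_ind2: _ => // u a v b <- <-.
by apply: eq_bigr => j _; rewrite -gP.
Qed.

End RealTrace.

(** * The invariant integral and the limit of the iterates *)

Section InvariantIntegral.
Variables (R : realType) (n k : nat) (U : set 'cV[Cx R]_n) (V : set 'cV[R]_n).
Variables (M : 'I_k -> 'M[R]_(1 + n)) (p : 'I_k -> 'I_k -> R) (q : 'I_k -> R).
Variables (nu : 'I_k -> probability (borel_cV R n) R) (r : R).
Hypotheses (hq : forall i, 0 <= q i) (hqsum : \sum_(i < k) q i = 1).
Hypotheses (r0 : 0 < r) (Vr : forall x, V x -> forall i, `|x i 0| <= r).
Hypothesis hnusupp : forall i, nu i (closure V) = 1%E.
Local Notation I f := (sum_integral V q nu (fun i x => f i x)).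
Local Notation Cb := {ffun 'I_k -> Cbar V}.

Lemma sum_integral_lin (c : R) (f g : Cb) : I (c *: f + g) = c * I f + I g.
Proof.
rewrite /sum_integral mulr_sumr -big_split; apply: eq_bigr => i _ /=.
have -> : (fun x => (c *: f + g) i x) = (c *: f i + g i : Cbar V).
  by apply/funext => x; rewrite !ffunE.
by rewrite (integral_lin Vr (hnusupp i)); ring.
Qed.

Lemma sum_integral_near_cst (f : Cb) (a B : R) :
  (forall i x, closure V x -> `|f i x - a| <= B) -> `|I f - a| <= B.
Proof.
move=> fB; have -> : I f - a = \sum_i q i * (\int[nu i]_(x in closure V) f i x - a).
  rewrite -[a in LHS]mul1r -hqsum mulr_suml -sumrB.
  by apply: eq_bigr => i _; rewrite mulrBr.
apply: le_trans (ler_norm_sum _ _ _) _; rewrite -[leRHS]mul1r -hqsum mulr_suml.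
apply: ler_sum => i _; rewrite normrM ger0_norm //; apply: ler_wpM2l => //.
by apply: (integral_near_cst Vr (hnusupp i)) => x; exact: fB.
Qed.

Lemma sum_integral_norm_le (f : Cb) : `|I f| <= sum_norm q (@Cbar_norm R n V) f.
Proof.
apply: le_trans (ler_norm_sum _ _ _) _; apply: ler_sum => i _.
rewrite normrM ger0_norm //; apply: ler_wpM2l => //.
have := integral_near_cst Vr (hnusupp i) (f := f i) (a := 0) (B := Cbar_norm (f i)).
by rewrite subr0; apply=> x Vx; rewrite subr0; exact: (Cbar_norm_ge Vr).
Qed.

Hypothesis Vpos : forall x, V x -> forall i, 0 < x i 0.
Hypotheses (hMpos : forall j r s, 0 < M j r s).
Hypothesis hMV : forall j, closure [set proj_act (M j) x | x in V] `<=` V.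
Hypothesis hVU : forall x, V x -> U (mxC x).
Hypothesis hnuinv : forall f : Cb, sum_integral V q nu (real_transfer0 M p f) = I f.
Variable L : Cx R -> {ffun 'I_k -> Ainf U} -> {ffun 'I_k -> Ainf U}.
Hypothesis hL : forall t, is_transfer_op M p t (L t).

(** The invariance of [nu] is carried along the iteration: the iterates stay real on real points and
    keep their integral. *)
Lemma real_iterates (w : {ffun 'I_k -> Ainf U}) (f : Cb) m :
  (forall i x, V x -> w i (mxC x) = toC (f i x)) ->
  exists g : Cb, (forall i x, V x -> iter m (L 0) w i (mxC x) = toC (g i x)) /\ I g = I f.
Proof.
move=> wf; elim: m => [|m [g [gw gI]]]; first by exists f.
have [h hP] := real_transfer0_exists Vpos p hMpos hMV g; exists h; split.
  move=> i x Vx; rewrite iterS (transfer0E hL _ _ (hVU Vx)) hP; last exact: subset_closure.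
  rewrite toC_sum; apply: eq_bigr => j _; rewrite toCM proj_act_mxC gw //.
  by apply: (proj_act_closure_real Vpos hMpos hMV); exact: subset_closure.
rewrite -gI -(hnuinv g); apply: eq_bigr => i _; congr (_ * _); apply: eq_Rintegral => x.
by rewrite inE => Vx; exact: hP.
Qed.

(** An iterate close to the constant [c] is real on [V], so [c] is close to a real value and the
    integral of the iterate, equal to that of [f], is close to [reC c]. The three thirds of [eta]
    lead from [c] to a value, from there to [reC c], and on to the integral. *)
Lemma limit_sum_integral (w : {ffun 'I_k -> Ainf U}) (f : Cb) (e : {ffun 'I_k -> Ainf U}) (c : Cx R) :
  (0 < k)%N -> V !=set0 -> (forall x, evp x e = 1) ->
  (forall i x, V x -> w i (mxC x) = toC (f i x)) ->
  (forall eta : R, 0 < eta -> exists m, bdd (@evp R n k U) (iter m (L 0) w - c *: e) eta) ->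
  c = toC (I f).
Proof.
move=> k0 [x0 Vx0] e1 wf cP; pose i0 := Ordinal k0.
apply/eqP; rewrite -subr_eq0 -cmod_eq0 eq_le cmod_ge0 andbT.
apply/ler_addgt0Pr => eta eta0; rewrite add0r.
have e30 : 0 < eta / 3 by rewrite divr_gt0.
have [m mP] := cP _ e30; have [g [gw gI]] := real_iterates m wf.
have gc i x : V x -> cmod (toC (g i x) - c) <= eta / 3.
  move=> Vx; have := mP (i, exist _ _ (hVU Vx)).
  have -> : iter m (L 0) w - c *: e = (- c) *: e + iter m (L 0) w by rewrite scaleNr addrC.
  by rewrite evp_lin e1 mulr1 addrC /evp /= gw.
have gre i x : V x -> `|g i x - reC c| <= eta / 3.
  by move=> Vx; apply: le_trans (gc i x Vx); rewrite -[g i x]reC_toC -reCB; exact: reC_le.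
have Ic : `|I g - reC c| <= eta / 3.
  by apply: sum_integral_near_cst => i; apply: Cbar_le_closure; exact: gre.
rewrite -gI; apply: le_trans (cmodBD c (toC (g i0 x0)) (toC (I g))) _.
rewrite (cmodB c) -toCB cmod_toC; have := gc i0 x0 Vx0; have := gre i0 x0 Vx0.
by have := ler_distD (reC c) (g i0 x0) (I g); rewrite [`|reC c - _|]distrC; move: Ic; lra.
Qed.

End InvariantIntegral.

(** * The induced operator *)

Section InducedOperator.
Variables (R : realType) (n k : nat) (U : set 'cV[Cx R]_n) (V : set 'cV[R]_n).
Variables (q : 'I_k -> R) (r : R).
Hypotheses (hq : forall i, 0 < q i) (hqsum : \sum_(i < k) q i = 1).
Hypotheses (r0 : 0 < r) (Vr : forall x, V x -> forall i, `|x i 0| <= r).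
Hypothesis Vpos : forall x, V x -> forall i, 0 < x i 0.
Hypotheses (oU : open U) (V0 : V !=set0) (hVU : forall x, V x -> U (mxC x)).
Local Notation Cb := {ffun 'I_k -> Cbar V}.
Local Notation nmC := (sum_norm q (@Cbar_norm R n V)).

Lemma sum_Cbar_norm_le (f : Cb) (B : R) :
  (forall i x, closure V x -> `|f i x| <= B) -> nmC f <= B.
Proof.
move=> fB; rewrite -[leRHS]mul1r -hqsum mulr_suml; apply: ler_sum => i _.
by apply: ler_wpM2l; [exact: ltW|apply: Cbar_norm_le => //; exact: fB].
Qed.

Lemma sum_Cbar_norm_ge (f : Cb) i x : closure V x -> q i * `|f i x| <= nmC f.
Proof.
have nm0 j : 0 <= Cbar_norm (f j).
  have [y /subset_closure Vy] := V0.
  exact: le_trans (normr_ge0 _) (Cbar_norm_ge Vr (f j) Vy).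
move=> Vx; rewrite /sum_norm (bigD1 i) //=; apply: ler_wpDr.
  by apply: sumr_ge0 => j _; rewrite mulr_ge0 // ltW.
by rewrite ler_pM2l //; exact: (Cbar_norm_ge Vr).
Qed.

(* Functions with an analytic extension to U are dense, and on them the two operators agree. *)
Lemma induced_op_unique (N : {ffun 'I_k -> Ainf U} -> {ffun 'I_k -> Ainf U}) (S T : Cb -> Cb) :
  induced_op q N S -> induced_op q N T -> S = T.
Proof.
move=> [[Slin [a Sa]] SN] [[Tlin [b Tb]] TN]; apply/funext => f; apply/ffunP => i.
apply: Cbar_ext => x Vx; apply/eqP; rewrite -subr_eq0 -normr_eq0 eq_le normr_ge0 andbT.
apply/ler_addgt0Pr => e e0; rewrite add0r.
(* The two operator bounds are for the weighted norm; dividing by [q i] turns them into bounds for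
   the value of component [i]. The 1 keeps [c] positive. *)
pose c := (`|a| + `|b| + 1) / q i.
have ab0 : 0 < `|a| + `|b| + 1 by rewrite ltr_wpDl // addr_ge0.
have c0 : 0 < c by rewrite divr_gt0.
have d0 : 0 < e / c by rewrite divr_gt0.
have /choice[wg wgP] := fun j => Ainf_density r0 Vr Vpos (f j) oU hVU d0.
have /choice[g gP] := wgP.
pose w : {ffun 'I_k -> Ainf U} := [ffun j => wg j]; pose h : Cb := [ffun j => g j].
have wh j y : V y -> w j (mxC y) = toC (h j y) by move=> Vy; rewrite !ffunE (gP j).1.
have STh : S h i x = T h i x.
  have SV y : V y -> `|(S h i - T h i : Cbar V) y - 0| <= 0.
    move=> Vy; rewrite subr0 CbarDE CbarNE.
    have -> : S h i y = T h i y by apply: toC_inj; rewrite -(SN w h wh) // -(TN w h wh).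
    by rewrite subrr normr0.
  apply/eqP; rewrite -subr_eq0 -normr_le0.
  by have := Cbar_le_closure SV Vx; rewrite subr0 CbarDE CbarNE.
have fh : nmC (f - h) <= e / c.
  by apply: sum_Cbar_norm_le => j y Vy; rewrite !ffunE CbarDE CbarNE (gP j).2.
have fh0 : 0 <= nmC (f - h).
  by apply: le_trans (sum_Cbar_norm_ge (f - h) i Vx); rewrite mulr_ge0 // ltW.
have split_at (T' : Cb -> Cb) : linear T' -> T' f i x = T' (f - h) i x + T' h i x.
  by move=> lin; have := lin 1 (f - h) h; rewrite !scale1r subrK => ->; rewrite ffunE CbarDE.
rewrite (split_at S Slin) (split_at T Tlin) STh opprD addrACA subrr addr0.
have hS := le_trans (sum_Cbar_norm_ge (S (f - h)) i Vx) (Sa (f - h)).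
have hT := le_trans (sum_Cbar_norm_ge (T (f - h)) i Vx) (Tb (f - h)).
rewrite -(ler_pM2l (hq i)); apply: (@le_trans _ _ ((`|a| + `|b|) * nmC (f - h))).
  apply: (@le_trans _ _ (q i * (`|S (f - h) i x| + `|T (f - h) i x|))).
    by rewrite ler_pM2l //; exact: ler_normB.
  rewrite mulrDr mulrDl; apply: lerD; [apply: le_trans hS _|apply: le_trans hT _];
  by apply: ler_wpM2r => //; exact: ler_norm.
apply: (@le_trans _ _ ((`|a| + `|b| + 1) * (e / c))).
  by apply: ler_pM => //; rewrite ?addr_ge0 ?lerDl.
by rewrite /c le_eqVlt; apply/orP; left; apply/eqP; field; rewrite !gt_eqF.
Qed.

End InducedOperator.

Theorem theorem4p3 (R : realType) (n k : nat) (hn : (0 < n)%N) (hk : (0 < k)%N)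
  (M : 'I_k -> 'M[R]_(1 + n)) (p : 'I_k -> 'I_k -> R) (q : 'I_k -> R)
  (U : set 'cV[Cx R]_n) (V : set 'cV[R]_n)
  (nu : 'I_k -> probability (borel_cV R n) R)
  (hMinv : forall j, M j \in unitmx)
  (hMpos : forall j r s, 0 < M j r s)
  (hppos : forall i j, 0 < p i j)
  (hpsum : forall i, \sum_(j < k) p i j = 1)
  (hqpos : forall i, 0 <= q i)
  (hqsum : \sum_(i < k) q i = 1)
  (hqstat : forall j, \sum_(i < k) q i * p i j = q j)
  (hUpos : forall z, U z -> forall i, 0 < reC (z i 0))
  (hUbnd : bounded_set U)
  (hUne : U !=set0)
  (hUconn : connected U)
  (hUopen : open U)
  (hV : V = [set mxRe z | z in U])
  (hVpos : forall x, V x -> forall i, 0 < x i 0)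
  (hVconn : connected V)
  (hVopen : open V)
  (hVU : forall x, V x -> U (mxC x))
  (hMU : forall j, closure [set proj_act (mxC (M j)) z | z in U] `<=` U)
  (hMUan : forall j i, analytic_on U (fun z => proj_act (mxC (M j)) z i 0))
  (hMV : forall j, closure [set proj_act (M j) x | x in V] `<=` V)
  (hMVan : forall j i, analytic_on V (fun x => proj_act (M j) x i 0))
  (hsq : forall j z, U z -> forall x : R, x <= 0 -> sum_squares (M j) z != toC x)
  (hell : forall j, in_Ainf U (ell (M j)))
  (hnusupp : forall i, nu i (closure V) = 1%E)
  (hnuinv : forall f : {ffun 'I_k -> Cbar V},
    sum_integral V q nu (real_transfer0 M p f) =
    sum_integral V q nu (fun i x => f i x)) :
  let nm := sum_norm q (@Ainf_norm R n U) in
  exists L : Cx R -> {ffun 'I_k -> Ainf U} -> {ffun 'I_k -> Ainf U},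
    (forall t, is_transfer_op M p t (L t)) /\
    exists (eps : R) (beta : Cx R -> Cx R)
      (N Q : Cx R -> {ffun 'I_k -> Ainf U} -> {ffun 'I_k -> Ainf U}),
    [/\ 0 < eps,
      (forall t, cmod t < eps ->
        [/\ bounded_op nm (L t) /\ bounded_op nm (Q t),
            forall w, L t w = beta t *: N t w + Q t w,
            max_modulus_eigenvalue (L t) (beta t),
            rank_one_projection nm (N t) /\
            (spectral_radius nm (Q t) < (cmod (beta t))%:E)%E &
            forall w, N t (Q t w) = 0 /\ Q t (N t w) = 0]),
      (forall t, cmod t < eps ->
        [/\ scalar_analytic_at beta t, op_analytic_at nm N t
          & op_analytic_at nm Q t]),
      beta 0 = 1 /\
      (exists NC : {ffun 'I_k -> Cbar V} -> {ffun 'I_k -> Cbar V},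
        [/\ induced_op q (N 0) NC,
            forall NC', induced_op q (N 0) NC' -> NC' = NC &
            forall (f : {ffun 'I_k -> Cbar V}) i x, closure V x ->
              NC f i x = sum_integral V q nu (fun j y => f j y)]) &
      exists D, op_derivative nm Q 0 D /\ (opnorm nm D < +oo)%E].
Proof.
move=> nm.
(* By stationarity [q j] is an average, with weights [q i], of the positive entries [p i j]. *)
have qpos j : 0 < q j.
  have [dl dl0 dlp] := finite_lbound (fun i => hppos i j).
  apply: (lt_le_trans dl0); rewrite -hqstat -[leLHS]mul1r -hqsum mulr_suml.
  by apply: ler_sum => i _; apply: ler_wpM2l.
have [r r0 Ur] := bounded_set_cmod hUbnd.
have Vr x : V x -> forall i, `|x i 0| <= r.
  by move=> Vx i; rewrite -cmod_toC; have := Ur _ (hVU x Vx) i; rewrite mxE.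
have [z0 Uz0] := hUne.
have V0 : V !=set0 by exists (mxRe z0); rewrite hV; exists z0.
have [L hL] := transfer_exists p hMpos hUpos hUopen hMU hell.
exists L; split=> //.
have [e e1] := one_exists k hUopen.
have [gam [gam0 gam1 Losc]] := transfer0_osc hk hppos hpsum hUbnd hUne hUconn hUopen hMU hL.
(* [m^-1] is one constant in the equivalence of the weighted norm with the supremum over all
   components and points; the other is 1, as the weights sum to 1. *)
have [m m0 mq] := finite_lbound qpos.
have norm0 (f : Ainf U) : 0 <= Ainf_norm f.
  exact: le_trans (cmod_ge0 _) (Ainf_norm_ge hUopen f hUbnd Uz0).
have nm_ev f : bdd (@evp R n k U) f (m^-1 * nm f).
  move=> [i [z Uz]]; rewrite /evp /= ler_pdivlMl // /nm /sum_norm (bigD1 i) //=.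
  apply: ler_wpDr; first by apply: sumr_ge0 => j _; rewrite mulr_ge0.
  by apply: ler_pM; rewrite ?cmod_ge0 ?(ltW m0) //; exact: Ainf_norm_ge.
have nm_le f B : bdd (@evp R n k U) f B -> nm f <= B.
  move=> fB; rewrite -[leRHS]mul1r -hqsum mulr_suml; apply: ler_sum => i _.
  apply: ler_wpM2l => //; apply: Ainf_norm_le => // z Uz.
  exact: (fB (i, exist _ z Uz)).
have m'0 : 0 < m^-1 by rewrite invr_gt0.
have [eps [beta [N [Q [eps0 spec an [beta0 NP] QD]]]]] :=
  gap_perturbation (Ordinal hk, exist _ z0 Uz0) (@evp_lin R n k U) (@evp_inj R n k U) e1
    (evp_bounded hUbnd hUopen) (evp_complete hUopen) m'0 nm_ev nm_le gam0 gam1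
    (transfer_lin hL) (transfer0_one hMpos hpsum hUpos hMU hL e1) Losc
    (transfer0_bdd hMpos hppos hpsum hUpos hMU hL)
    (transfer_pert hMpos hppos hpsum hUpos hUbnd hUopen hMU hell hL)
    (transfer_hol hMpos hUpos hMU hL).
exists eps, beta, N, Q; split=> //; split=> //.
have /choice[cst cstP] : forall c : R, exists g : Cbar V, forall x, closure V x -> g x = c.
  by move=> c; apply: Cbar_build => x; exact: cvg_cst.
pose I (f : {ffun 'I_k -> Cbar V}) := sum_integral V q nu (fun i x => f i x).
pose NC (f : {ffun 'I_k -> Cbar V}) : {ffun 'I_k -> Cbar V} := [ffun=> cst (I f)].
have NCE f i x : closure V x -> NC f i x = I f by move=> Vx; rewrite ffunE cstP.
have NCind : induced_op q (N 0) NC.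
  split; last first.
    move=> w f wf i x Vx; have [c -> cP] := NP w.
    rewrite NCE; last exact: subset_closure.
    rewrite -(limit_sum_integral hqpos hqsum Vr hnusupp hVpos hMpos hMV hVU hnuinv hL hk V0 e1 wf cP).
    by rewrite ffunE AinfZE -[RHS]mulr1 -(e1 (i, exist _ _ (hVU x Vx))).
  split.
    move=> c f g; apply/ffunP => i; apply: Cbar_ext => x Vx.
    rewrite NCE // [I _](sum_integral_lin q Vr hnusupp) !ffunE CbarDE CbarZE !cstP //.
  exists 1 => f; rewrite mul1r.
  apply: le_trans (sum_integral_norm_le hqpos Vr hnusupp f).
  by apply: sum_Cbar_norm_le => // i x Vx; rewrite NCE.
exists NC; split=> // NC' NC'ind.
exact: (induced_op_unique qpos hqsum r0 Vr hVpos hUopen V0 hVU NC'ind NCind).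
Qed.
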